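(* There exist absolute constants $0<A<B<\infty$ and, for every dyadic integer $R\ge 2$ (that is, $R=2^{j_{\max}}$ with $j_{\max}\ge1$ an integer) and every $s>1$, a frame $\{\psi_\nu\}_{\nu\in\mathcal{I}}$ for $L^2(D(R))$ with frame constants $A,B$ (independent of $R$ and $s$), such that the following holds. Let $S\subset\mathbb{R}^2$ be a well-shaped domain. Then there is a constant $C>0$, depending only on $s$ and $S$ (in particular independent of $R$ and $\varepsilon$), such that for every dyadic integer $R\ge2$ and every $\varepsilon\in(0,1/2)$ there exists a partition of the index set $\mathcal{I}=\mathcal{I}_1\cup\mathcal{I}_2\cup\mathcal{I}_3$ of the frame associated with $(R,s)$ satisfying $$\sum_{\nu\in\mathcal{I}_1}\|\widehat{\psi_\nu}\|_{L^2(S)}^2+\sum_{\nu\in\mathcal{I}_2}\|\widehat{\psi_\nu}\|_{L^2(\mathbb{R}^2\setminus S)}^2\le\varepsilon^2$$ and $$\#\mathcal{I}_3\le C\,R\,\bigl(\log(R/\varepsilon)\bigr)^{1+2s}.$$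
   Context: $D(R)\subset\mathbb{R}^2$ is the disk of radius $R$ centered at the origin; $L^2(D(R))$ is identified with the subspace of $L^2(\mathbb{R}^2)$ of functions vanishing outside $D(R)$. $\log$ is the base-2 logarithm. The Fourier transform is $\widehat f(\xi)=\frac{1}{2\pi}\int_{\mathbb{R}^2} f(x)e^{-ix\cdot\xi}\,dx$, extended to $L^2(\mathbb{R}^2)$. A family $\{f_\nu\}$ in a Hilbert space $H$ is a frame with frame constants $0<A\le B<\infty$ if $A\|f\|^2\le\sum_\nu|\langle f,f_\nu\rangle|^2\le B\|f\|^2$ for all $f\in H$. A domain is a bounded, open, connected subset of $\mathbb{R}^2$. A domain $S\subset\mathbb{R}^2$ is called well-shaped if its boundary $\partial S$ has finite one-dimensional Hausdorff measure $\mathcal{H}^1(\partial S)$ and there is a constant $C'>0$ such that for all $t>0$, $|\{x\in\mathbb{R}^2:\operatorname{dist}(x,\partial S)\le t\}|\le C'\max\{t^2,\ t\,\mathcal{H}^1(\partial S)\}$, where $|\cdot|$ is Lebesgue measure. *)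

(* Defs.v *)
From HB Require Import structures.
From mathcomp Require Import all_boot all_order all_algebra.
From mathcomp Require Import finmap complex.
From mathcomp Require Import all_classical all_reals all_analysis.
From mathcomp Require Import measurable_realfun lra.

Set Implicit Arguments.
Unset Strict Implicit.
Unset Printing Implicit Defensive.

Import Order.TTheory GRing.Theory Num.Theory.
Import numFieldNormedType.Exports.

Local Open Scope classical_set_scope.
Local Open Scope ring_scope.
Local Open Scope complex_scope.

Section Plane.
Variable R : realType.
Implicit Types (x y xi : R * R) (E U S D : set (R * R)).

Definition leb2 := (@lebesgue_measure R \x @lebesgue_measure R)%E.

Definition dot2 x y : R := x.1 * y.1 + x.2 * y.2.

(* The library norm on R * R is the max norm; it induces the same topology and
   bounded sets, but metric quantities below need the Euclidean one. *)
Definition enorm2 x : R := Num.sqrt (dot2 x x).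

Definition disk (r : R) : set (R * R) := [set x | enorm2 x < r].

(* +oo when E is empty. *)
Definition dist2 x E : \bar R := ereal_inf [set (enorm2 (x - y))%:E | y in E].

(* The outer maxe gives the empty set diameter 0. *)
Definition diam2 U : \bar R :=
  maxe 0%E (ereal_sup [set (enorm2 (p.1 - p.2))%:E | p in U `*` U]).

Definition hausdorff1_pre (delta : R) E : \bar R :=
  ereal_inf [set (\sum_(0 <= i <oo) diam2 (U i))%E |
    U in [set U : (set (R * R))^nat |
      E `<=` \bigcup_i U i /\ forall i, (diam2 (U i) <= delta%:E)%E]].

Definition hausdorff1 E : \bar R :=
  ereal_sup [set hausdorff1_pre delta E | delta in [set d : R | 0 < d]].

Definition boundary S : set (R * R) := closure S `\` interior S.

Definition domain2 S : Prop := [/\ bounded_set S, open S & connected S].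

Definition well_shaped S : Prop :=
  [/\ domain2 S,
      (hausdorff1 (boundary S) < +oo)%E &
      exists2 C' : R, 0 < C' & forall t : R, 0 < t ->
        (leb2 [set x | dist2 x (boundary S) <= t%:E] <=
          C'%:E * maxe (t ^+ 2)%:E (t%:E * hausdorff1 (boundary S)))%E].

Implicit Types f g : R * R -> R[i].

Definition cintegral f : R[i] :=
  Rintegral leb2 setT (fun x => complex.Re (f x)) +i*
  Rintegral leb2 setT (fun x => complex.Im (f x)).

Definition L2sqnorm D f : \bar R :=
  (\int[leb2]_(x in D) (Normc.normc (f x) ^+ 2)%:E)%E.

(* Elements of L^2 are given by Borel representatives. *)
Definition L2plane : set (R * R -> R[i]) :=
  [set f | [/\ measurable_fun setT (fun x => complex.Re (f x)),
               measurable_fun setT (fun x => complex.Im (f x)) &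
               (L2sqnorm setT f < +oo)%E]].

Definition L2disk (r : R) : set (R * R -> R[i]) :=
  [set f | L2plane f /\ forall x, ~ disk r x -> f x = 0].

Definition inner2 f g : R[i] := cintegral (fun x => f x * conjc (g x)).

Definition is_frame (H : set (R * R -> R[i])) (I : choiceType)
    (psi : I -> R * R -> R[i]) (A B : R) : Prop :=
  [/\ 0 < A <= B,
      forall nu, H (psi nu) &
      forall f, H f ->
        (A%:E * L2sqnorm setT f <=
           \esum_(nu in setT) (Normc.normc (inner2 f (psi nu)) ^+ 2)%:E)%E /\
        (\esum_(nu in setT) (Normc.normc (inner2 f (psi nu)) ^+ 2)%:E <=
           B%:E * L2sqnorm setT f)%E].

Definition expNi (t : R) : R[i] := cos t -i* sin t.

(* The integral formula. On L2disk r it is the L^2 Fourier transform, because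
   elements of L2disk r are also in L^1 (L2disk_integrable below). *)
Definition fourier2 f xi : R[i] :=
  ((2 * pi)^-1)%:C * cintegral (fun x => f x * expNi (dot2 x xi)).

Definition log2 (a : R) : R := ln a / ln 2.

End Plane.

Lemma L2disk_integrable (R : realType) (r : R) (f : R * R -> R[i]) :
  L2disk r f ->
  (@leb2 R).-integrable setT (fun x => (complex.Re (f x))%:E) /\
  (@leb2 R).-integrable setT (fun x => (complex.Im (f x))%:E).
Proof.
case=> -[mRe mIm fin] f0.
pose g : R * R -> R :=
  fun x => \1_(`[- r, r] `*` `[- r, r]) x + Normc.normc (f x) ^+ 2.
have mbox : measurable ((`[- r, r] `*` `[- r, r]) : set (R * R))
  by exact: measurableX.
have normE x : Normc.normc (f x) ^+ 2 = complex.Re (f x) ^+ 2 +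
    complex.Im (f x) ^+ 2.
  by case: (f x) => a b /=; rewrite sqr_sqrtr// addr_ge0// sqr_ge0.
have msq : measurable_fun setT (fun x => Normc.normc (f x) ^+ 2).
  under eq_fun do rewrite normE.
  by apply: measurable_funD; apply: measurable_funX.
have ig : (@leb2 R).-integrable setT (EFin \o g).
  have -> : EFin \o g = (fun x => (\1_(`[- r, r] `*` `[- r, r]) x)%:E) \+
      (fun x => (Normc.normc (f x) ^+ 2)%:E) by [].
  apply: integrableD => //; apply/integrableP; split.
  - apply/measurable_EFinP. exact: measurable_indic.
  - under eq_integral do rewrite gee0_abs ?lee_fin//.
    rewrite integral_indic// setIT.
    rewrite [ltLHS](_ : _ = (lebesgue_measure (`[(- r)%R, r] : set R) *
        lebesgue_measure (`[(- r)%R, r] : set R))%E); last first.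
      by apply: product_measure1E; exact: measurable_itv.
    rewrite !lebesgue_measure_itv/=.
    by case: ifP => // _; rewrite ?mule0// ltry.
  - exact/measurable_EFinP.
  - under eq_integral do rewrite gee0_abs ?lee_fin ?sqr_ge0//.
    exact: fin.
have bnd x : 0 <= g x /\ (`|complex.Re (f x)| <= g x) /\ (`|complex.Im (f x)| <= g x).
  have g0 : 0 <= g x by rewrite addr_ge0 ?sqr_ge0// indicE.
  split => //.
  have [dx|dx] := pselect (disk r x); last first.
    by rewrite (f0 _ dx)/= normr0.
  have bx : (`[- r, r] `*` `[- r, r]) x.
    have aux (a b : R) : Num.sqrt (a * a + b * b) < r -> - r <= a <= r.
      move=> h; rewrite -ler_norml; apply/ltW/(le_lt_trans _ h).
      by rewrite -sqrtr_sqr ler_sqrt ?addr_ge0 -?expr2 ?sqr_ge0// lerDl sqr_ge0.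
    move: dx; rewrite /disk /enorm2 /dot2 /= => dx.
    by split; rewrite /= in_itv/=; [|rewrite addrC in dx]; exact: aux dx.
  rewrite /g indicE mem_set// normE.
  have aux (a b : R) : `|a| <= 1 + (a ^+ 2 + b ^+ 2).
    rewrite ler_norml; have := sqr_ge0 b; nra.
  by split; [|rewrite [_ ^+ 2 + _]addrC]; exact: aux.
split; apply: (le_integrable _ _ _ ig) => //=.
- exact/measurable_EFinP.
- move=> x _; have [g0 [h _]] := bnd x; by rewrite lee_fin [leRHS]ger0_norm.
- exact/measurable_EFinP.
- move=> x _; have [g0 [_ h]] := bnd x; by rewrite lee_fin [leRHS]ger0_norm.
Qed.

(* Main.v *)
Require Import Defs.
From Stdlib Require Import PeanoNat.
From mathcomp Require Import all_boot all_order all_algebra.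
From mathcomp Require Import finmap.
From mathcomp Require Import all_classical all_reals all_analysis complex.
From mathcomp Require Import measurable_realfun ring lra zify.

Set Implicit Arguments.
Unset Strict Implicit.
Unset Printing Implicit Defensive.

Import Order.TTheory GRing.Theory Num.Theory.
Import numFieldNormedType.Exports.

Local Open Scope classical_set_scope.
Local Open Scope ring_scope.

(* The frame is a union of orthonormal systems, each localised on one cell of a Whitney
   decomposition of the disk: a cell at distance about l = 2^k from the circle is a square of
   side about l.  On such a square the system is a smooth window times the exponentials
   exp(i pi n.x / l); the cells that meet the unit neighbourhood of the circle carry instead
   the orthonormal polynomials of the part of the cell inside the disk.  By Parseval on each
   cell the frame operator is multiplication by a sum of squared windows, which lies between
   1 and 49.

   The window is a trapezoid averaged over infinitely many intervals of lengths about
   l i^(-s), so its Fourier transform is a product of cardinal sines and decays like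
   exp(- c (l |xi|)^(1/s)).  With L = log2 (R / eps), a packet whose frequency pi n / l is
   farther than t = K L^s / l from the boundary of S therefore has energy about (eps / R)^N on
   the wrong side of it.  The exceptional frequencies of a cell lie in a t-tube around the
   boundary of S; they form a lattice of mesh pi / l, so there are O(l L^(2s)) of them, and
   O(R / l) cells of scale l contribute O(R L^(2s)); there are at most L scales.  On the
   O(R) cells at the circle, the m-th polynomial is orthogonal to all polynomials of degree
   below sqrt m in each variable, so its Fourier transform is superexponentially small on S by
   Taylor expansion, and only O(L^2) indices are exceptional. *)

(** * Orthonormal systems in L^2 of the plane *)

(** Frame elements must vanish outside the disk, so a smooth window cannot reach the circle. The
    last unit layer therefore needs sharply cut cells, and there polynomials replace exponentials,
    whose transforms would decay too slowly after the cut. A window of compact support cannot decay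
    exponentially in frequency; the averaging lengths must have a finite sum, and this is where
    [1 < s] enters. Their total is kept below an eighth of the scale for every [s], so all windows
    equal 1 on the same half-size square and live on the same square; hence frame bounds free of
    [s]. A frame asks only for two-sided bounds, so the windows are never normalised to a partition
    of unity. Every cell carries infinitely many packets, so smallness of single packets is not
    enough: each energy bound carries a summable factor [1 / ((m + 1)(m + 2))], paid for by part of
    the decay. Losses polynomial in [R], such as the number of cells, are absorbed by a power [N] of
    [eps / R] that is fixed in terms of [S] and [s] alone. *)

Section L2.
Variable R : realType.
Notation T := (R * R)%type.
Notation mu := (@leb2 R).
Implicit Types (u v w : T -> R) (F G H : T -> R[i]).

Definition L2real u := measurable_fun setT u /\ (\int[mu]_x (u x ^+ 2)%:E < +oo)%E.

Definition rinner u v : R := Rintegral mu setT (fun x => u x * v x).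

Lemma L2real_integrable u v : L2real u -> L2real v -> mu.-integrable setT (fun x => (u x * v x)%:E).
Proof.
move=> [mu_ u2] [mv v2].
have mm : measurable_fun setT (fun x => u x ^+ 2 + v x ^+ 2).
  by apply: measurable_funD; exact: measurable_funX.
have i2 w : measurable_fun setT w -> (\int[mu]_x (w x ^+ 2)%:E < +oo)%E ->
    mu.-integrable setT (fun x => (w x ^+ 2)%:E).
  move=> mw w2; apply/integrableP; split.
    exact/measurable_EFinP/measurable_funX.
  by under eq_integral do rewrite gee0_abs ?lee_fin ?sqr_ge0//.
apply: (@le_integrable _ _ _ mu setT _ _ (fun x => ((u x ^+ 2)%:E + (v x ^+ 2)%:E)%E)) => //.
- exact/measurable_EFinP/measurable_funM.
- move=> x _; rewrite -EFinD /= lee_fin [leRHS]ger0_norm ?addr_ge0 ?sqr_ge0//.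
  rewrite ler_norml; have := sqr_ge0 (u x - v x); have := sqr_ge0 (u x + v x).
  rewrite !expr2; nra.
- by apply: integrableD => //; exact: i2.
Qed.

Lemma L2real_sqr_int u : L2real u -> (\int[mu]_x (u x ^+ 2)%:E)%E = (rinner u u)%:E.
Proof.
move=> hu; rewrite /rinner /Rintegral.
under [in RHS]eq_integral do rewrite -expr2.
rewrite fineK// ge0_fin_numE; first by case: hu.
by apply: integral_ge0 => x _; rewrite lee_fin sqr_ge0.
Qed.

Lemma L2realD u v : L2real u -> L2real v -> L2real (fun x => u x + v x).
Proof.
move=> hu hv; have [m1 i1] := hu; have [m2 i2] := hv; split.
  exact: measurable_funD.
have -> : (fun x => ((u x + v x) ^+ 2)%:E) =
   (fun x => (u x * u x)%:E + (u x * v x)%:E)%E \+ (fun x => (u x * v x)%:E + (v x * v x)%:E)%E.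
  by apply/funext => x; rewrite /= -!EFinD; congr EFin; ring.
apply: integrable_lty => //.
by apply: integrableD => //; apply: integrableD => //; exact: L2real_integrable.
Qed.

Lemma L2realZ (b : R) u : L2real u -> L2real (fun x => b * u x).
Proof.
move=> hu; have [m1 i1] := hu; split.
  exact: measurable_funM.
have -> : (fun x => ((b * u x) ^+ 2)%:E) = (fun x => (b ^+ 2)%:E * (u x * u x)%:E)%E.
  by apply/funext => x; rewrite /= -!EFinM; congr EFin; ring.
apply: integrable_lty => //.
by apply: integrableZl => //; exact: L2real_integrable.
Qed.

Lemma rinnerC u v : rinner u v = rinner v u.
Proof. by rewrite /rinner; congr Rintegral; apply/funext => x; rewrite mulrC. Qed.

Lemma rinnerDl u v w : L2real u -> L2real v -> L2real w ->
  rinner (fun x => u x + v x) w = rinner u w + rinner v w.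
Proof.
move=> hu hv hw; rewrite /rinner -RintegralD//; [|exact: L2real_integrable..].
by congr Rintegral; apply/funext => x; rewrite mulrDl.
Qed.

Lemma rinnerZl (b : R) u v : L2real u -> L2real v -> rinner (fun x => b * u x) v = b * rinner u v.
Proof.
move=> hu hv; rewrite /rinner -RintegralZl//; last exact: L2real_integrable.
by congr Rintegral; apply/funext => x; rewrite mulrA.
Qed.

Lemma rinner_ge0 u : 0 <= rinner u u.
Proof. by apply: Rintegral_ge0 => x _; rewrite -expr2 sqr_ge0. Qed.

End L2.

Section Complex.
Variable R : realType.
Notation T := (R * R)%type.
Notation mu := (@leb2 R).
Local Open Scope complex_scope.
Implicit Types (u v w : T -> R) (F G H : T -> R[i]) (b : R[i]).
Local Notation re F := (fun x => complex.Re (F x)).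
Local Notation im F := (fun x => complex.Im (F x)).

(** The squared modulus as a polynomial in the real and imaginary parts, within reach of [ring] and
    [nra]; [Normc.normc] carries a square root. *)
Definition nsq (z : R[i]) : R := complex.Re z ^+ 2 + complex.Im z ^+ 2.

Lemma nsqE z : Normc.normc z ^+ 2 = nsq z.
Proof. by case: z => a c /=; rewrite /nsq sqr_sqrtr ?addr_ge0 ?sqr_ge0. Qed.

Lemma nsq_ge0 z : 0 <= nsq z.
Proof. by rewrite addr_ge0 ?sqr_ge0. Qed.

Lemma nsqM y z : nsq (y * z) = nsq y * nsq z.
Proof. by case: y => a b; case: z => c d; rewrite /nsq /=; ring. Qed.

Lemma nsqD y z : nsq (y + z) <= 2 * (nsq y + nsq z).
Proof.
case: y => a b; case: z => c d; rewrite /nsq /=.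
have := sqr_ge0 (a - c); have := sqr_ge0 (b - d); rewrite !expr2; nra.
Qed.

(** The real part of [inner2]: the real inner product whose norm is the $L^2$ norm of complex
    functions. *)
Definition reinner F G : R := rinner (re F) (re G) + rinner (im F) (im G).

Definition N2 F : R := reinner F F.

Lemma L2planeP F : L2plane F <-> L2real (re F) /\ L2real (im F).
Proof.
have E : L2sqnorm setT F = (\int[mu]_x ((complex.Re (F x) ^+ 2)%:E + (complex.Im (F x) ^+ 2)%:E))%E.
  by apply: eq_integral => x _; rewrite nsqE.
split.
- case=> m1 m2 fin.
  have aux w : measurable_fun setT w -> (forall x, w x ^+ 2 <= nsq (F x)) -> L2real w.
    move=> mw wF; split=> //; apply: le_lt_trans fin.
    apply: ge0_le_integral => //.
    + by move=> x _; rewrite lee_fin sqr_ge0.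
    + exact/measurable_EFinP/measurable_funX.
    + apply/measurable_EFinP; under eq_fun do rewrite nsqE.
      by apply: measurable_funD; exact: measurable_funX.
    + by move=> x _; rewrite lee_fin nsqE.
  by split; apply: aux => // x; rewrite /nsq ?lerDl ?lerDr sqr_ge0.
- case=> -[m1 i1] [m2 i2]; split=> //.
  rewrite E ge0_integralD//.
  + exact: lte_add_pinfty.
  + by move=> x _; rewrite lee_fin sqr_ge0.
  + exact/measurable_EFinP/measurable_funX.
  + by move=> x _; rewrite lee_fin sqr_ge0.
  + exact/measurable_EFinP/measurable_funX.
Qed.

Lemma L2sqnormE F : L2plane F -> L2sqnorm setT F = (N2 F)%:E.
Proof.
move=> /L2planeP[h1 h2]; rewrite /N2 /reinner EFinD -!L2real_sqr_int//.
rewrite -ge0_integralD//.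
+ by apply: eq_integral => x _; rewrite nsqE.
+ by move=> x _; rewrite lee_fin sqr_ge0.
+ by apply/measurable_EFinP/measurable_funX; case: h1.
+ by move=> x _; rewrite lee_fin sqr_ge0.
+ by apply/measurable_EFinP/measurable_funX; case: h2.
Qed.

Lemma N2_ge0 F : 0 <= N2 F.
Proof. by rewrite addr_ge0 ?rinner_ge0. Qed.

Lemma inner2E F G : L2plane F -> L2plane G ->
  inner2 F G = reinner F G +i* (rinner (im F) (re G) - rinner (re F) (im G)).
Proof.
move=> /L2planeP[f1 f2] /L2planeP[g1 g2].
rewrite /inner2 /cintegral; congr (_ +i* _).
  rewrite /reinner /rinner -RintegralD//; [|exact: L2real_integrable..].
  by congr Rintegral; apply/funext => x; case: (F x); case: (G x) => * /=; ring.
rewrite /rinner -RintegralB//; [|exact: L2real_integrable..].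
by congr Rintegral; apply/funext => x; case: (F x); case: (G x) => * /=; ring.
Qed.

Lemma L2planeD F G : L2plane F -> L2plane G -> L2plane (fun x => F x + G x).
Proof.
move=> /L2planeP[f1 f2] /L2planeP[g1 g2]; apply/L2planeP; split.
  rewrite (_ : (fun x => _) = (fun x => complex.Re (F x) + complex.Re (G x))).
    exact: L2realD.
  by apply/funext => x; case: (F x); case: (G x).
rewrite (_ : (fun x => _) = (fun x => complex.Im (F x) + complex.Im (G x))).
  exact: L2realD.
by apply/funext => x; case: (F x); case: (G x).
Qed.

Lemma L2planeZ b F : L2plane F -> L2plane (fun x => b * F x).
Proof.
case: b => p q; move=> /L2planeP[f1 f2]; apply/L2planeP; split.
  rewrite (_ : (fun x => _) = (fun x => p * complex.Re (F x) + (- q) * complex.Im (F x))).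
    by apply: L2realD; exact: L2realZ.
  by apply/funext => x; case: (F x) => c d /=; ring.
rewrite (_ : (fun x => _) = (fun x => p * complex.Im (F x) + q * complex.Re (F x))).
  by apply: L2realD; exact: L2realZ.
by apply/funext => x; case: (F x) => c d /=; ring.
Qed.

Lemma L2planeB b F G : L2plane F -> L2plane G -> L2plane (fun x => F x - b * G x).
Proof.
move=> hF hG; under eq_fun do rewrite -mulNr.
by apply: L2planeD => //; exact: L2planeZ.
Qed.

Lemma L2plane0 : @L2plane R (fun=> 0).
Proof.
apply/L2planeP; split; split=> //=; under eq_integral do rewrite expr0n/=;
  by rewrite integral0.
Qed.

Lemma L2plane_sum (e : nat -> T -> R[i]) (b : nat -> R[i]) N :
  (forall m, L2plane (e m)) -> L2plane (fun x => \sum_(m < N) b m * e m x).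
Proof.
move=> he; elim: N => [|N IH].
  by under eq_fun do rewrite big_ord0; exact: L2plane0.
under eq_fun do rewrite big_ord_recr/=.
by apply: L2planeD => //; exact: L2planeZ.
Qed.

Lemma reB b F G : re (fun x => F x - b * G x) =
  (fun x => complex.Re (F x) + (((- complex.Re b) * complex.Re (G x)) + complex.Im b * complex.Im (G x))).
Proof. by apply/funext => x; case: b; case: (F x); case: (G x) => * /=; ring. Qed.

Lemma imB b F G : im (fun x => F x - b * G x) =
  (fun x => complex.Im (F x) + (((- complex.Re b) * complex.Im (G x)) + (- complex.Im b) * complex.Re (G x))).
Proof. by apply/funext => x; case: b; case: (F x); case: (G x) => * /=; ring. Qed.

Let rinner_lin u v w z (p q : R) : L2real u -> L2real v -> L2real w -> L2real z ->
  rinner (fun x => u x + (p * v x + q * w x)) z = rinner u z + (p * rinner v z + q * rinner w z).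
Proof.
move=> hu hv hw hz.
rewrite (rinnerDl hu (L2realD (L2realZ p hv) (L2realZ q hw)) hz) (rinnerDl (L2realZ p hv) (L2realZ q hw) hz).
by rewrite !rinnerZl.
Qed.

Lemma inner2Bl b F G H : L2plane F -> L2plane G -> L2plane H ->
  inner2 (fun x => F x - b * G x) H = inner2 F H - b * inner2 G H.
Proof.
move=> hF hG hH; rewrite !inner2E//; last exact: L2planeB.
move: hF hG hH => /L2planeP[f1 f2] /L2planeP[g1 g2] /L2planeP[h1 h2].
rewrite /reinner reB imB !rinner_lin//.
by case: b => p q /=; congr (_ +i* _); ring.
Qed.

(** The one quadratic expansion behind the norm estimates: completing the square in [N2_resid], the
    parallelogram bound [N2D] and the homogeneity [N2Z] are all instances. *)
Lemma N2B b F G : L2plane F -> L2plane G ->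
  N2 (fun x => F x - b * G x) =
  N2 F - 2 * complex.Re (conjc b * inner2 F G) + nsq b * N2 G.
Proof.
move=> hF hG; rewrite inner2E//.
move: hF hG => /L2planeP[f1 f2] /L2planeP[g1 g2].
have hr := L2realD f1 (L2realD (L2realZ (- complex.Re b) g1) (L2realZ (complex.Im b) g2)).
have hi := L2realD f2 (L2realD (L2realZ (- complex.Re b) g2) (L2realZ (- complex.Im b) g1)).
rewrite /N2 /reinner reB imB !rinner_lin//.
rewrite ![rinner _ (fun x => _ + _)]rinnerC !rinner_lin//.
rewrite [rinner (re G) (re F)]rinnerC [rinner (im G) (im F)]rinnerC.
rewrite [rinner (re G) (im F)]rinnerC [rinner (im G) (re F)]rinnerC [rinner (im G) (re G)]rinnerC.
by case: b {hr hi} => p q; rewrite /nsq /=; ring.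
Qed.

Lemma eq_N2 F G : (forall x, F x = G x) -> N2 F = N2 G.
Proof. by move=> /funext ->. Qed.

(** Parallelogram law with the norm of [F - G] discarded. *)
Lemma N2D F G : L2plane F -> L2plane G ->
  N2 (fun x => F x + G x) <= 2 * (N2 F + N2 G).
Proof.
move=> hF hG.
have -> : (fun x => F x + G x) = (fun x => F x - (-1) * G x).
  by apply/funext => x; rewrite mulN1r opprK.
have := N2_ge0 (fun x => F x - 1 * G x).
rewrite !N2B//= /nsq/=.
by case: (inner2 F G) => p q /=; lra.
Qed.

Lemma N2Z b F : L2plane F -> N2 (fun x => b * F x) = nsq b * N2 F.
Proof.
move=> hF.
have -> : (fun x => b * F x) = (fun x => 0 - (- b) * F x).
  by apply/funext => x; rewrite sub0r mulNr opprK.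
have h0 := L2plane0.
have z u : rinner (fun=> 0) u = 0.
  rewrite /rinner; under eq_Rintegral do rewrite mul0r.
  by rewrite Rintegral_cst// mul0r.
rewrite (N2B (- b) h0 hF) inner2E// /N2 /reinner/= !z/=.
by case: b => p q; rewrite /nsq/=; ring.
Qed.

Lemma N2_0 : N2 (fun=> 0 : R[i]) = 0.
Proof.
have n0 : nsq (0 : R[i]) = 0 by rewrite /nsq/= expr0n addr0.
have h := N2Z 0 L2plane0; by move: h; rewrite n0 !mul0r.
Qed.

End Complex.

(** * Bessel and Parseval for orthogonal systems of unit or zero vectors *)

Section Parseval.
Variable R : realType.
Notation T := (R * R)%type.
Local Open Scope complex_scope.
Variable e : nat -> T -> R[i].
Implicit Types (g : T -> R[i]) (b : nat -> R[i]).
Hypothesis eL2 : forall m, L2plane (e m).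
Hypothesis orth : forall m k, m <> k -> inner2 (e m) (e k) = 0.
Hypothesis unit_or_zero : forall m, e m = (fun=> 0) \/ N2 (e m) = 1.

Lemma L2plane_resid g b N : L2plane g -> L2plane (fun x => g x - \sum_(m < N) b m * e m x).
Proof.
move=> hg.
have := L2planeB 1 hg (L2plane_sum b N eL2).
by under eq_fun do rewrite mul1r.
Qed.

Lemma inner2_resid g b N k : L2plane g -> (N <= k)%N ->
  inner2 (fun x => g x - \sum_(m < N) b m * e m x) (e k) = inner2 g (e k).
Proof.
move=> hg; elim: N => [_|N IH Nk].
  by congr inner2; apply/funext => x; rewrite big_ord0 subr0.
rewrite -(IH (ltnW Nk)).
have -> : (fun x => g x - \sum_(m < N.+1) b m * e m x) =
    (fun x => (g x - \sum_(m < N) b m * e m x) - b N * e N x).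
  by apply/funext => x; rewrite big_ord_recr/= opprD addrA.
rewrite inner2Bl//; last exact: L2plane_resid.
by rewrite orth ?mulr0 ?subr0// => NE; rewrite NE ltnn in Nk.
Qed.

(** Completing the square one coefficient at a time: by orthogonality the partial residual still has
    inner product [inner2 g (e N)] with the next vector. The weight [N2 (e m)] in the last sum lets
    a zero vector take any coefficient at no cost. *)
Lemma N2_resid g b N : L2plane g ->
  N2 (fun x => g x - \sum_(m < N) b m * e m x) =
  N2 g - \sum_(m < N) nsq (inner2 g (e m)) + \sum_(m < N) N2 (e m) * nsq (b m - inner2 g (e m)).
Proof.
move=> hg; elim: N => [|N IH].
  rewrite !big_ord0 subr0 addr0; apply: eq_N2 => x; by rewrite big_ord0 subr0.
have -> : (fun x => g x - \sum_(m < N.+1) b m * e m x) =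
    (fun x => (g x - \sum_(m < N) b m * e m x) - b N * e N x).
  by apply/funext => x; rewrite big_ord_recr/= opprD addrA.
rewrite N2B//; last exact: L2plane_resid.
rewrite IH inner2_resid// !big_ord_recr/=.
set s1 := \sum_(i < N) _; set s2 := \sum_(i < N) _.
have [e0|e1] := unit_or_zero N; last first.
  rewrite e1; case: (b N) => p q; case: (inner2 g (e N)) => c d.
  rewrite /nsq/=; ring.
have -> : inner2 g (e N) = 0.
  rewrite e0 inner2E//; last exact: L2plane0.
  rewrite /reinner/=.
  have z (u : T -> R) : rinner u (fun=> 0) = 0.
    rewrite /rinner; under eq_Rintegral do rewrite mulr0.
    by rewrite Rintegral_cst// mul0r.
  by rewrite !z addr0 subr0.
rewrite e0 N2_0 mulr0 /= mulr0 /nsq/= ; ring.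
Qed.

Lemma bessel g N : L2plane g -> \sum_(m < N) nsq (inner2 g (e m)) <= N2 g.
Proof.
move=> hg; have := N2_resid (fun m => inner2 g (e m)) N hg.
rewrite [X in _ = _ + X]big1 => [|m _]; last by rewrite subrr /nsq/= expr0n addr0 mulr0.
by rewrite addr0 -subr_ge0 => <-; exact: N2_ge0.
Qed.

(** Membership in the closed linear span of the system. *)
Definition approximable g := forall d : R, 0 < d -> exists N b,
  N2 (fun x => g x - \sum_(m < N) b m * e m x) <= d.

(** Fourier coefficients are optimal: by [N2_resid], any combination within [d] of [g] forces the
    Bessel sum to within [d] of [N2 g]. *)
Lemma parseval g : L2plane g -> approximable g ->
  (\sum_(0 <= m <oo) (nsq (inner2 g (e m)))%:E = (N2 g)%:E)%E.
Proof.
move=> hg ag; apply/eqP; rewrite eq_le; apply/andP; split.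
  apply: lime_le.
    by apply: is_cvg_nneseries => m _ _; rewrite lee_fin nsq_ge0.
  apply: nearW => N; rewrite big_mkord sumEFin lee_fin; exact: bessel.
apply/lee_addgt0Pr => d d0; have [N [b grid_radius]] := ag d d0.
have h := nneseries_lim_ge N (fun m (_ : (0 <= m)%N) (_ : xpredT m) => nsq_ge0 (inner2 g (e m)) : (0 <= (nsq (inner2 g (e m)))%:E)%E).
apply: le_trans (leeD2r _ h); rewrite big_mkord sumEFin -EFinD lee_fin.
move: grid_radius; rewrite N2_resid//.
have : 0 <= \sum_(m < N) N2 (e m) * nsq (b m - inner2 g (e m)).
  by apply: sumr_ge0 => m _; rewrite mulr_ge0 ?N2_ge0 ?nsq_ge0.
lra.
Qed.

End Parseval.

(** * A density criterion *)

(* V stands for the set of real functions that can be approximated: it suffices to approximate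
   products of indicators of half-lines, by Dynkin's theorem. *)
Section Density.
Variable R : realType.
Notation T := (R * R)%type.
Notation mu := (@leb2 R).
Variable V : (T -> R) -> Prop.
Hypothesis VD : forall u v, V u -> V v -> V (fun x => u x + v x).
Hypothesis VZ : forall b u, V u -> V (fun x => b * u x).
Hypothesis Vlim : forall (u_ : nat -> T -> R) (u G : T -> R),
  (forall n, V (u_ n)) -> (forall n x, `|u_ n x| <= G x) -> L2real G ->
  (forall x, u_ n x @[n --> \oo] --> u x) -> V u.

Lemma V_sum (u_ : nat -> T -> R) n : V (fun=> 0) -> (forall i, V (u_ i)) ->
  V (fun x => \sum_(i < n) u_ i x).
Proof.
move=> V0 Vu; elim: n => [|n IH]; first by under eq_fun do rewrite big_ord0.
by under eq_fun do rewrite big_ord_recr/=; exact: VD.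
Qed.

(** The admissible sets form a Dynkin system: complements by linearity, disjoint unions by bounded
    limits with [g] itself as the dominating function. The map [pr] lets the same argument run on
    either coordinate and on the plane. *)
Lemma V_dynkin d (X : measurableType d) (pr : T -> X) (G : set_system X) (g : T -> R) :
  @measurable _ X = <<s G >> -> setI_closed G ->
  (forall x, 0 <= g x) -> L2real g -> V g ->
  (forall A, G A -> V (fun x => g x * \1_A (pr x))) ->
  forall A, measurable A -> V (fun x => g x * \1_A (pr x)).
Proof.
move=> GE GI g0 Lg Vg VG A mA.
have V0 : V (fun=> 0) by have := VZ 0 Vg; under eq_fun do rewrite mul0r.
apply: (@dynkin_induction _ X G (fun A => V (fun x => g x * \1_A (pr x)))) => //.
- by under eq_fun do rewrite indicT mulr1.
- move=> S mS VS.
  have -> : (fun x => g x * \1_(~` S) (pr x)) = (fun x => g x + (-1) * (g x * \1_S (pr x))).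
    by apply/funext => x; rewrite !indicE in_setC; case: (_ \in _) => /=; ring.
  by apply: VD => //; exact: VZ.
- move=> F mF tF VF.
  apply: (Vlim (u_ := fun n x => \sum_(i < n) (g x * \1_(F i) (pr x))) (G := g)) => //.
  + by move=> n; exact: (V_sum (u_ := fun i x => g x * \1_(F i) (pr x))).
  + move=> n x; rewrite -mulr_sumr.
    (* Disjointness makes the partial sum the indicator of a finite union, hence at most 1. *)
    have : 0 <= (\sum_(i < n) \1_(F i) (pr x) : R) <= 1.
      have -> : \sum_(i < n) \1_(F i) (pr x) = \1_(\big[setU/set0]_(i < n) F i) (pr x) :> R.
        elim: n => [|n IH]; first by rewrite !big_ord0 indic0.
        rewrite !big_ord_recr/= IH !indicE in_setU.
        have [h1|] := boolP (pr x \in F n); last by rewrite orbF addr0.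
        have [h2|] := boolP (pr x \in _); last by rewrite add0r.
        move: h1 h2; rewrite !inE -bigcup_mkord => h1 [i /= ni h2].
        have e := tF i n I I (ex_intro _ _ (conj h2 h1)).
        by rewrite e ltnn in ni.
      by rewrite indicE; case: (_ \in _); rewrite /= ?lexx ?ler01.
    move=> /andP[h1 h2]; rewrite ger0_norm ?mulr_ge0//.
    by rewrite ler_piMr.
  + move=> x.
    have [[k _ Fk]|nF] := pselect ((\bigcup_k F k) (pr x)).
      rewrite indicE mem_set//=; last by exists k.
      rewrite mulr1; apply: cvg_near_cst; exists k.+1 => // n /= kn.
      rewrite (bigD1 (Ordinal kn))//= big1 => [|i ik].
        by rewrite indicE mem_set// mulr1 addr0.
      rewrite indicE memNset ?mulr0// => Fi.
      have := tF i k I I (ex_intro _ _ (conj Fi Fk)) => e.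
      by move/eqP: ik; apply; apply: val_inj.
    rewrite indicE memNset// mulr0; apply: cvg_near_cst; near=> n.
    apply: big1 => i _; rewrite indicE memNset ?mulr0// => Fi; apply: nF.
    by exists i.
- by rewrite -GE.
Unshelve. all: by end_near.
Qed.

(** The whole line is included so that one coordinate can be left free: each Dynkin pass starts from
    a function with a trivial factor in the variable being treated. *)
Definition halfline : set_system R := [set A | A = setT \/ exists a, A = `]-oo, a[%classic].

Lemma halfline_gen : @measurable _ R = <<s halfline >>.
Proof.
rewrite [LHS]RGenInftyO.measurableE eqEsubset; split => A.
  apply: smallest_sub; first exact: smallest_sigma_algebra.
  by move=> B hB; apply: sub_sigma_algebra; right.
apply: smallest_sub; first exact: smallest_sigma_algebra.
move=> B [->|hB]; last exact: sub_sigma_algebra.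
have := @measurableT _ (g_sigma_algebraType (@RGenInftyO.G R)); exact.
Qed.

Lemma halflineI : setI_closed halfline.
Proof.
move=> A B [->|[a ->]]; first by rewrite setTI.
move=> [->|[b ->]]; first by rewrite setIT; right; exists a.
right; exists (Num.min a b); apply/seteqP; split => x /=; rewrite !in_itv/= lt_min.
  by move=> [-> ->].
by move=> /andP[].
Qed.

Variable E : set T.
Hypothesis mE : measurable E.
Hypothesis fE : (mu E < +oo)%E.

Lemma L2real_bounded (u : T -> R) (M : R) : measurable_fun setT u ->
  (forall x, `|u x| <= M * \1_E x) -> L2real u.
Proof.
move=> mu_ uM; split=> //.
apply: (@le_lt_trans _ _ (\int[mu]_x ((M ^+ 2)%:E * (\1_E x)%:E))%E).
  apply: ge0_le_integral => //.
  - by move=> x _; rewrite lee_fin sqr_ge0.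
  - exact/measurable_EFinP/measurable_funX.
  - by apply: measurable_funeM; exact/measurable_EFinP/measurable_indic.
  - move=> x _; rewrite -EFinM lee_fin -(real_normK (num_real (u x))).
    move: (uM x); rewrite indicE; case: (_ \in _) => /=; have := normr_ge0 (u x).
      rewrite !mulr1 => h1 h2; rewrite ler_pXn2r// ?nnegrE//; exact: le_trans h2.
    rewrite !mulr0 => h1 h2; have -> : `|u x| = 0 by lra.
    by rewrite expr0n.
rewrite ge0_integralZl ?lee_fin ?sqr_ge0//; last first.
  exact/measurable_EFinP/measurable_indic.
by rewrite integral_indic// setIT lte_mul_pinfty ?lee_fin ?sqr_ge0.
Qed.

Hypothesis VE : forall A B, halfline A -> halfline B ->
  V (fun x => \1_E x * (\1_A x.1 * \1_B x.2)).

Let m_halfline A : halfline A -> measurable A.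
Proof. by rewrite halfline_gen => h; exact: sub_sigma_algebra. Qed.

Let mfst (A : set R) : measurable A -> measurable_fun setT (fun x : T => \1_A x.1 : R).
Proof. by move=> mA; apply: (measurableT_comp (measurable_indic mA)). Qed.

Let msnd (A : set R) : measurable A -> measurable_fun setT (fun x : T => \1_A x.2 : R).
Proof. by move=> mA; apply: (measurableT_comp (measurable_indic mA)). Qed.

(** Two Dynkin passes: the first coordinate with a half-line fixed in the second, then the second
    coordinate with the measurable set [A] fixed in the first. *)
Lemma V_rect (A B : set R) : measurable A -> measurable B ->
  V (fun x => \1_E x * (\1_A x.1 * \1_B x.2)).
Proof.
have setTh : halfline setT by left.
have i01 (S : set T) x : `|\1_E x * \1_S x : R| <= 1 * \1_E x.
  by rewrite !indicE; case: (_ \in E); case: (_ \in S); rewrite /= ?mul0r ?mul1r ?mulr0 ?normr0 ?normr1.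
have i01' (S : set R) (z : R) x : `|\1_E x * \1_S z : R| <= 1 * \1_E x.
  by rewrite !indicE; case: (_ \in E); case: (_ \in S); rewrite /= ?mul0r ?mul1r ?mulr0 ?normr0 ?normr1.
move=> mA mB.
have step1 A' : measurable A' -> forall B', halfline B' ->
    V (fun x => \1_E x * (\1_A' x.1 * \1_B' x.2)).
  move=> mA' B' hB'.
  have := @V_dynkin _ R fst halfline (fun x => \1_E x * \1_B' x.2) halfline_gen halflineI.
  move=> /(_ _ _ _ _ A' mA') h.
  have -> : (fun x => \1_E x * (\1_A' x.1 * \1_B' x.2)) =
      (fun x => \1_E x * \1_B' x.2 * \1_A' x.1) :> (T -> R).
    by apply/funext => x; rewrite mulrAC mulrA.
  apply: h.
  - by move=> x; rewrite mulr_ge0.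
  - apply: (@L2real_bounded _ 1) => //; apply: measurable_funM; first exact: measurable_indic.
    by apply: msnd; exact: m_halfline.
  - by have := VE setTh hB'; under eq_fun do rewrite indicT mul1r.
  - move=> A'' hA''.
    by have := VE hA'' hB'; under eq_fun do rewrite mulrA mulrAC.
have := @V_dynkin _ R snd halfline (fun x => \1_E x * \1_A x.1) halfline_gen halflineI.
move=> /(_ _ _ _ _ B mB) h.
under eq_fun do rewrite mulrA.
apply: h.
- by move=> x; rewrite mulr_ge0.
- apply: (@L2real_bounded _ 1) => //; apply: measurable_funM; first exact: measurable_indic.
  exact: mfst.
- by have := step1 _ mA _ setTh; under eq_fun do rewrite indicT mulr1.
- move=> B'' hB''.
  by have := step1 _ mA _ hB''; under eq_fun do rewrite mulrA.
Qed.

(** A third Dynkin pass, over the family of measurable rectangles, which is closed under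
    intersection and generates the product sigma-algebra. *)
Lemma V_set (A : set T) : measurable A -> V (fun x => \1_E x * \1_A x).
Proof.
move=> mA.
pose G : set_system T := [set A1 `*` A2 | A1 in measurable & A2 in measurable].
have VErect (A1 A2 : set R) : measurable A1 -> measurable A2 ->
    V (fun x => \1_E x * \1_(A1 `*` A2) x).
  move=> m1 m2; have := V_rect m1 m2; congr V; apply/funext => x.
  by congr (_ * _); rewrite !indicE in_setX -natrM mulnb.
have := @V_dynkin _ T id G (fun x => \1_E x) _ _ _ _ _ _ A mA.
apply.
- exact: measurable_prod_measurableType.
- move=> _ _ [A1 mA1 [A2 mA2 <-]] [B1 mB1 [B2 mB2 <-]].
  exists (A1 `&` B1); first exact: measurableI.
  exists (A2 `&` B2); first exact: measurableI.
  by rewrite setXI.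
- by [].
- apply: (@L2real_bounded _ 1); first exact: measurable_indic.
  by move=> x; rewrite mul1r ger0_norm.
- have := VErect setT setT measurableT measurableT.
  by rewrite setXTT; under eq_fun do rewrite indicT mulr1.
- by move=> _ [A1 mA1 [A2 mA2 <-]]; exact: VErect.
Qed.

Import HBNNSimple.

(** Simple functions increase to [u] and are dominated by [u]. They are multiplied by the indicator
    of [E], since [V_set] only supplies sets cut by [E]; the limit does not change because [u]
    vanishes off [E]. *)
Lemma V_nonneg (u : T -> R) : L2real u -> (forall x, 0 <= u x) ->
  (forall x, ~ E x -> u x = 0) -> V u.
Proof.
move=> Lu u0 uE; have [mu_ _] := Lu.
have mEu : measurable_fun setT (EFin \o u) by exact/measurable_EFinP.
pose s := nnsfun_approx measurableT mEu.
have cs x : s n x @[n --> \oo] --> u x.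
  have /fine_cvg := @cvg_nnsfun_approx _ _ _ _ measurableT _ mEu (fun x _ => u0 x : (0%E <= (EFin \o u) x)%E) x I.
  exact.
have su n x : s n x <= u x.
  have nd : nondecreasing_seq (fun n => s n x).
    by move=> p q pq; have /lefP := @nd_nnsfun_approx _ _ _ _ measurableT _ mEu p q pq; exact.
  by have := nondecreasing_cvgn_le nd (cvgP _ (cs x)) n; rewrite (cvg_lim _ (cs x)).
apply: (Vlim (u_ := fun n x => \1_E x * s n x) (G := u)) => //.
- move=> n.
  have -> : (fun x => \1_E x * s n x) =
      (fun x => \sum_(y \in range (s n)) y * (\1_E x * \1_(s n @^-1` [set y]) x)).
    apply/funext => x; rewrite [X in _ * X](fimfunE (s n) x) mulr_fsumr//.
    by apply: eq_fsbigr => y _; rewrite mulrCA.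
  have V0 : V (fun=> 0).
    by have := V_set measurable0; under eq_fun do rewrite indic0 mulr0.
  have fr : finite_set (range (s n)) by exact: fimfunP.
  under eq_fun do rewrite fsbig_finite//=.
  elim: (fset_set (range (s n)) : seq R) => [|y r IH].
    by under eq_fun do rewrite big_nil.
  under eq_fun do rewrite big_cons.
  by apply: VD => //; apply: VZ; apply: V_set.
- move=> n x; rewrite ger0_norm ?mulr_ge0// indicE.
  by case: (_ \in _); rewrite ?mul1r// mul0r.
- move=> x; have [Ex|nEx] := pselect (E x).
    under eq_fun do rewrite indicE mem_set// mul1r.
    exact: cs.
  under eq_fun do rewrite indicE memNset// mul0r.
  by rewrite uE//; exact: cvg_cst.
Qed.

Lemma V_L2real (u : T -> R) : L2real u -> (forall x, ~ E x -> u x = 0) -> V u.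
Proof.
move=> Lu uE.
have Lp : L2real (u ^\+)%R.
  case: Lu => m i; split; first exact: measurable_funrpos.
  apply: le_lt_trans i; apply: ge0_le_integral => //.
  - by move=> x _; rewrite lee_fin sqr_ge0.
  - by apply/measurable_EFinP/measurable_funX/measurable_funrpos.
  - exact/measurable_EFinP/measurable_funX.
  - move=> x _; rewrite lee_fin /funrpos /Num.max; case: ifP => // _.
    by rewrite expr0n sqr_ge0.
have Ln : L2real (u ^\-)%R.
  case: Lu => m i; split; first exact: measurable_funrneg.
  apply: le_lt_trans i; apply: ge0_le_integral => //.
  - by move=> x _; rewrite lee_fin sqr_ge0.
  - by apply/measurable_EFinP/measurable_funX/measurable_funrneg.
  - exact/measurable_EFinP/measurable_funX.
  - move=> x _; rewrite lee_fin /funrneg /Num.max; case: ifP => // _.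
      by rewrite expr0n sqr_ge0.
    by rewrite sqrrN.
have -> : u = (fun x => (u ^\+)%R x + (-1) * (u ^\-)%R x).
  by apply/funext => x; rewrite mulN1r -[LHS](congr1 (fun f => f x) (funrposBneg u)).
apply: VD.
  by apply: V_nonneg => // x nE; rewrite /funrpos uE// maxxx.
by apply: VZ; apply: V_nonneg => // x nE; rewrite /funrneg uE// oppr0 maxxx.
Qed.

End Density.

(** * Polynomials converging pointwise to a step *)

Section Step.
Variable R : realType.

Lemma bernoulli_ge (y : R) n : -1 <= y -> 1 + n%:R * y <= (1 + y) ^+ n.
Proof.
move=> y1; elim: n => [|n IH]; first by rewrite mul0r addr0 expr0.
rewrite exprS -natr1.
have h : 0 <= (1 + y) * ((1 + y) ^+ n - (1 + n%:R * y)).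
  by apply: mulr_ge0; [lra|rewrite subr_ge0].
have h2 : 0 <= n%:R * y ^+ 2 by rewrite mulr_ge0 ?sqr_ge0.
rewrite expr2 in h2; nra.
Qed.

(* By Bernoulli's inequality these polynomials tend to 1 on [0, 1/2[ and to 0 on [1/2, 1]:
   they turn a function of the algebra into an indicator, without Stone-Weierstrass. *)
Definition step_poly (n : nat) (u : R) : R := (1 - u ^+ n) ^+ (n * 2 ^ n).

Lemma step_poly01 n u : 0 <= u <= 1 -> 0 <= step_poly n u <= 1.
Proof.
move=> /andP[u0 u1]; have h1 : 0 <= u ^+ n by rewrite exprn_ge0.
have h2 : u ^+ n <= 1 by rewrite exprn_ile1.
by rewrite /step_poly exprn_ge0 ?exprn_ile1 //; lra.
Qed.

(** Bernoulli bounds the defect from 1 by [n 2^n u^n]. With [r = sqrt (2 u) < 1] this is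
    [(n r^n) r^n], and [n r^n] stays bounded by Bernoulli applied to [1 / r]. *)
Lemma step_poly_cvg1 u : 0 <= u < 1/2 -> step_poly n u @[n --> \oo] --> (1 : R).
Proof.
move=> /andP[u0 u1].
have u01 : 0 <= u <= 1 by lra.
pose r := Num.sqrt (2 * u).
have r0 : 0 <= r by exact: sqrtr_ge0.
have r2 : r ^+ 2 = 2 * u by rewrite sqr_sqrtr//; lra.
have r1 : r < 1 by rewrite -(@ltr_pXn2r _ 2)// ?nnegrE// r2; lra.
pose d := (1 - r).
have d0 : 0 < d by rewrite /d; lra.
have key n : n%:R * r ^+ n <= d^-1.
  have b := @bernoulli_ge (r^-1 - 1) n.
  have [->|rn0] := eqVneq r 0.
    case: n {b} => [|n]; first by rewrite mul0r invr_ge0 ltW.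
    by rewrite expr0n/= mulr0 invr_ge0 ltW.
  have rp : 0 < r by rewrite lt_def rn0.
  have ri : 1 <= r^-1 by rewrite invf_ge1// ltW.
  have := b; have -> : 1 + (r^-1 - 1) = r^-1 by ring.
  have h : -1 <= r^-1 - 1 by lra.
  move=> /(_ h) {b h} b.
  have dr : d <= r^-1 - 1 by rewrite -(@ler_pM2r _ r)// [leRHS]mulrBl mulVf// /d; nra.
  rewrite -[leRHS]div1r ler_pdivlMr// mulrAC -ler_pdivlMr ?exprn_gt0// div1r -exprVn.
  apply: le_trans b; rewrite -[leLHS]add0r lerD// ler_wpM2l//.
apply: (@squeeze_cvgr _ _ _ _ (fun n => 1 - d^-1 * r ^+ n) (fun=> 1)).
- apply: nearW => n; have /andP[_ ->] := step_poly01 n u01; rewrite andbT.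
  have un : u ^+ n <= 1 by rewrite exprn_ile1//; lra.
  have := @bernoulli_ge (- u ^+ n) (n * 2 ^ n); rewrite lerN2 => /(_ un) b.
  rewrite /step_poly; apply: le_trans b; rewrite mulrN lerD2l lerN2.
  rewrite natrM natrX -mulrA -exprMn -r2 -exprM mul2n -addnn exprD mulrA.
  by rewrite ler_wpM2r// exprn_ge0.
- rewrite -[X in _ --> X](_ : 1 - d^-1 * 0 = 1); last by rewrite mulr0 subr0.
  apply: cvgB; first exact: cvg_cst.
  apply: cvgM; first exact: cvg_cst.
  by apply: cvg_expr; rewrite ger0_norm.
- exact: cvg_cst.
Qed.

(** With [v = u^n] and [k = n 2^n], [(1 - v)^k (1 + v)^k <= 1], while Bernoulli makes the second
    factor at least [n + 1] because [(2 u)^n >= 1]. The factor [2^n] in the exponent is what places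
    the threshold at 1/2. *)
Lemma step_poly_cvg0 u : 1/2 <= u <= 1 -> step_poly n u @[n --> \oo] --> (0 : R).
Proof.
move=> /andP[u0 u1].
have u01 : 0 <= u <= 1 by lra.
apply: (@squeeze_cvgr _ _ _ _ (fun=> 0) (fun n => n.+1%:R^-1)).
- apply: nearW => n; have /andP[-> _] := step_poly01 n u01; rewrite /=.
  have un : u ^+ n <= 1 by rewrite exprn_ile1//; lra.
  have un0 : 0 <= u ^+ n by rewrite exprn_ge0//; lra.
  have un2 : 1 <= 2 ^+ n * u ^+ n by rewrite -exprMn exprn_ege1//; lra.
  have b := @bernoulli_ge (u ^+ n) (n * 2 ^ n).
  have h1 : n.+1%:R <= (1 + u ^+ n) ^+ (n * 2 ^ n).
    apply: le_trans (b _); last lra.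
    rewrite -natr1 natrM natrX addrC lerD2l -mulrA -[leLHS]mulr1.
    by rewrite ler_wpM2l.
  have h2 : (1 + u ^+ n) ^+ (n * 2 ^ n) * step_poly n u <= 1.
    by rewrite /step_poly -exprMn exprn_ile1//; nra.
  rewrite -[leRHS]mul1r ler_pdivlMr// mulrC; apply: le_trans h2.
  by rewrite ler_wpM2r//; have /andP[] := step_poly01 n u01.
- exact: cvg_cst.
- exact: cvg_harmonic.
Qed.

End Step.

(** * Density of a separating algebra in $L^2$ of a set of finite measure *)

Section Approx.
Variable R : realType.
Notation T := (R * R)%type.
Notation mu := (@leb2 R).
Local Open Scope complex_scope.
Variable e : nat -> T -> R[i].
Hypothesis eL2 : forall m, L2plane (e m).
Implicit Types (u : T -> R) (F G H v w : T -> R[i]) (b : R[i]).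

Definition cpx u : T -> R[i] := fun x => (u x)%:C.

Lemma L2plane_cpx u : L2real u -> L2plane (cpx u).
Proof.
move=> hu; apply/L2planeP; split=> //; split=> //=.
by under eq_integral do rewrite expr0n/=; rewrite integral0.
Qed.

Lemma N2_cpx u : N2 (cpx u) = rinner u u.
Proof.
rewrite /N2 /reinner /= [X in _ + X](_ : _ = 0) ?addr0//.
by rewrite /rinner; under eq_Rintegral do rewrite mulr0; rewrite Rintegral_cst// mul0r.
Qed.

Lemma combo_widen (b : nat -> R[i]) N N' x : (N <= N')%N ->
  \sum_(m < N) b m * e m x = \sum_(m < N') (if (m < N)%N then b m else 0) * e m x.
Proof.
move=> NN'; rewrite (big_ord_widen _ (fun m => b m * e m x) NN') big_mkcond/=.
by apply: eq_bigr => m _; case: ifP => //; rewrite mul0r.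
Qed.

Lemma approx_close F : L2plane F ->
  (forall d, 0 < d -> exists G, [/\ L2plane G, approximable e G & N2 (fun x => F x - G x) <= d]) ->
  approximable e F.
Proof.
move=> hF h d d0.
have d4 : 0 < d / 4 by lra.
have [G [hG aG FG]] := h _ d4; have [N [b grid_radius]] := aG _ d4.
exists N, b.
have hFG : L2plane (fun x => F x - G x).
  by have := L2planeB 1 hF hG; under eq_fun do rewrite mul1r.
have := N2D hFG (L2plane_resid eL2 b N hG).
have -> : (fun x => F x - G x + (G x - \sum_(m < N) b m * e m x)) =
   (fun x => F x - \sum_(m < N) b m * e m x).
  by apply/funext => x; ring.
lra.
Qed.

Lemma approx_D F G : L2plane F -> L2plane G -> approximable e F -> approximable e G ->
  approximable e (fun x => F x + G x).
Proof.
move=> hF hG aF aG d d0; have d4 : 0 < d / 4 by lra.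
have [N [b grid_radius]] := aF _ d4; have [N' [b' hb']] := aG _ d4.
exists (maxn N N'), (fun m => (if (m < N)%N then b m else 0) + (if (m < N')%N then b' m else 0)).
have := N2D (L2plane_resid eL2 b N hF) (L2plane_resid eL2 b' N' hG).
set A := (X in N2 X <= _); set B := (X in _ -> N2 X <= _).
have -> : A = B; last by lra.
apply/funext => x; rewrite /A /B.
rewrite (combo_widen b x (leq_maxl N N')) (combo_widen b' x (leq_maxr N N')).
rewrite addrACA -opprD -big_split/=; congr (_ - _).
by apply: eq_bigr => m _; rewrite mulrDl.
Qed.

Lemma approx_Z b F : L2plane F -> approximable e F -> approximable e (fun x => b * F x).
Proof.
move=> hF aF d d0.
have c0 : 0 < nsq b + 1 by have := nsq_ge0 b; lra.
have [N [b' grid_radius]] := aF _ (divr_gt0 d0 c0).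
exists N, (fun m => b * b' m).
have -> : (fun x => b * F x - \sum_(m < N) b * b' m * e m x) =
    (fun x => b * (F x - \sum_(m < N) b' m * e m x)).
  apply/funext => x; rewrite mulrBr mulr_sumr; congr (_ - _).
  by apply: eq_bigr => m _; rewrite mulrA.
rewrite N2Z; last exact: L2plane_resid.
move: grid_radius; rewrite ler_pdivlMr//; set z := N2 _ => hz.
have : 0 <= z by exact: N2_ge0.
have := nsq_ge0 b; nra.
Qed.

Lemma approx_0 : approximable e (fun=> 0).
Proof.
move=> d d0; exists 0%N, (fun=> 0); apply: le_trans (ltW d0).
have -> : (fun x => 0 - \sum_(m < 0) (fun=> 0 : R[i]) (m : nat) * e m x) = (fun=> 0).
  by apply/funext => x; rewrite big_ord0 subr0.
by rewrite N2_0.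
Qed.

Lemma approx_e m : approximable e (e m).
Proof.
move=> d d0; exists m.+1, (fun k => if k == m then 1 else 0); apply: le_trans (ltW d0).
rewrite [X in N2 X](_ : _ = (fun=> 0)) ?N2_0//.
apply/funext => x; rewrite big_ord_recr/= eqxx mul1r big1 ?add0r ?subrr//.
by move=> i _; rewrite ltn_eqF// mul0r.
Qed.

Definition approx_real u := L2real u /\ approximable e (cpx u).

Lemma approx_realD u (v : T -> R) : approx_real u -> approx_real v -> approx_real (fun x => u x + v x).
Proof.
move=> [u1 u2] [v1 v2]; split; first exact: L2realD.
have := approx_D (L2plane_cpx u1) (L2plane_cpx v1) u2 v2.
by congr approximable; apply/funext => x; rewrite /cpx rmorphD.
Qed.

Lemma approx_realZ (b : R) u : approx_real u -> approx_real (fun x => b * u x).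
Proof.
move=> [u1 u2]; split; first exact: L2realZ.
have := approx_Z b%:C (L2plane_cpx u1) u2.
by congr approximable; apply/funext => x; rewrite /cpx rmorphM.
Qed.

(** Dominated convergence for the squared errors, with majorant [4 G^2]: the limit is approximated
    in $L^2$ by members of the closed span. *)
Lemma Vrlim (u_ : nat -> T -> R) (u G : T -> R) :
  (forall n, approx_real (u_ n)) -> (forall n x, `|u_ n x| <= G x) -> L2real G ->
  (forall x, u_ n x @[n --> \oo] --> u x) -> approx_real u.
Proof.
move=> Vu uG LG cu.
have mu_ : measurable_fun setT u.
  apply: (measurable_fun_cvg (fun n => (Vu n).1.1)) => x _; exact: cu.
have uG' x : `|u x| <= G x.
  have h : `|u_ n x| @[n --> \oo] --> `|u x| by apply: cvg_norm; exact: cu.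
  rewrite -(cvg_lim (@Rhausdorff R) h); apply: limr_le; first exact: cvgP h.
  by apply: nearW => n; exact: uG.
have Lu : L2real u.
  split => //; apply: le_lt_trans LG.2; apply: ge0_le_integral => //.
  - by move=> x _; rewrite lee_fin sqr_ge0.
  - exact/measurable_EFinP/measurable_funX.
  - by apply/measurable_EFinP/measurable_funX; case: LG.
  - move=> x _; rewrite lee_fin -(real_normK (num_real (u x))).
    by rewrite ler_pXn2r ?nnegrE ?(le_trans _ (uG' x))// normr_ge0.
split=> //; apply: approx_close; first exact: L2plane_cpx.
move=> d d0.
have Lun n : L2real (fun x => u x - u_ n x).
  have := L2realD Lu (L2realZ (-1) (Vu n).1); congr L2real; apply/funext => x.
  by rewrite mulN1r.
suff [n hn] : exists n, rinner (fun x => u x - u_ n x) (fun x => u x - u_ n x) <= d.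
  exists (cpx (u_ n)); split; [by apply: L2plane_cpx; case: (Vu n)|by case: (Vu n)|].
  rewrite [X in N2 X](_ : _ = cpx (fun x => u x - u_ n x)) ?N2_cpx//.
  by apply/funext => x; rewrite /cpx rmorphB.
have ae1 : {ae mu, forall x : T, setT x ->
    ((u x - u_ n x) ^+ 2)%:E @[n --> \oo] --> cst 0%E x}.
  apply: aeW => x _; apply/fine_cvgP; split; first exact: nearW.
  rewrite /comp/=.
  have c1 : (u x - u_ n x) @[n --> \oo] --> u x - u x.
    by apply: cvgB; [exact: cvg_cst|exact: cu].
  have := cvgM c1 c1; rewrite subrr mul0r.
  by move=> /(_ _); under [in X in _ -> X]eq_fun do rewrite expr2; exact.
have i1 : mu.-integrable setT (fun x => (4 * (G x * G x))%:E).
  by under eq_fun do rewrite EFinM; apply: integrableZl => //; exact: L2real_integrable.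
have ae2 : {ae mu, forall (x : T) (n : nat), setT x ->
    (`|((u x - u_ n x) ^+ 2)%:E| <= (4 * (G x * G x))%:E)%E}.
  apply: aeW => x n _; rewrite /= lee_fin ger0_norm ?sqr_ge0//.
  have h1 := uG' x; have h2 := uG n x.
  have : `|u x - u_ n x| <= 2 * G x by apply: le_trans (ler_normB _ _) _; lra.
  rewrite -(real_normK (num_real (u x - u_ n x))).
  have := normr_ge0 (u x - u_ n x); rewrite expr2; nra.
have [_ _] := @dominated_convergence _ _ R mu setT measurableT
  (fun n x => ((u x - u_ n x) ^+ 2)%:E) (cst 0%E) (fun x => (4 * (G x * G x))%:E)
  (fun n => (measurable_EFinP _ _).2 (measurable_funX 2 (Lun n).1)) (measurable_cst _) ae1 i1 ae2.
rewrite integral0 => /fine_cvgP[_].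
move=> /cvgrPdist_le /(_ d d0)[n _ /(_ n (leqnn n))] /=.
rewrite sub0r normrN => h; exists n; apply: le_trans h.
rewrite /rinner /Rintegral ; under eq_integral do rewrite -expr2.
exact: ler_norm.
Qed.

Variable E : set T.
Hypothesis mE : measurable E.
Hypothesis fE : (mu E < +oo)%E.

Variable M : (T -> R[i]) -> Prop.
Hypothesis M1 : M (fun=> 1).
Hypothesis MM : forall v w, M v -> M w -> M (fun x => v x * w x).
Hypothesis M_L2 : forall v, M v -> L2plane (fun x => (\1_E x)%:C * v x).
Hypothesis M_approx : forall v, M v -> approximable e (fun x => (\1_E x)%:C * v x).

(** As [M] is closed under products and contains 1, its span is an algebra; applying [step_poly] to
    a member stays inside. *)
Inductive Cspan : (T -> R[i]) -> Prop :=
| Cspan0 : Cspan (fun=> 0)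
| CspanS b v F : M v -> Cspan F -> Cspan (fun x => b * v x + F x).

Lemma CspanM v : M v -> Cspan v.
Proof.
move=> hv; rewrite (_ : v = fun x => 1 * v x + (fun=> 0) x).
  by apply: CspanS => //; exact: Cspan0.
by apply/funext => x; rewrite mul1r addr0.
Qed.

Lemma Cspan_add F G : Cspan F -> Cspan G -> Cspan (fun x => F x + G x).
Proof.
move=> hF hG; elim: hF => [|b v F' hv _ IH].
  by under eq_fun do rewrite add0r.
under eq_fun do rewrite -addrA.
exact: CspanS.
Qed.

Lemma Cspan_scale b F : Cspan F -> Cspan (fun x => b * F x).
Proof.
elim => [|c v F' hv _ IH]; first by under eq_fun do rewrite mulr0; exact: Cspan0.
by under eq_fun do rewrite mulrDr mulrA; exact: CspanS.
Qed.

Lemma Cspan_mul F G : Cspan F -> Cspan G -> Cspan (fun x => F x * G x).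
Proof.
move=> hF hG; elim: hF => [|b v F' hv _ IH].
  by under eq_fun do rewrite mul0r; exact: Cspan0.
under eq_fun do rewrite mulrDl -mulrA.
apply: Cspan_add => //; apply: Cspan_scale.
elim: hG => [|c w G' hw _ IH2].
  by under eq_fun do rewrite mulr0; exact: Cspan0.
under eq_fun do rewrite mulrDr mulrCA.
by apply: CspanS => //; exact: MM.
Qed.

Lemma Cspan_cst b : Cspan (fun=> b).
Proof. by have := Cspan_scale b (CspanM M1); under eq_fun do rewrite mulr1. Qed.

Lemma Cspan_exp F n : Cspan F -> Cspan (fun x => F x ^+ n).
Proof.
move=> hF; elim: n => [|n IH]; first by under eq_fun do rewrite expr0; exact: Cspan_cst.
by under eq_fun do rewrite exprS; exact: Cspan_mul.
Qed.

Lemma Cspan_stepn n u : Cspan (cpx u) -> Cspan (cpx (fun x => step_poly n (u x))).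
Proof.
move=> hu.
have -> : cpx (fun x => step_poly n (u x)) =
    (fun x => (1 + (-1) * (cpx u x) ^+ n) ^+ (n * 2 ^ n)).
  by apply/funext => x; rewrite /cpx /step_poly rmorphXn rmorphB rmorph1 rmorphXn mulN1r.
apply: Cspan_exp; apply: Cspan_add; first exact: Cspan_cst.
by apply: Cspan_scale; exact: Cspan_exp.
Qed.

Lemma Cspan_approx F : Cspan F ->
  L2plane (fun x => (\1_E x)%:C * F x) /\ approximable e (fun x => (\1_E x)%:C * F x).
Proof.
elim => [|b v F' hv _ [IH1 IH2]].
  by under eq_fun do rewrite mulr0; split; [exact: L2plane0|exact: approx_0].
under eq_fun do rewrite mulrDr mulrCA.
split; first by apply: L2planeD => //; apply: L2planeZ; exact: M_L2.
apply: approx_D => //; first by apply: L2planeZ; exact: M_L2.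
by apply: approx_Z; [exact: M_L2|exact: M_approx].
Qed.

(** A threshold at 1/2 is enough: [step_poly n] composed with [p] then converges on [E] to the
    indicator of [D]. *)
Definition separates (p : T -> R) (D : set T) :=
  Cspan (cpx p) /\ forall x, E x ->
    [/\ 0 <= p x <= 1, D x -> p x < 1/2 & ~ D x -> 1/2 <= p x].

Hypothesis sep1 : forall A, @halfline R A -> exists p, separates p (fst @^-1` A).
Hypothesis sep2 : forall A, @halfline R A -> exists p, separates p (snd @^-1` A).

Let sep_cvg p (A : set T) x : separates p A -> E x ->
  step_poly n (p x) @[n --> \oo] --> (\1_A x : R).
Proof.
move=> [_ h] Ex; have [/andP[p0 p1] h1 h2] := h x Ex.
have [Ax|nAx] := pselect (A x).
  by rewrite indicE mem_set//; apply: step_poly_cvg1; rewrite p0 h1.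
by rewrite indicE memNset//; apply: step_poly_cvg0; rewrite h2.
Qed.

Let approx_realE (A B : set R) : halfline A -> halfline B ->
  approx_real (fun x => \1_E x * (\1_A x.1 * \1_B x.2)).
Proof.
move=> /sep1[p sp] /sep2[q sq].
apply: (@Vrlim (fun n x => \1_E x * (step_poly n (p x) * step_poly n (q x))) _ (fun x => \1_E x)).
- move=> n.
  have [] := Cspan_approx (Cspan_mul (Cspan_stepn n sp.1) (Cspan_stepn n sq.1)).
  have -> : (fun x => (\1_E x)%:C * (cpx (fun x => step_poly n (p x)) x * cpx (fun x => step_poly n (q x)) x)) =
      cpx (fun x => \1_E x * (step_poly n (p x) * step_poly n (q x))).
    by apply/funext => x; rewrite /cpx !rmorphM.
  by move=> /L2planeP[].
- move=> n x; have [Ex|nEx] := pselect (E x); last first.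
    by rewrite indicE memNset// mul0r normr0.
  rewrite indicE mem_set// mul1r.
  have [/(step_poly01 n)/andP[p0 p1] _ _] := sp.2 x Ex.
  have [/(step_poly01 n)/andP[q0 q1] _ _] := sq.2 x Ex.
  by rewrite ger0_norm ?mulr_ge0// mulr_ile1.
- apply: (@L2real_bounded _ E mE fE _ 1); first exact: measurable_indic.
  by move=> x; rewrite mul1r ger0_norm.
- move=> x; have [Ex|nEx] := pselect (E x); last first.
    by rewrite indicE memNset// mul0r; under eq_fun do rewrite mul0r; exact: cvg_cst.
  rewrite indicE mem_set// mul1r; under eq_fun do rewrite mul1r.
  by apply: cvgM; [exact: (sep_cvg sp Ex)|exact: (sep_cvg sq Ex)].
Qed.

Hypothesis orth : forall m k, m <> k -> inner2 (e m) (e k) = 0.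
Hypothesis unit_or_zero : forall m, e m = (fun=> 0) \/ N2 (e m) = 1.

(** Products of two step polynomials, one for each coordinate, converge on [E] to indicators of
    quadrants. The density criterion extends this to all real $L^2$ functions supported in [E], and
    the real and imaginary parts of [g] are recombined with ['i]. *)
Theorem parseval_separating g : L2plane g -> (forall x, ~ E x -> g x = 0) ->
  (\sum_(0 <= m <oo) (nsq (inner2 g (e m)))%:E = (N2 g)%:E)%E.
Proof.
move=> hg gE; apply: parseval => //.
have /L2planeP[g1 g2] := hg.
have [] : approx_real (fun x => complex.Re (g x)).
  apply: (@V_L2real _ approx_real approx_realD approx_realZ Vrlim E mE fE approx_realE) => // x nE.
  by rewrite gE.
have [] : approx_real (fun x => complex.Im (g x)).
  apply: (@V_L2real _ approx_real approx_realD approx_realZ Vrlim E mE fE approx_realE) => // x nE.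
  by rewrite gE.
move=> L1 a1 L2 a2.
have := approx_D (L2plane_cpx L2) (L2planeZ 'i (L2plane_cpx L1)) a2
  (approx_Z 'i (L2plane_cpx L1) a1).
congr approximable; apply/funext => x; rewrite /cpx.
by case: (g x) => a b; simpc.
Qed.

End Approx.

(** * Polynomial systems on the boundary cells *)

Section GramSchmidt.
Variable R : realType.
Notation T := (R * R)%type.
Local Open Scope complex_scope.
Implicit Types (F G f g : T -> R[i]) (b : nat -> R[i]).

Definition orthosys (e : nat -> T -> R[i]) := [/\ forall m, L2plane (e m),
  forall m k, m <> k -> inner2 (e m) (e k) = 0 &
  forall m, e m = (fun=> 0) \/ N2 (e m) = 1].

Lemma inner2_self F : L2plane F -> inner2 F F = (N2 F)%:C.
Proof.
by move=> hF; rewrite inner2E// /N2 [rinner (fun x => complex.Im _) _]rinnerC subrr.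
Qed.

Lemma inner2_conj F G : L2plane F -> L2plane G -> inner2 G F = (inner2 F G)^*.
Proof.
move=> hF hG; rewrite !inner2E//= /reinner.
rewrite [rinner (fun x => complex.Re (G x)) _]rinnerC [rinner (fun x => complex.Im (G x)) _]rinnerC.
rewrite [rinner (fun x => complex.Im (G x)) _]rinnerC [rinner (fun x => complex.Re (G x)) _]rinnerC.
by congr (_ +i* _); rewrite opprB.
Qed.

Lemma inner2_0l F : L2plane F -> inner2 (fun=> 0) F = 0.
Proof.
move=> hF; rewrite /inner2; under eq_fun do rewrite mul0r.
by rewrite /cintegral/= Rintegral_cst// mul0r.
Qed.

(** Lets a Taylor polynomial be subtracted from an exponential without changing its inner product
    with a polynomial of higher index. *)
Lemma inner2_comb_eq0 (I : Type) (r : seq I) (w : I -> T -> R[i]) (b : I -> R[i]) g f :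
  (forall i, L2plane (w i)) -> L2plane g -> L2plane f ->
  all (fun i => inner2 (w i) f == 0) r ->
  inner2 (fun x => g x - \sum_(i <- r) b i * w i x) f = inner2 g f /\
  L2plane (fun x => g x - \sum_(i <- r) b i * w i x).
Proof.
move=> hw hg hf; elim: r => [|i r IH] /=.
  by move=> _; under eq_fun do rewrite big_nil subr0.
move=> /andP[/eqP wi /IH[IH1 IH2]].
under eq_fun do rewrite big_cons opprD addrCA addrC.
by split; [rewrite inner2Bl// wi mulr0 subr0|exact: L2planeB].
Qed.

(* A null vector is sent to 0, so the Gram-Schmidt system may contain zeros. *)
Definition normalize F : T -> R[i] := fun x => ((Num.sqrt (N2 F))^-1)%:C * F x.

Lemma normalize_unit F : L2plane F -> normalize F = (fun=> 0) \/ N2 (normalize F) = 1.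
Proof.
move=> hF; have [n0|n0] := eqVneq (N2 F) 0.
  by left; apply/funext => x; rewrite /normalize n0 sqrtr0 invr0 mul0r.
right; rewrite /normalize N2Z// /nsq/= expr0n addr0 exprVn sqr_sqrtr ?N2_ge0//.
by rewrite mulVf.
Qed.

Lemma inner2_normalize F G : L2plane F -> L2plane G -> inner2 F G = 0 ->
  inner2 (normalize F) G = 0.
Proof.
move=> hF hG FG.
have -> : normalize F = (fun x => 0 - (- ((Num.sqrt (N2 F))^-1)%:C) * F x).
  by apply/funext => x; rewrite sub0r mulNr opprK.
by rewrite inner2Bl ?FG ?mulr0 ?subr0 ?inner2_0l//; exact: L2plane0.
Qed.

Variable v : nat -> T -> R[i].
Hypothesis vL2 : forall m, L2plane (v m).

Definition resid (e : nat -> T -> R[i]) m : T -> R[i] :=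
  fun x => v m x - \sum_(i < m) inner2 (v m) (e i) * e i x.

(** Row [m] is the system built from the first [m] vectors, padded with zeros. Each row is then a
    complete [orthosys] on its own, and the recursion has all earlier vectors at hand. *)
Fixpoint gs_rows (m : nat) : nat -> T -> R[i] :=
  if m is m'.+1 then fun k => if k == m' then normalize (resid (gs_rows m') m') else gs_rows m' k
  else fun _ _ => 0.

Definition gram_schmidt (m : nat) : T -> R[i] := gs_rows m.+1 m.

Lemma gs_rows_gs m k : (k < m)%N -> gs_rows m k = gram_schmidt k.
Proof.
elim: m => // m IH; rewrite ltnS leq_eqVlt => /orP[/eqP ->//|km].
by rewrite /= ltn_eqF// IH.
Qed.

Lemma inner2_resid_lt e b N k g : orthosys e -> L2plane g -> (k < N)%N ->
  inner2 (fun x => g x - \sum_(m < N) b m * e m x) (e k) =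
  inner2 g (e k) - b k * inner2 (e k) (e k).
Proof.
move=> [eL2 orth _] hg; elim: N => // N IH; rewrite ltnS => kN.
have -> : (fun x => g x - \sum_(m < N.+1) b m * e m x) =
    (fun x => (g x - \sum_(m < N) b m * e m x) - b N * e N x).
  by apply/funext => x; rewrite big_ord_recr/= opprD addrA.
rewrite inner2Bl//; last exact: L2plane_resid.
move: kN; rewrite leq_eqVlt => /orP[/eqP ->|kN].
  by rewrite inner2_resid.
by rewrite IH// (orth N k) ?mulr0 ?subr0// => Nk; rewrite Nk ltnn in kN.
Qed.

Lemma resid_orth e m k : orthosys e -> (k < m)%N -> inner2 (resid e m) (e k) = 0.
Proof.
move=> oe km; rewrite /resid (inner2_resid_lt (fun i => inner2 (v m) (e i)) oe (vL2 m) km).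
have [eL2 _ uz] := oe; have [->|e1] := uz k.
  rewrite inner2_self; last exact: L2plane0.
  rewrite N2_0 mulr0 subr0 inner2_conj ?inner2_0l ?conjc0//; exact: L2plane0.
by rewrite inner2_self// e1 mulr1 subrr.
Qed.

Lemma gs_rows_zero m k : (m <= k)%N -> gs_rows m k = (fun=> 0).
Proof.
elim: m => // m IH mk /=; rewrite gtn_eqF//; exact/IH/ltnW.
Qed.

Lemma gs_rows_ortho m : orthosys (gs_rows m).
Proof.
elim: m => [|m IH].
  by split => [i|i k ik|i] /=; [exact: L2plane0|rewrite inner2_0l//; exact: L2plane0|left].
have [eL2 orth uz] := IH.
have rL2 : L2plane (resid (gs_rows m) m).
  exact: (L2plane_resid eL2 (fun i => inner2 (v m) (gs_rows m i)) m (vL2 m)).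
have nL2 : L2plane (normalize (resid (gs_rows m) m)) by exact: L2planeZ.
have key k : k <> m -> inner2 (normalize (resid (gs_rows m) m)) (gs_rows m k) = 0.
  move=> km; apply: inner2_normalize => //.
  have [km'|mk] := ltnP k m; first exact: resid_orth.
  rewrite gs_rows_zero// inner2_conj ?inner2_0l ?conjc0//; exact: L2plane0.
split => [k|k l kl|k] /=.
- by case: eqP.
- case: eqP => [km|km]; case: eqP => [lm|lm] //.
  + by rewrite km lm in kl.
  + exact: key.
  + by rewrite inner2_conj// key// conjc0.
  + exact: orth.
- by case: eqP => // _; exact: normalize_unit.
Qed.

Lemma gram_schmidt_ortho : orthosys gram_schmidt.
Proof.
split=> [m|m k mk|m].
- by have [+ _ _] := gs_rows_ortho m.+1; exact.
- have [_ + _] := gs_rows_ortho (maxn m k).+1 => /(_ m k mk).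
  by rewrite !gs_rows_gs// ltnS ?leq_maxl ?leq_maxr.
- by have [_ _ +] := gs_rows_ortho m.+1; exact.
Qed.

(** Equality holds only in norm: a residual that is null but not identically zero is normalised to
    the zero function, and is left over. *)
Lemma gram_schmidt_exact m : exists b, N2 (fun x => v m x - \sum_(i < m.+1) b i * gram_schmidt i x) = 0.
Proof.
have [eL2 _ _] := gs_rows_ortho m.
have rL2 : L2plane (resid (gs_rows m) m).
  exact: (L2plane_resid eL2 (fun i => inner2 (v m) (gs_rows m i)) m (vL2 m)).
have rE x : resid (gs_rows m) m x = v m x - \sum_(i < m) inner2 (v m) (gram_schmidt i) * gram_schmidt i x.
  by rewrite /resid; congr (_ - _); apply: eq_bigr => i _; rewrite gs_rows_gs.
exists (fun i => if i == m then (Num.sqrt (N2 (resid (gs_rows m) m)))%:C else inner2 (v m) (gram_schmidt i)).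
have -> : (fun x => v m x - \sum_(i < m.+1) (if i == m :> nat then (Num.sqrt (N2 (resid (gs_rows m) m)))%:C
     else inner2 (v m) (gram_schmidt i)) * gram_schmidt i x) = (fun x => resid (gs_rows m) m x -
    (Num.sqrt (N2 (resid (gs_rows m) m)))%:C * gram_schmidt m x).
  apply/funext => x; rewrite big_ord_recr/= eqxx opprD addrA rE; congr (_ - _ - _).
  by apply: eq_bigr => i _; rewrite ltn_eqF.
have [n0|n0] := eqVneq (N2 (resid (gs_rows m) m)) 0.
  by under eq_fun do rewrite n0 sqrtr0 mul0r subr0.
have -> : (fun x => resid (gs_rows m) m x - (Num.sqrt (N2 (resid (gs_rows m) m)))%:C * gram_schmidt m x) = (fun=> 0).
  apply/funext => x; rewrite /gram_schmidt/= eqxx /normalize mulrA -rmorphM mulfV ?mul1r ?subrr//.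
  by rewrite sqrtr_eq0 -ltNge lt_def n0 N2_ge0.
exact: N2_0.
Qed.

Lemma gram_schmidt_approx m : approximable gram_schmidt (v m).
Proof.
have [b grid_radius] := gram_schmidt_exact m; move=> d d0; exists m.+1, b.
by rewrite grid_radius ltW.
Qed.

(** Subtracting the first [m + 1] members does not change the inner product with a later one. What
    remains of [v m] has norm 0, so Bessel annihilates that inner product. *)
Lemma gram_schmidt_orth_lower m k : (m < k)%N -> inner2 (v m) (gram_schmidt k) = 0.
Proof.
move=> mk; have [b grid_radius] := gram_schmidt_exact m; have [eL2 orth uz] := gram_schmidt_ortho.
have hr := L2plane_resid eL2 b m.+1 (vL2 m).
have := bessel eL2 orth uz k.+1 hr.
rewrite grid_radius big_ord_recr/= (inner2_resid eL2 orth)//.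
have : 0 <= \sum_(i < k) nsq (inner2 (fun x => v m x - \sum_(i < m.+1) b i * gram_schmidt i x) (gram_schmidt i)).
  by apply: sumr_ge0 => i _; exact: nsq_ge0.
case: (inner2 (v m) (gram_schmidt k)) => p q; rewrite /nsq/= => h1 h2.
have [p2 q2] : p ^+ 2 = 0 /\ q ^+ 2 = 0.
  by have := sqr_ge0 p; have := sqr_ge0 q; lra.
move/eqP: p2; move/eqP: q2; rewrite !sqrf_eq0 => /eqP -> /eqP ->.
by [].
Qed.

Lemma gram_schmidt_supp (E : set T) : (forall m x, ~ E x -> v m x = 0) ->
  forall m x, ~ E x -> gram_schmidt m x = 0.
Proof.
move=> vE; suff h m : forall k x, ~ E x -> gs_rows m k x = 0 by move=> m; exact: h.
elim: m => // m IH k x nE /=; case: eqP => [_|_]; last exact: IH.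
rewrite /normalize /resid vE// big1 ?subrr ?mulr0// => i _.
by rewrite IH// mulr0.
Qed.

End GramSchmidt.

(** * Enumeration of pairs along square shells *)

Section Shell.

Definition isqrt (m : nat) : nat := Nat.sqrt m.

Lemma isqrtP m : (isqrt m * isqrt m <= m < (isqrt m).+1 * (isqrt m).+1)%N.
Proof. by have := Nat.sqrt_spec m (Nat.le_0_l m); rewrite /isqrt; lia. Qed.

Lemma isqrt_unique m k : (k * k <= m < k.+1 * k.+1)%N -> isqrt m = k.
Proof. by move=> h; rewrite /isqrt; apply: Nat.sqrt_unique; lia. Qed.

(* Enumerates pairs along the square shells [max a b = k], so that the indices below [k * k]
   are exactly those of the pairs with [a, b < k]. *)
Definition shell (m : nat) : nat * nat :=
  let k := isqrt m in let r := (m - k * k)%N in (minn r k, minn (2 * k - r) k).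

Definition unshell (p : nat * nat) : nat :=
  if (p.1 <= p.2)%N then (p.2 * p.2 + p.1)%N else (p.1 * p.1 + (2 * p.1 - p.2))%N.

Lemma unshellK p : shell (unshell p) = p.
Proof.
case: p => a b; rewrite /unshell /shell /=; case: ifP => ab.
  have -> : isqrt (b * b + a) = b by apply: isqrt_unique; nia.
  by congr pair; nia.
have -> : isqrt (a * a + (2 * a - b)) = a by apply: isqrt_unique; nia.
by congr pair; nia.
Qed.

Lemma shellK m : unshell (shell m) = m.
Proof.
rewrite /unshell /shell /=; have := isqrtP m; set k := isqrt m.
move=> h; case: ifP => ab; nia.
Qed.

Lemma unshell_lt a b k : (a < k)%N -> (b < k)%N -> (unshell (a, b) < k * k)%N.
Proof. by rewrite /unshell /= => ak width_const; case: ifP => h; nia. Qed.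

Lemma shell_max m : maxn (shell m).1 (shell m).2 = isqrt m.
Proof. by rewrite /shell /=; have := isqrtP m; set k := isqrt m => h; lia. Qed.

End Shell.

(** * Uniform Taylor bounds for the complex exponential *)

Section Taylor.
Variable R : realType.

(** Geometric tail of ratio 1/16; the factor 2 is a crude value for 16/15. The finite version [h]
    keeps the term [1 - 16 ^- p] so that the induction on [p] closes. *)
Lemma series_tail (c : nat -> R) (A l : R) k :
  (forall n, `|c n| <= A * 16 ^- n) -> series c n @[n --> \oo] --> l ->
  `|l - \sum_(n < k) c n| <= 2 * A * 16 ^- k.
Proof.
move=> cA cl.
have A0 : 0 <= A by have := cA 0%N; rewrite expr0 invr1 mulr1; apply: le_trans.
have h p : `|\sum_(n < k + p) c n - \sum_(n < k) c n| <= 2 * A * 16 ^- k * (1 - 16 ^- p).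
  elim: p => [|p IH]; first by rewrite addn0 subrr normr0 expr0 invr1 subrr mulr0.
  rewrite addnS big_ord_recr/= addrAC; apply: le_trans (ler_normD _ _) _.
  apply: le_trans (lerD IH (cA _)) _.
  rewrite exprD invfM (exprS _ p) invfM.
  set x := 16 ^- k; set y := 16 ^- p.
  have : 0 <= x * y * A by rewrite !mulr_ge0// invr_ge0 exprn_ge0.
  nra.
have c1 : (fun n => `|series c n - \sum_(n < k) c n|) n @[n --> \oo] --> `|l - \sum_(n < k) c n|.
  by apply: cvg_norm; apply: cvgB => //; exact: cvg_cst.
rewrite -(cvg_lim (@Rhausdorff R) c1); apply: limr_le; first exact: cvgP c1.
exists k => // n /= kn.
rewrite /series/= big_mkord -(subnKC kn); apply: le_trans (h _) _.
rewrite ler_piMr// ?mulr_ge0// ?invr_ge0 ?exprn_ge0// gerBl invr_ge0 exprn_ge0//.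
Qed.

(** A single term of the series of [exp (16 M)] is below its sum. The ratio 16 is chosen so that its
    square 256, which governs squared moduli, splits into two factors 16 with separate uses in
    [inv256_le]. *)
Lemma exp_coeff_bound (M x : R) n : `|x| <= M -> `|x| ^+ n / n`!%:R <= expR (16 * M) * 16 ^- n.
Proof.
move=> xM; have M0 : 0 <= M by apply: le_trans xM.
rewrite ler_pdivlMr ?exprn_gt0// mulrAC -exprMn.
have M16 : 0 <= 16 * M by rewrite mulr_ge0.
apply: (@le_trans _ _ ((16 * M) ^+ n / n`!%:R)).
  rewrite ler_wpM2r ?invr_ge0// lerXn2r ?nnegrE ?mulr_ge0//.
  by rewrite mulrC ler_wpM2l.
have := nondecreasing_cvgn_le (@nondecreasing_series _ (exp_coeff (16 * M)) xpredT 0 (fun k _ _ => exp_coeff_ge0 k M16)) (is_cvg_series_exp_coeff (16 * M)) n.+1.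
move=> h; apply: (le_trans _ (h : _ <= expR (16 * M))).
rewrite /series/= big_nat_recr//= lerDr sumr_ge0// => k _.
exact: exp_coeff_ge0.
Qed.

(** Taylor coefficients of cosine and, next, sine, indexed by all degrees so that both series
    combine into [exp_coef]; [sinc] is not the cardinal sine. *)
Definition cosc (n : nat) : R := (~~ odd n)%:R * (-1) ^+ n./2 / n`!%:R.
Definition sinc (n : nat) : R := (odd n)%:R * (-1) ^+ n.-1./2 / n`!%:R.

Let sgn_le1 (b : bool) p : `|b%:R * (-1) ^+ p : R| <= 1.
Proof. by rewrite normrM normrX normrN1 expr1n mulr1; case: b; rewrite ?normr0 ?normr1. Qed.

Let coef_le (b : bool) p n (x : R) :
  `|b%:R * (-1) ^+ p / n`!%:R * x ^+ n| <= `|x| ^+ n / n`!%:R.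
Proof.
rewrite -!mulrA mulrA normrM; apply: le_trans (ler_piMl _ (sgn_le1 b p)) _ => //.
by rewrite normrM normrX normfV normr_nat mulrC.
Qed.

Lemma cos_taylor M x k : `|x| <= M ->
  `|cos x - \sum_(n < k) cosc n * x ^+ n| <= 2 * expR (16 * M) * 16 ^- k.
Proof.
move=> xM; apply: (@series_tail (fun n => cosc n * x ^+ n)).
  move=> n; apply: le_trans (exp_coeff_bound n xM).
  exact: coef_le.
have := @is_cvg_series_cos_coeff R x; rewrite cos.unlock => h; move: h.
have -> : cos_coeff x = (fun n => cosc n * x ^+ n).
  by rewrite cos_coeffE; apply/funext => n; rewrite /cosc; ring.
exact.
Qed.

Lemma sin_taylor M x k : `|x| <= M ->
  `|sin x - \sum_(n < k) sinc n * x ^+ n| <= 2 * expR (16 * M) * 16 ^- k.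
Proof.
move=> xM; apply: (@series_tail (fun n => sinc n * x ^+ n)).
  move=> n; apply: le_trans (exp_coeff_bound n xM).
  exact: coef_le.
have := @is_cvg_series_sin_coeff R x; rewrite sin.unlock => h; move: h.
have -> : sin_coeff x = (fun n => sinc n * x ^+ n).
  by rewrite sin_coeffE; apply/funext => n; rewrite /sinc; ring.
exact.
Qed.

Local Open Scope complex_scope.

Definition exp_coef (n : nat) : R[i] := cosc n +i* sinc n.

Definition cis (t : R) : R[i] := cos t +i* sin t.

Definition cis_poly k (t : R) : R[i] := \sum_(n < k) exp_coef n * (t ^+ n)%:C.

Lemma cisD s t : cis (s + t) = cis s * cis t.
Proof. by rewrite /cis cosD sinD; simpc; congr (_ +i* _); rewrite addrC. Qed.

Lemma nsq_cis t : nsq (cis t) = 1.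
Proof. exact: cos2Dsin2. Qed.

Lemma cis_polyE k t : cis_poly k t =
  (\sum_(n < k) cosc n * t ^+ n) +i* (\sum_(n < k) sinc n * t ^+ n).
Proof.
rewrite /cis_poly; elim: k => [|k IH]; first by rewrite !big_ord0.
by rewrite !big_ord_recr/= IH /exp_coef; simpc.
Qed.

Lemma cis_taylor M t k : `|t| <= M ->
  nsq (cis t - cis_poly k t) <= 8 * expR (16 * M) ^+ 2 * 256 ^- k.
Proof.
move=> tM; rewrite cis_polyE /cis /nsq /=.
have h1 := cos_taylor k tM; have h2 := sin_taylor k tM.
set a := cos t - _ in h1 *; set b := sin t - _ in h2 *.
set B := 2 * _ * _ in h1 h2.
have e : 8 * expR (16 * M) ^+ 2 * 256 ^- k = 2 * B ^+ 2.
  rewrite /B !exprMn exprVn -exprM mulnC exprM.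
  by rewrite (_ : 16 ^+ 2 = 256 :> R); [ring|ring].
rewrite e -(real_normK (num_real a)) -(real_normK (num_real b)).
have := normr_ge0 a; have := normr_ge0 b; rewrite !expr2; nra.
Qed.

(** Truncating the two exponentials separately leaves degrees below [k] in each variable, which are
    exactly the pairs that [shell] enumerates before [k * k]. *)
Lemma cis2_taylor M : exists2 C : R, 0 < C & forall s t k, `|s| <= M -> `|t| <= M ->
  nsq (cis s * cis t - cis_poly k s * cis_poly k t) <= C * 256 ^- k.
Proof.
pose B : R := 8 * expR (16 * M) ^+ 2.
have B0 : 0 < B by rewrite mulr_gt0// exprn_gt0// expR_gt0.
exists (2 * B + 2 * B * (2 * (1 + B))) => [|s t k sM tM].
  by move: B0; clearbody B => B0; nra.
have hs := cis_taylor k sM; have ht := cis_taylor k tM; rewrite -/B in hs ht.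
have k1 : 256 ^- k <= 1 :> R by rewrite invf_le1 ?exprn_gt0// exprn_ege1//; lra.
have k0 : 0 <= 256 ^- k :> R by rewrite invr_ge0 exprn_ge0.
have -> : cis s * cis t - cis_poly k s * cis_poly k t =
   cis s * (cis t - cis_poly k t) + (cis s - cis_poly k s) * cis_poly k t by ring.
apply: le_trans (nsqD _ _) _; rewrite !nsqM nsq_cis mul1r.
have hP : nsq (cis_poly k t) <= 2 * (1 + B).
  have -> : cis_poly k t = cis t + (-1) * (cis t - cis_poly k t) by ring.
  apply: le_trans (nsqD _ _) _; rewrite nsqM nsq_cis.
  have -> : nsq (-1 : R[i]) = 1 by rewrite /nsq/= oppr0 sqrrN expr1n expr0n addr0.
  by rewrite mul1r; nra.
set x := nsq (cis t - _) in ht *; set y := nsq (cis s - _) in hs *.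
set z := nsq (cis_poly _ _) in hP *; set q := 256 ^- k in k0 k1 hs ht *.
have y0 : 0 <= y by exact: nsq_ge0.
have z0 : 0 <= z by exact: nsq_ge0.
have h : y * z <= (B * q) * (2 * (1 + B)) by apply: ler_pM.
nra.
Qed.

End Taylor.

Section Tools.
Variable R : realType.
Notation T := (R * R)%type.
Notation mu := (@leb2 R).
Local Open Scope complex_scope.

Lemma N2_le (E : set T) (D m : R) (F : T -> R[i]) : measurable E -> (mu E <= m%:E)%E ->
  L2plane F -> 0 <= D -> (forall x, nsq (F x) <= D * \1_E x) -> N2 F <= D * m.
Proof.
move=> mE Em hF D0 FD; rewrite -lee_fin -L2sqnormE//.
apply: (@le_trans _ _ (\int[mu]_x (D%:E * (\1_E x)%:E))%E).
  apply: ge0_le_integral => //.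
  - by move=> x _; rewrite lee_fin sqr_ge0.
  - apply/measurable_EFinP; under eq_fun do rewrite nsqE.
    by case: hF => m1 m2 _; apply: measurable_funD; exact: measurable_funX.
  - by apply: measurable_funeM; exact/measurable_EFinP/measurable_indic.
  - by move=> x _; rewrite nsqE -EFinM lee_fin.
rewrite ge0_integralZl ?lee_fin//; last exact/measurable_EFinP/measurable_indic.
by rewrite integral_indic// setIT EFinM lee_wpmul2l ?lee_fin.
Qed.

Lemma L2plane_bounded (E : set T) (F : T -> R[i]) (M : R) : measurable E -> (mu E < +oo)%E ->
  measurable_fun setT (fun x => complex.Re (F x)) ->
  measurable_fun setT (fun x => complex.Im (F x)) ->
  (forall x, nsq (F x) <= (M * \1_E x) ^+ 2) -> 0 <= M -> L2plane F.
Proof.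
move=> mE fE m1 m2 FM M0; apply/L2planeP.
have MB x : 0 <= M * \1_E x by rewrite mulr_ge0.
split; apply: (@L2real_bounded _ E mE fE _ M) => // x;
  rewrite -(@ler_pXn2r _ 2)// ?nnegrE//; apply: le_trans (FM x);
  by rewrite (real_normK (num_real _)) /nsq ?lerDl ?lerDr sqr_ge0.
Qed.

Lemma leb2_box (a b c d : R) : a <= b -> c <= d ->
  mu (`[a, b] `*` `[c, d]) = ((b - a) * (d - c))%:E.
Proof.
move=> ab cd; rewrite [LHS](_ : _ = (lebesgue_measure (`[a, b] : set R) *
    lebesgue_measure (`[c, d] : set R))%E); last first.
  by apply: product_measure1E; exact: measurable_itv.
rewrite !lebesgue_measure_itv/= !lte_fin.
have -> : (if a < b then (b%:E - a%:E)%E else 0%E) = (b - a)%:E :> \bar R.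
  case: ltP => // ba; have -> : a = b by lra.
  by rewrite subrr.
have -> : (if c < d then (d%:E - c%:E)%E else 0%E) = (d - c)%:E :> \bar R.
  case: ltP => // ba; have -> : c = d by lra.
  by rewrite subrr.
by rewrite -EFinM.
Qed.

Lemma nsq_fourier2_le (f : T -> R[i]) xi :
  nsq (fourier2 f xi) <= nsq (cintegral (fun x => f x * expNi (dot2 x xi))).
Proof.
rewrite /fourier2 nsqM ler_piMl ?nsq_ge0// /nsq/= expr0n addr0.
have h : 1 <= 2 * pi :> R by have := pi_ge2 R; lra.
by rewrite exprn_ile1 ?invr_ge0 ?invf_le1//; lra.
Qed.

End Tools.

(** * Orthonormal polynomials on a boundary cell *)

Section PolyCell.
Variable R : realType.
Notation T := (R * R)%type.
Notation mu := (@leb2 R).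
Local Open Scope complex_scope.
Variables (E : set T) (c : T).
Hypothesis mE : measurable E.
Hypothesis Ec : forall x, E x -> `|x.1 - c.1| <= 1/2 /\ `|x.2 - c.2| <= 1/2.

Definition mono a b : T -> R[i] := fun x => ((x.1 - c.1) ^+ a * (x.2 - c.2) ^+ b)%:C.

Definition indmono a b : T -> R[i] := fun x => (\1_E x)%:C * mono a b x.

(** The order by square shells makes the [m]-th member orthogonal to every monomial of degree below
    [isqrt m] in each variable. *)
Definition poly_sys : nat -> T -> R[i] := gram_schmidt (fun m => indmono (shell m).1 (shell m).2).

Lemma cell_le1 : (mu E <= 1%:E)%E.
Proof.
have -> : 1%:E = mu (`[c.1 - 1/2, c.1 + 1/2] `*` `[c.2 - 1/2, c.2 + 1/2]).
  by rewrite leb2_box; [congr EFin; lra|lra|lra].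
apply: le_measure; rewrite ?inE//; first exact: measurableX.
move=> x /Ec[]; rewrite !ler_norml => h1 h2; split; rewrite /= in_itv/=; lra.
Qed.

Lemma cell_fin : (mu E < +oo)%E.
Proof. exact: le_lt_trans cell_le1 (ltry _). Qed.

Let mcoord1 a : measurable_fun setT (fun x : T => (x.1 - c.1) ^+ a).
Proof. by apply: measurable_funX; apply: measurable_funB. Qed.

Let mcoord2 a : measurable_fun setT (fun x : T => (x.2 - c.2) ^+ a).
Proof. by apply: measurable_funX; apply: measurable_funB. Qed.

Let pow_le1 (y : R) a : `|y| <= 1/2 -> `|y ^+ a| <= 1.
Proof. by move=> h; rewrite normrX exprn_ile1//; lra. Qed.

Lemma indmono_L2 a b : L2plane (indmono a b).
Proof.
have -> : indmono a b = cpx (fun x => \1_E x * ((x.1 - c.1) ^+ a * (x.2 - c.2) ^+ b)).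
  by apply/funext => x; rewrite /indmono /mono /cpx -rmorphM.
apply: L2plane_cpx; apply: (@L2real_bounded _ E mE cell_fin _ 1).
  by apply: measurable_funM; [exact: measurable_indic|exact: measurable_funM].
move=> x; rewrite indicE; have [|_] := boolP (x \in E); last first.
  by rewrite mul0r normr0 mulr0.
rewrite inE => /Ec[h1 h2]; rewrite !mul1r normrM mulr_ile1 ?normr_ge0 ?pow_le1//.
Qed.

Lemma poly_sys_ortho : orthosys poly_sys.
Proof. by apply: gram_schmidt_ortho => m; exact: indmono_L2. Qed.

Lemma poly_sys_supp m x : ~ E x -> poly_sys m x = 0.
Proof.
apply: gram_schmidt_supp => {}m {}x nE.
by rewrite /indmono indicE memNset// mul0r.
Qed.

Lemma poly_sys_orth_mono a b k m : (a < k)%N -> (b < k)%N -> (k * k <= m)%N ->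
  inner2 (indmono a b) (poly_sys m) = 0.
Proof.
move=> ak width_const km.
have := @gram_schmidt_orth_lower R (fun m => indmono (shell m).1 (shell m).2)
  (fun m => indmono_L2 _ _) (unshell (a, b)) m.
rewrite unshellK; apply; exact: leq_trans (unshell_lt ak width_const) km.
Qed.

Definition is_mono (v : T -> R[i]) := exists a b, v = mono a b.

(** The function is [1/2 + (pr x - a) / 4], below 1/2 exactly when [pr x < a]. If [a] is within 1 of
    [y0] its values on [E] stay between 1/8 and 7/8; if [a] is farther, the half-line contains or
    misses all of [E] and a constant serves. *)
Let sep_aff (y0 : R) (pr : T -> R) (A : set R) :
  Cspan is_mono (fun x => (pr x - y0)%:C) -> (forall x, E x -> `|pr x - y0| <= 1/2) ->
  halfline A -> exists p, separates E is_mono p (pr @^-1` A).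
Proof.
have M1 : is_mono (fun=> 1).
  by exists 0%N, 0%N; apply/funext => x; rewrite /mono !expr0 mulr1.
move=> hpr prE [->|[a ->]].
  exists (fun=> 0); split; first exact: (Cspan_cst M1).
  by move=> x _; split=> [|_|/(_ I)//]; rewrite ?lexx ?ler01//; lra.
have [h1|h1] := ltP 1 (a - y0).
  exists (fun=> 0); split; first exact: (Cspan_cst M1).
  move=> x Ex; have := prE x Ex; rewrite ler_norml => h.
  split=> [|_|[]]; first by rewrite lexx ler01.
    lra.
  by rewrite /= in_itv/=; lra.
have [h2|h2] := ltP (a - y0) (-1).
  exists (fun=> 1); split; first exact: (Cspan_cst M1).
  move=> x Ex; have := prE x Ex; rewrite ler_norml => h.
  split=> [|/=|_]; first by rewrite lexx ler01.
    by rewrite in_itv/=; lra.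
  lra.
exists (fun x => (1/2 - (a - y0) / 4) + (1/4) * (pr x - y0)); split.
  have -> : cpx (fun x => (1/2 - (a - y0) / 4) + (1/4) * (pr x - y0)) =
    (fun x => (1/2 - (a - y0) / 4)%:C + (1/4)%:C * (pr x - y0)%:C).
    by apply/funext => x; rewrite /cpx [LHS]rmorphD; congr (_ + _); exact: rmorphM.
  apply: Cspan_add; first exact: (Cspan_cst M1).
  exact: Cspan_scale.
move=> x Ex; have := prE x Ex; rewrite ler_norml => h.
split; rewrite /= ?in_itv/=; [by apply/andP; split; lra|lra|].
by move=> /negP; rewrite -leNgt; lra.
Qed.

Lemma poly_parseval g : L2plane g -> (forall x, ~ E x -> g x = 0) ->
  (\sum_(0 <= m <oo) (nsq (inner2 g (poly_sys m)))%:E = (N2 g)%:E)%E.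
Proof.
have [eL2 orth uz] := poly_sys_ortho.
apply: (@parseval_separating R poly_sys eL2 E mE cell_fin is_mono) => //.
- by exists 0%N, 0%N; apply/funext => x; rewrite /mono !expr0 mulr1.
- move=> _ _ [a [b ->]] [a' [b' ->]]; exists (a + a')%N, (b + b')%N.
  by apply/funext => x; rewrite /mono -rmorphM !exprD mulrACA.
- by move=> _ [a [b ->]]; exact: indmono_L2.
- move=> _ [a [b ->]].
  have := @gram_schmidt_approx R (fun m => indmono (shell m).1 (shell m).2)
    (fun m => indmono_L2 _ _) (unshell (a, b)).
  by rewrite unshellK.
- move=> A; apply: (sep_aff (y0 := c.1)); last by move=> x /Ec[].
  by apply: CspanM; exists 1%N, 0%N; apply/funext => x; rewrite /mono expr1 expr0 mulr1.
- move=> A; apply: (sep_aff (y0 := c.2)); last by move=> x /Ec[].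
  by apply: CspanM; exists 0%N, 1%N; apply/funext => x; rewrite /mono expr1 expr0 mul1r.
Qed.

Let meas_cis (xi : T) :
  measurable_fun setT (fun x : T => cos (dot2 x xi)) /\
  measurable_fun setT (fun x : T => sin (dot2 x xi)).
Proof.
have md : measurable_fun setT (fun x : T => dot2 x xi).
  by apply: measurable_funD; apply: measurable_funM.
split; apply: (measurableT_comp _ md).
  by apply: continuous_measurable_fun; exact: continuous_cos.
by apply: continuous_measurable_fun; exact: continuous_sin.
Qed.

(** The Fourier integral is the conjugate of an inner product of the exponential, cut to [E], with
    the [m]-th polynomial. That polynomial ignores the Taylor polynomial of degree below [isqrt m]
    in each variable, so by Bessel only the squared norm of the remainder counts, over a cell of
    area at most 1. *)
Lemma poly_fourier (xi : T) (C M : R) m : 0 < C ->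
  (forall s t k, `|s| <= M -> `|t| <= M ->
    nsq (cis s * cis t - cis_poly k s * cis_poly k t) <= C * 256 ^- k) ->
  `|xi.1| <= M -> `|xi.2| <= M ->
  nsq (fourier2 (poly_sys m) xi) <= C * 256 ^- isqrt m.
Proof.
move=> C0 hC x1 x2; apply: le_trans (nsq_fourier2_le _ _) _.
have [eL2 orth uz] := poly_sys_ortho.
pose G : T -> R[i] := fun x => (\1_E x)%:C * cis (dot2 x xi).
have [mc ms] := meas_cis xi.
have reG : (fun x => complex.Re (G x)) = (fun x => \1_E x * cos (dot2 x xi)).
  by apply/funext => x; rewrite /G /cis /= mul0r subr0.
have imG : (fun x => complex.Im (G x)) = (fun x => \1_E x * sin (dot2 x xi)).
  by apply/funext => x; rewrite /G /cis /= mul0r addr0.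
have GL2 : L2plane G.
  apply: (@L2plane_bounded _ E _ 1 mE cell_fin) => //.
  - by rewrite reG; apply: measurable_funM => //; exact: measurable_indic.
  - by rewrite imG; apply: measurable_funM => //; exact: measurable_indic.
  - move=> x; rewrite /G nsqM nsq_cis mulr1 mul1r /nsq/= expr0n addr0//.
have -> : cintegral (fun x => poly_sys m x * expNi (dot2 x xi)) = inner2 (poly_sys m) G.
  rewrite /inner2; congr cintegral; apply/funext => x.
  have [Ex|nE] := pselect (E x); last by rewrite poly_sys_supp// !mul0r.
  by rewrite /G indicE mem_set// mul1r.
rewrite inner2_conj//.
have -> : nsq (inner2 G (poly_sys m))^* = nsq (inner2 G (poly_sys m)).
  by case: (inner2 _ _) => p q; rewrite /nsq/= sqrrN.
set k := isqrt m.
pose r := [seq (a, b) | a <- index_iota 0 k, b <- index_iota 0 k].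
(* The phase at the centre [c] is factored out, so that the expansion is in powers of [x - c]. *)
pose co (p : nat * nat) : R[i] := cis (dot2 c xi) *
  (exp_coef R p.1 * (xi.1 ^+ p.1)%:C * (exp_coef R p.2 * (xi.2 ^+ p.2)%:C)).
have [] := @inner2_comb_eq0 R _ r (fun p => indmono p.1 p.2) co G (poly_sys m).
- by move=> p; exact: indmono_L2.
- by [].
- exact: eL2.
- apply/allP => p /allpairsP[[a b]] /= [+ + ->] /=.
  rewrite !mem_index_iota /= => ak width_const; apply/eqP; apply: (poly_sys_orth_mono ak width_const).
  by have /andP[] := isqrtP m.
move=> <- hL2.
set H := (fun x => _) in hL2 *.
apply: (@le_trans _ _ (N2 H)).
  have := bessel eL2 orth uz m.+1 hL2; rewrite big_ord_recr/=; apply: le_trans.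
  by rewrite lerDr sumr_ge0// => i _; exact: nsq_ge0.
rewrite -[leRHS]mulr1; apply: (N2_le mE cell_le1) => //.
  by rewrite mulr_ge0 ?invr_ge0 ?exprn_ge0// ltW.
move=> x; rewrite /H /G.
have [Ex|nE] := pselect (E x); last first.
  rewrite indicE memNset// mul0r big1 ?subrr => [|p _]; last first.
    by rewrite /indmono indicE memNset// mul0r mulr0.
  by rewrite /nsq/= expr0n addr0 mulr0.
pose s := (x.1 - c.1) * xi.1; pose t := (x.2 - c.2) * xi.2.
have [h1 h2] := Ec Ex.
have M0 : 0 <= M by apply: le_trans x1.
have sM : `|s| <= M.
  rewrite /s normrM; apply: le_trans x1; rewrite ler_piMl//; lra.
have tM : `|t| <= M.
  rewrite /t normrM; apply: le_trans x2; rewrite ler_piMl//; lra.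
have := hC s t k sM tM; rewrite indicE mem_set// mulr1.
apply: le_trans; rewrite le_eqVlt; apply/orP; left; apply/eqP.
have -> : dot2 x xi = dot2 c xi + (s + t) by rewrite /dot2 /s /t; ring.
rewrite (cisD (dot2 c xi)) (cisD s) mul1r -[in RHS](mul1r (nsq _)) -(nsq_cis (dot2 c xi)) -nsqM mulrBr.
congr (nsq (_ - _)).
have cE (u : R) : cis_poly k u = \sum_(0 <= n < k) exp_coef R n * (u ^+ n)%:C by rewrite big_mkord.
rewrite /r big_allpairs_dep !cE.
rewrite big_distrl/= mulr_sumr; apply: eq_bigr => a _.
rewrite !mulr_sumr; apply: eq_bigr => b _.
rewrite /co /indmono /mono indicE mem_set//= mul1r /s /t !exprMn !rmorphM/=.
ring.
Qed.

End PolyCell.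

(** * Bump functions with stretched-exponential Fourier decay *)

Section Avg.
Variable R : realType.
Notation lm := (@lebesgue_measure R).
Implicit Types (f g : R -> R) (b t eta : R).

Lemma bounded_integrable d (X : measurableType d) (mu : {measure set X -> \bar R})
    (D : set X) (u : X -> R) (M : R) :
  measurable D -> (mu D < +oo)%E -> measurable_fun setT u ->
  (forall x, `|u x| <= M * \1_D x) -> mu.-integrable setT (EFin \o u).
Proof.
move=> mD fD mu_ uM.
apply: (@le_integrable _ _ _ mu setT _ _ (fun x => (M%:E * (\1_D x)%:E)%E)) => //.
- exact/measurable_EFinP.
- move=> x _; rewrite -EFinM /= lee_fin; apply: le_trans (uM x) _; exact: ler_norm.
- apply: integrableZl => //.
  apply/integrableP; split; first exact/measurable_EFinP/measurable_indic.
  under eq_integral do rewrite gee0_abs ?lee_fin//.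
  by rewrite integral_indic// setIT.
Qed.

Lemma lebesgue_integral_shift (g : R -> \bar R) t : lm.-integrable setT (fun x : R => g (x + t)) ->
  measurable_fun setT g -> (\int[lm]_x g (x + t)%R = \int[lm]_x g x)%E.
Proof.
move=> ig mg.
have ms : @measurable_fun _ _ (measurableTypeR R) (measurableTypeR R) setT (fun x : R => x + t).
  exact: measurable_funD.
have shiftE (A : set R) : measurable A ->
    pushforward lm (fun x : R => (x + t : measurableTypeR R)) A = lm A.
  move=> mA; apply/esym/lebesgue_measure_unique => //= _ [[a b]] _ <-.
  rewrite /pushforward /=.
  have -> : (fun x : R => x + t) @^-1` `]a, b]%classic = `]a - t, b - t]%classic.
    by apply/seteqP; split => x /=; rewrite !in_itv/=; lra.
  rewrite !lebesgue_measure_itv/= !lte_fin ltrD2r.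
  case: ifP => // _; rewrite -!EFinB; congr EFin; ring.
have h := @integral_pushforward _ _ (measurableTypeR R) (measurableTypeR R) R _ ms _ setT g mg ig measurableT.
rewrite -[LHS]h; apply: eq_measure_integral => //= A mA _.
exact: shiftE.
Qed.

(** Convolution with the uniform density on [[- b, b]]; its Fourier multiplier is the cardinal sine
    of [b eta]. *)
Definition avg b f x : R := (2 * b)^-1 * \int[lm]_(t in `[- b, b]) f (x + t).

Definition lip (L : R) f := forall x y, `|f x - f y| <= L * `|x - y|.

Lemma lip_continuous L f : lip L f -> continuous f.
Proof.
move=> lf x; apply/cvgrPdist_le => e e0; near=> y.
apply: le_trans (lf x y) _.
have h : `|x - y| <= e / (`|L| + 1).
  near: y; apply: (@cvgr_dist_le _ R^o _ (nbhs x) _ id x) => //.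
  by rewrite divr_gt0 ?ltr_wpDl.
have Lp : 0 < `|L| + 1 by rewrite ltr_wpDl.
rewrite ler_pdivlMr// in h; apply: le_trans h; rewrite mulrC.
by rewrite ler_wpM2l//; apply: le_trans (ler_norm _) _; lra.
Unshelve. all: by end_near. Qed.

Lemma continuous_shift_int f x b : continuous f ->
  lm.-integrable `[- b, b] (EFin \o (fun t => f (x + t))).
Proof.
move=> cf; apply: continuous_compact_integrable; first exact: segment_compact.
apply: continuous_subspaceT => t.
by apply: (@continuous_comp _ _ _ (fun t => x + t) f); [apply: cvgD; [exact: cvg_cst|exact: cvg_id]|exact: cf].
Qed.

Lemma Rint_cst b (k : R) : 0 < b -> \int[lm]_(t in `[- b, b]) k = k * (2 * b).
Proof.
move=> b0; rewrite Rintegral_cst//= lebesgue_measure_itv/= lte_fin.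
have -> : - b < b by lra.
by rewrite -EFinB/=; congr (_ * _); ring.
Qed.

Lemma avg_le f g x y b : 0 < b -> continuous f -> continuous g ->
  (forall t, `|t| <= b -> f (x + t) <= g (y + t)) -> avg b f x <= avg b g y.
Proof.
move=> b0 cf cg fg; rewrite /avg ler_pM2l ?invr_gt0; last by lra.
apply: le_Rintegral => //; [exact: continuous_shift_int..|].
by move=> t; rewrite /= in_itv/= => h; apply: fg; rewrite ler_norml.
Qed.

Lemma avg_const b k (x : R) : 0 < b -> avg b (fun=> k) x = k.
Proof.
by move=> b0; rewrite /avg Rint_cst// mulrC mulfK//; apply/eqP; lra.
Qed.

Lemma avg_ge_cst f x b m : 0 < b -> continuous f ->
  (forall t, `|t| <= b -> m <= f (x + t)) -> m <= avg b f x.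
Proof.
move=> b0 cf h; rewrite -(avg_const m x b0).
by apply: avg_le => //; exact: cst_continuous.
Qed.

Lemma avg_le_cst f x b m : 0 < b -> continuous f ->
  (forall t, `|t| <= b -> f (x + t) <= m) -> avg b f x <= m.
Proof.
move=> b0 cf h; rewrite -[leRHS](avg_const m x b0).
by apply: avg_le => //; exact: cst_continuous.
Qed.

Lemma avg_addr f k b x : 0 < b -> continuous f ->
  avg b (fun y => f y + k) x = avg b f x + k.
Proof.
move=> b0 cf; rewrite /avg RintegralD//; last 2 first.
- exact: continuous_shift_int.
- apply: continuous_compact_integrable; first exact: segment_compact.
  by apply: continuous_subspaceT; exact: cst_continuous.
rewrite mulrDr Rint_cst//; congr (_ + _).
by rewrite mulrC mulfK//; apply/eqP; lra.
Qed.

Lemma avg_lip L f b : 0 < b -> lip L f -> lip L (avg b f).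
Proof.
move=> b0 lf; have cf := lip_continuous lf.
have h x y : avg b f x <= avg b f y + L * `|x - y|.
  rewrite -avg_addr//; apply: avg_le => //.
    by move=> z; apply: cvgD; [exact: cf|exact: cvg_cst].
  move=> t _; have := lf (x + t) (y + t).
  rewrite opprD addrACA subrr addr0 ler_norml => /andP[_]; lra.
move=> x y; rewrite ler_norml.
have := h x y; have := h y x; rewrite distrC; lra.
Qed.

Lemma avg_dist L f b x : 0 < b -> 0 <= L -> lip L f -> `|avg b f x - f x| <= L * b.
Proof.
move=> b0 L0 lf; have cf := lip_continuous lf.
have h t : `|t| <= b -> `|f (x + t) - f x| <= L * b.
  move=> tb; apply: le_trans (lf _ _) _; rewrite addrAC subrr add0r.
  exact: ler_wpM2l.
rewrite ler_norml; apply/andP; split.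
  rewrite lerBrDr; apply: avg_ge_cst => // t /h; rewrite ler_norml; lra.
by rewrite lerBlDr; apply: avg_le_cst => // t /h; rewrite ler_norml; lra.
Qed.

End Avg.

(** * Effect of an average on the Fourier integral *)

Section AvgFourier.
Variable R : realType.
Notation lm := (@lebesgue_measure R).
Implicit Types (f : R -> R) (b eta th : R).

(* The phases 0 and - pi / 2 give the real and imaginary parts of the Fourier integral. *)
Definition phase_integral f eta th : R := \int[lm]_(x in setT) (f x * cos (eta * x + th)).

(** The bound by 1 is part of the condition; it makes the length of the interval a bound for every
    phase integral. *)
Definition supp_in (A B : R) f := forall x, `|f x| <= \1_(`[A, B]%classic : set R) x.

Let cont_cos (eta th : R) : continuous (fun x : R => cos (eta * x + th)).
Proof.
move=> x; apply: (@continuous_comp _ _ _ (fun x : R => eta * x + th) cos); last exact: continuous_cos.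
by apply: cvgD; [apply: cvgM; [exact: cvg_cst|exact: cvg_id]|exact: cvg_cst].
Qed.

Lemma itv_fin (A B : R) : (lm `[A, B] < +oo)%E.
Proof. by rewrite lebesgue_measure_itv/=; case: ifP => // _; rewrite ltry. Qed.

Lemma lm_itv (A B : R) : A <= B -> lm `[A, B] = (B - A)%:E.
Proof.
move=> AB; rewrite lebesgue_measure_itv/= lte_fin.
case: ltP => // BA; have -> : A = B by lra.
by rewrite subrr.
Qed.

Lemma normcos_le1 (x : R) : `|cos x| <= 1.
Proof. by rewrite ler_norml cos_geN1 cos_le1. Qed.

Lemma normsin_le1 (x : R) : `|sin x| <= 1.
Proof. by rewrite ler_norml sin_geN1 sin_le1. Qed.

Lemma phase_integral_integrable_m A B f eta th : measurable_fun setT f -> supp_in A B f ->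
  lm.-integrable setT (EFin \o (fun x : R => f x * cos (eta * x + th))).
Proof.
move=> mf sf; apply: (@bounded_integrable _ _ (measurableTypeR R) _ (`[A, B]%classic : set R) _ 1) => //.
- exact: itv_fin.
- by apply: measurable_funM => //; apply: continuous_measurable_fun; exact: cont_cos.
- move=> x; rewrite mul1r; apply: le_trans (sf x).
  by rewrite normrM ler_piMr// normcos_le1.
Qed.

Lemma phase_integral_integrable A B f eta th : continuous f -> supp_in A B f ->
  lm.-integrable setT (EFin \o (fun x : R => f x * cos (eta * x + th))).
Proof. by move=> cf; apply: phase_integral_integrable_m; exact: continuous_measurable_fun. Qed.

Lemma phase_integral_bound A B f eta th : A <= B -> measurable_fun setT f -> supp_in A B f ->
  `|phase_integral f eta th| <= B - A.
Proof.
move=> AB mf sf; apply: le_trans (le_normr_Rintegral _ _) _ => //.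
  exact: (phase_integral_integrable_m eta th mf sf).
have -> : B - A = \int[lm]_(x in setT) (\1_(`[A, B]%classic : set R) x).
  rewrite /Rintegral integral_indic// setIT.
  exact: (congr1 fine (esym (lm_itv AB))).
apply: le_Rintegral => //.
- have := integrable_norm (phase_integral_integrable_m eta th mf sf); exact.
- apply: (@bounded_integrable _ _ (measurableTypeR R) _ (`[A, B]%classic : set R) _ 1) => //; first exact: itv_fin.
  by move=> x; rewrite mul1r ger0_norm.
- move=> x _; apply: le_trans (sf x).
  by rewrite normrM ler_piMr// normcos_le1.
Qed.

Lemma avg_supp A B f L b : 0 < b -> lip L f -> supp_in A B f -> supp_in (A - b) (B + b) (avg b f).
Proof.
move=> b0 lf sf x; have cf := lip_continuous lf.
have sf1 y : `|f y| <= 1.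
  by apply: le_trans (sf y) _; rewrite indicE; case: (_ \in _).
have [xin|xout] := pselect (A - b <= x <= B + b).
  rewrite indicE mem_set/= ?in_itv//=; rewrite ler_norml; apply/andP; split.
    by apply: avg_ge_cst => // t _; have := sf1 (x + t); rewrite ler_norml => /andP[].
  by apply: avg_le_cst => // t _; have := sf1 (x + t); rewrite ler_norml => /andP[].
rewrite indicE memNset/= ?in_itv//.
have z t : `|t| <= b -> f (x + t) = 0.
  move=> tb; have := sf (x + t); rewrite indicE memNset/= ?in_itv/=.
    by rewrite normr_le0 => /eqP.
  by move: tb; rewrite ler_norml => tb h; apply: xout; lra.
rewrite normr_le0; apply/eqP/le_anti/andP; split.
  by apply: avg_le_cst => // t /z ->.
by apply: avg_ge_cst => // t /z ->.
Qed.

(** Angle subtraction: the dependence on [t] is carried by the cosine and sine of [eta * t] alone,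
    so averaging over [t] can be computed in closed form. *)
Lemma phase_integral_phase A B f eta th t : continuous f -> supp_in A B f ->
  phase_integral f eta (th - eta * t) = cos (eta * t) * phase_integral f eta th + sin (eta * t) * phase_integral f eta (th - pi / 2).
Proof.
move=> cf sf; rewrite /phase_integral -!RintegralZl//; try exact: phase_integral_integrable cf sf.
rewrite -RintegralD//; last 2 first.
- have := integrableZl measurableT (cos (eta * t)) (phase_integral_integrable eta th cf sf).
  by [].
- have := integrableZl measurableT (sin (eta * t)) (phase_integral_integrable eta (th - pi / 2) cf sf).
  by [].
apply: eq_Rintegral => x _.
have -> : eta * x + (th - eta * t) = (eta * x + th) - eta * t by ring.
have -> : eta * x + (th - pi / 2) = (eta * x + th) - pi / 2 by ring.
rewrite cosB [cos (_ - pi / 2)]cosB cos_pihalf sin_pihalf; ring.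
Qed.

Lemma phase_integral_shift A B f eta th t : continuous f -> supp_in A B f ->
  (\int[lm]_x (f (x + t) * cos (eta * x + th))%:E = (phase_integral f eta (th - eta * t))%:E)%E.
Proof.
move=> cf sf.
have ig := phase_integral_integrable eta (th - eta * t) cf sf.
have cft : continuous (fun x => f (x + t)).
  move=> x; apply: (@continuous_comp _ _ _ (fun x : R => x + t) f); last exact: cf.
  by apply: cvgD; [exact: cvg_id|exact: cvg_cst].
have sft : supp_in (A - t) (B - t) (fun x => f (x + t)).
  move=> x; apply: le_trans (sf _) _; rewrite !indicE ler_nat.
  case: (boolP (_ \in _)) => //=; rewrite inE/= in_itv/= => h.
  by rewrite mem_set//= in_itv/=; lra.
rewrite /phase_integral /Rintegral fineK; last exact: integrable_fin_num.
have ph (x : R) : eta * (x + t) + (th - eta * t) = eta * x + th by ring.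
rewrite -[RHS](lebesgue_integral_shift (t := t)).
- by apply: eq_integral => x _; rewrite -ph.
- have := phase_integral_integrable eta th cft sft; congr integrable.
  by apply/funext => x /=; rewrite -ph.
- have [] := integrableP _ _ _ ig; exact.
Qed.

(** Exchange of the two integrals; translating [f] by [t] becomes a change of phase by
    [- eta * t]. *)
Lemma avg_fubini A B f L b eta th : 0 < b -> lip L f -> supp_in A B f ->
  2 * b * phase_integral (avg b f) eta th =
  \int[lm]_(t in `[- b, b]) (phase_integral f eta (th - eta * t)).
Proof.
move=> b0 lf sf; have cf := lip_continuous lf.
pose I : set R := `[- b, b]%classic.
have mI : measurable I by exact: measurable_itv.
pose F := fun z : R * R => \1_I z.2 * (f (z.1 + z.2) * cos (eta * z.1 + th)).
have f1 y : `|f y| <= 1.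
  by apply: le_trans (sf y) _; rewrite indicE; case: (_ \in _).
have mF : measurable_fun setT F.
  apply: measurable_funM; first exact: (measurableT_comp (measurable_indic mI)).
  apply: measurable_funM.
    apply: (measurableT_comp (continuous_measurable_fun cf)).
    exact: measurable_funD.
  by apply: (measurableT_comp (continuous_measurable_fun (@cont_cos eta th))).
have iF : (lm \x lm)%E.-integrable setT (EFin \o F).
  apply: (@bounded_integrable _ _ (measurableTypeR R * measurableTypeR R)%type _ (`[A - b, B + b]%classic `*` I) _ 1) => //.
  - exact: measurableX.
  - rewrite [ltLHS](_ : _ = (lm (`[(A - b)%R, (B + b)%R] : set R) * lm (I : set R))%E); last first.
      by apply: product_measure1E => //; exact: measurable_itv.
    by rewrite lte_mul_pinfty// ?itv_fin// ge0_fin_numE// itv_fin.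
  - move=> [x t]; rewrite mul1r /F/= indicE.
    have [|_] := boolP (t \in I); last by rewrite mul0r normr0.
    rewrite inE => It; rewrite mul1r normrM.
    apply: le_trans (ler_piMr _ (normcos_le1 _)) _ => //.
    apply: le_trans (sf _) _; rewrite !indicE ler_nat.
    case: (boolP (_ \in _)) => //=; rewrite inE/= in_itv/= => h.
    rewrite mem_set//=; split => //=; move: It; rewrite /I/= !in_itv/=; lra.
have := Fubini iF.
rewrite /=.
have -> : (\int[lm]_x \int[lm]_y (F (x, y))%:E = \int[lm]_x (2 * b * (avg b f x * cos (eta * x + th)))%:E)%E.
  apply: eq_integral => x _.
  have -> : (\int[lm]_y (F (x, y))%:E = \int[lm]_(y in I) ((cos (eta * x + th))%:E * (f (x + y))%:E))%E.
    rewrite [RHS]integral_mkcond; apply: eq_integral => y _.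
    rewrite /F patchE/= indicE; case: ifP => _; last by rewrite mul0r.
    by rewrite mul1r -EFinM mulrC.
  have ii := continuous_shift_int x b cf.
  rewrite integralZl// /avg /Rintegral -[X in (_ * X)%E = _]fineK; last exact: integrable_fin_num.
  rewrite -EFinM; congr EFin; field; lra.
have -> : (\int[lm]_y \int[lm]_x (F (x, y))%:E = \int[lm]_(y in I) (phase_integral f eta (th - eta * y))%:E)%E.
  rewrite [RHS]integral_mkcond; apply: eq_integral => y _.
  rewrite /F patchE/= indicE; case: ifP => _.
    by under eq_integral do rewrite mul1r; exact: (phase_integral_shift eta th y cf sf).
  by under eq_integral do rewrite mul0r; rewrite integral0.
have lavg := avg_lip b0 lf.
have savg := avg_supp b0 lf sf.
move=> h; rewrite [RHS]/Rintegral -h /phase_integral -RintegralZl//.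
exact: (phase_integral_integrable eta th (lip_continuous lavg) savg).
Qed.

Let dsin (eta : R) x : is_derive x (1:R) (fun t : R => sin (eta * t) / eta) (cos (eta * x) * eta / eta).
Proof.
have -> : cos (eta * x) * eta / eta = eta^-1 *: (cos (eta * x) *: eta) by rewrite /GRing.scale/=; ring.
have -> : (fun t : R => sin (eta * t) / eta) = eta^-1 \*: (sin \o (fun t : R => eta *: t)).
  by apply/funext => t; rewrite /GRing.scale/= mulrC.
apply: is_deriveZ.
apply: is_derive1_comp.
have := is_deriveZ eta (is_derive_id x (1:R)); rewrite /GRing.scale/= mulr1; exact.
Qed.

Let dcos (eta : R) x : is_derive x (1:R) (fun t : R => - cos (eta * t) / eta) (sin (eta * x) * eta / eta).
Proof.
have -> : sin (eta * x) * eta / eta = (- eta^-1) *: (- sin (eta * x) *: eta) by rewrite /GRing.scale/=; ring.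
have -> : (fun t : R => - cos (eta * t) / eta) = (- eta^-1) \*: (cos \o (fun t : R => eta *: t)).
  by apply/funext => t; rewrite [RHS](_ : _ = - eta^-1 * cos (eta * t)) //; ring.
apply: is_deriveZ.
apply: is_derive1_comp.
have := is_deriveZ eta (is_derive_id x (1:R)); rewrite /GRing.scale/= mulr1; exact.
Qed.

Let ftc (f F : R -> R) a b : a < b -> continuous f -> (forall x, is_derive x (1:R) F (f x)) ->
  \int[lm]_(x in `[a, b]) f x = F b - F a.
Proof.
move=> ab cf dF.
have cF x : {for x, continuous F}.
  by apply/differentiable_continuous/derivable1_diffP; have [] := dF x.
rewrite /Rintegral (continuous_FTC2 (F := F))//.
- exact: continuous_subspaceT.
- split; first by move=> x _; have [] := dF x.
  + by apply: cvg_at_right_filter; exact: cF.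
  + by apply: cvg_at_left_filter; exact: cF.
- by move=> x _; rewrite derive1E derive_val.
Qed.

Lemma Rint_cos a b eta : a < b -> eta != 0 ->
  \int[lm]_(t in `[a, b]) cos (eta * t) = (sin (eta * b) - sin (eta * a)) / eta.
Proof.
move=> ab e0.
have dF x : is_derive x (1:R) (fun t : R => sin (eta * t) / eta) (cos (eta * x)).
  by have := dsin eta x; rewrite mulfK.
have cc : continuous (fun x : R => cos (eta * x)).
  move=> x; apply: (@continuous_comp _ _ _ (fun x : R => eta * x) cos); last exact: continuous_cos.
  by apply: cvgM; [exact: cvg_cst|exact: cvg_id].
by rewrite (ftc ab cc dF) mulrBl.
Qed.

Lemma Rint_sin a b eta : a < b -> eta != 0 ->
  \int[lm]_(t in `[a, b]) sin (eta * t) = (cos (eta * a) - cos (eta * b)) / eta.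
Proof.
move=> ab e0.
have dF x : is_derive x (1:R) (fun t : R => - cos (eta * t) / eta) (sin (eta * x)).
  by have := dcos eta x; rewrite mulfK.
have cc : continuous (fun x : R => sin (eta * x)).
  move=> x; apply: (@continuous_comp _ _ _ (fun x : R => eta * x) sin); last exact: continuous_sin.
  by apply: cvgM; [exact: cvg_cst|exact: cvg_id].
by rewrite (ftc ab cc dF) -mulrBl; congr (_ / _); ring.
Qed.

(** Over the symmetric interval the sine term integrates to 0 and the cosine term to
    [2 sin (b eta) / eta]. The multiplier is the cardinal sine, at most [1 / (b |eta|)]; the stated
    bound gives away a factor 2. *)
Lemma phase_integral_avg A B f L b eta D : 0 < b -> eta != 0 -> lip L f -> supp_in A B f ->
  (forall th, `|phase_integral f eta th| <= D) ->
  forall th, `|phase_integral (avg b f) eta th| <= 2 / (b * `|eta|) * D.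
Proof.
move=> b0 e0 lf sf hD th; have cf := lip_continuous lf.
have ep : 0 < `|eta| by rewrite normr_gt0.
have := avg_fubini eta th b0 lf sf.
have bb : - b < b by lra.
have -> : \int[lm]_(t in `[- b, b]) (phase_integral f eta (th - eta * t)) =
    (sin (eta * b) - sin (eta * - b)) / eta * phase_integral f eta th +
    (cos (eta * - b) - cos (eta * b)) / eta * phase_integral f eta (th - pi / 2).
  rewrite -Rint_cos// -Rint_sin//.
  have ic : lm.-integrable `[- b, b] (EFin \o (fun t => cos (eta * t))).
    apply: continuous_compact_integrable; first exact: segment_compact.
    apply: continuous_subspaceT => x.
    apply: (@continuous_comp _ _ _ (fun x : R => eta * x) cos); last exact: continuous_cos.
    by apply: cvgM; [exact: cvg_cst|exact: cvg_id].
  have isn : lm.-integrable `[- b, b] (EFin \o (fun t => sin (eta * t))).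
    apply: continuous_compact_integrable; first exact: segment_compact.
    apply: continuous_subspaceT => x.
    apply: (@continuous_comp _ _ _ (fun x : R => eta * x) sin); last exact: continuous_sin.
    by apply: cvgM; [exact: cvg_cst|exact: cvg_id].
  rewrite -!RintegralZr// -RintegralD//; last 2 first.
  - by apply: (integrableZr _ (phase_integral f eta th) ic); exact: measurable_itv.
  - by apply: (integrableZr _ (phase_integral f eta (th - pi / 2)) isn); exact: measurable_itv.
  by apply: eq_Rintegral => t _; rewrite (phase_integral_phase eta th t cf sf).
rewrite mulrN cosN subrr mul0r mul0r addr0 => h.
have -> : phase_integral (avg b f) eta th =
    (2 * b)^-1 * ((sin (eta * b) - sin (- (eta * b))) / eta * phase_integral f eta th).
  by rewrite -h mulKf//; apply/eqP; lra.
rewrite sinN opprK !normrM normfV.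
have s1 : `|sin (eta * b) + sin (eta * b)| <= 2.
  apply: le_trans (ler_normD _ _) _; have := normsin_le1 (eta * b); lra.
have h2 : `|2 * b| = 2 * b by rewrite ger0_norm//; lra.
rewrite normfV h2.
have -> : 2 / (b * `|eta|) * D = (2 * b)^-1 * (4 / `|eta| * D).
  by field; rewrite !gt_eqF//; lra.
rewrite ler_wpM2l ?invr_ge0//; first lra.
have e1 : 0 <= `|eta|^-1 by rewrite invr_ge0.
have h3 : `|sin (eta * b) + sin (eta * b)| * `|eta|^-1 <= 4 / `|eta| by rewrite ler_wpM2r//; lra.
by apply: ler_pM => //; rewrite mulr_ge0.
Qed.

End AvgFourier.

(** * Averaging widths and the decay they produce *)

Section Widths.
Variable R : realType.
Variable s : R.
Hypothesis s1 : 1 < s.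

(* Telescoping differences, of total mass [1/8] and of order [i ^ (- s)]. *)
Definition avg_width (i : nat) : R := (i.+1%:R `^ (1 - s) - i.+2%:R `^ (1 - s)) / 8.

Lemma sum_avg_width k : \sum_(i < k) avg_width i = (1 - k.+1%:R `^ (1 - s)) / 8.
Proof.
have s1b := s1.
elim: k => [|k IH]; first by rewrite big_ord0 powR1 subrr mul0r.
by rewrite big_ord_recr/= IH /avg_width; ring.
Qed.

(** The factor [s - 1] is that of the derivative of [x^(1 - s)] and the 8 is the normalisation of
    the widths. Dividing by [s] keeps the constant below 1, which [cell_partition] uses. *)
Definition width_const : R := (s - 1) / (8 * s).

Lemma width_const_gt0 : 0 < width_const.
Proof.
have s1b := s1.
have h : 0 < s - 1 by lra.
have h2 : 0 < 8 * s by lra.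
by rewrite divr_gt0.
Qed.

(** With [r = s - 1] and [q = i + 2], everything reduces to [(q - 1)^r (1 + r / q) <= q^r], which
    follows from [ln (1 - 1 / q) <= - 1 / q] and [1 + x <= exp x]. *)
Lemma avg_width_ge i : width_const * i.+2%:R `^ (- s) <= avg_width i.
Proof.
have s1b := s1.
pose p : R := i.+1%:R; pose q : R := i.+2%:R.
have p0 : 0 < p by rewrite ltr0n.
have q0 : 0 < q by rewrite ltr0n.
have q1 : 1 <= q by rewrite ler1n.
have pq : p = q - 1 by rewrite /p /q -[i.+2%:R]natr1 addrK.
have [r Hr] : exists r : R, r = s - 1 by exists (s - 1).
have r0 : 0 < r by lra.
rewrite /avg_width /width_const -/p -/q.
have -> : 1 - s = - r by lra.
have -> : q `^ (- s) = q `^ (- r) * q^-1.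
  rewrite -[q^-1]powR_inv1 ?ltW// -powRD; last by rewrite (gt_eqF q0) implybT.
  by congr powR; lra.
have Q0 : 0 < q `^ r by exact: powR_gt0.
have P0 : 0 < p `^ r by exact: powR_gt0.
rewrite !powRN.
have key : p `^ r * (1 + r / q) <= q `^ r.
  have h1 : ln (p / q) <= - q^-1.
    have -> : p / q = 1 + (- q^-1) by rewrite pq; field; lra.
    apply: le_ln1Dx; rewrite ltrN2 invf_lt1//.
    by rewrite /q ltr1n.
  have h2 : p `^ r = q `^ r * expR (r * ln (p / q)).
    rewrite -[in LHS](divfK (lt0r_neq0 q0) p) powRM ?divr_ge0 ?ltW// mulrC; congr (_ * _).
    by rewrite /powR gt_eqF// divr_gt0.
  have h3 : expR (r * ln (p / q)) <= expR (- (r / q)).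
    by rewrite ler_expR -mulrN ler_wpM2l// ltW.
  have h4 : (1 + r / q) <= expR (r / q) by exact: expR_ge1Dx.
  have rq : 0 <= r / q by rewrite divr_ge0 ?ltW.
  rewrite h2 -mulrA; apply: ler_piMr; first exact: ltW.
  apply: (@le_trans _ _ (expR (- (r / q)) * expR (r / q))).
    by apply: ler_pM => //; rewrite ?expR_ge0// addr_ge0.
  by rewrite -expRD addNr expR0.
have Pi : (q `^ r)^-1 * (1 + r / q) <= (p `^ r)^-1.
  by rewrite mulrC ler_pdivrMr// ler_pdivlMl// .
set X := (q `^ r)^-1 in Pi *; have X0 : 0 < X by rewrite invr_gt0.
have -> : s = 1 + r by lra.
have e : (1 + r - 1) / (8 * (1 + r)) * (X * q^-1) = (X * (r / q) / (1 + r)) / 8.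
  by field; rewrite !gt_eqF//; lra.
rewrite e ler_pM2r// ler_pdivrMr; last lra.
have h : 0 <= X * (r / q) by rewrite mulr_ge0 ?divr_ge0 ?ltW.
have h5 : X * (r / q) <= (p `^ r)^-1 - X by rewrite lerBrDl -{1}[X]mulr1 -mulrDr.
apply: (le_trans h5); apply: ler_peMr; [exact: le_trans h h5|lra].
Qed.

Lemma avg_width_gt0 i : 0 < avg_width i.
Proof.
have s1b := s1.
apply: lt_le_trans (avg_width_ge i); rewrite mulr_gt0 ?width_const_gt0//.
Qed.

Lemma sum_avg_width_lt k : 0 <= \sum_(i < k) avg_width i < 1/8.
Proof.
have s1b := s1.
rewrite sumr_ge0/= => [|i _]; last exact/ltW/avg_width_gt0.
have := powR_gt0 (1 - s) (ltr0Sn R k); rewrite sum_avg_width; lra.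
Qed.

(** Each of the first [m] widths is at least the lower bound [width_const * (m + 1)^(- s)] for the
    last of them. *)
Lemma prod_avg_width y m : 0 < y ->
  \prod_(i < m) (2 / (avg_width i * y)) <= (2 / width_const * m.+1%:R `^ s / y) ^+ m.
Proof.
have s1b := s1.
move=> y0; have k0 := width_const_gt0.
have -> : (2 / width_const * m.+1%:R `^ s / y) ^+ m = \prod_(i < m) (2 / width_const * m.+1%:R `^ s / y).
  by rewrite prodr_const card_ord.
apply: ler_prod => i _; have b0 := avg_width_gt0 i.
apply/andP; split; first by rewrite divr_ge0// mulr_ge0// ltW.
have M0 : 0 < m.+1%:R `^ s :> R by exact: powR_gt0.
have h : width_const * (m.+1%:R `^ s)^-1 <= avg_width i.
  apply: le_trans (avg_width_ge i); rewrite ler_pM2l// powRN lef_pV2 ?posrE ?powR_gt0//.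
  by apply: ge0_ler_powR; rewrite ?nnegrE ?ler_nat//; [lra|exact: ltn_ord].
rewrite -[leRHS]mulrA -[leRHS]mulrA ler_pM2l//.
have -> : width_const^-1 * (m.+1%:R `^ s / y) = (width_const * (m.+1%:R `^ s)^-1 * y)^-1.
  by field; rewrite !gt_eqF.
have h3 : 0 < width_const * (m.+1%:R `^ s)^-1 * y.
  by apply: mulr_gt0 => //; apply: mulr_gt0 => //; rewrite invr_gt0.
have h4 : 0 < avg_width i * y by apply: mulr_gt0.
by rewrite lef_pV2 ?posrE// ler_pM2r.
Qed.

(* The infimum over m of the product bound for the Fourier transform, with m about
   (width_const y / 4)^(1/s). *)
Definition decay (y : R) : R := 4 * 2 `^ (- ((width_const / 4 * y) `^ s^-1)).

(** Let [w = (width_const y / 4)^(1/s)] and let [m + 1] be its integer part. Each of the [m] factors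
    is then at most 1/2, and [2^(- m) = 4 * 2^(- (m + 2)) <= 4 * 2^(- w)]: the factor 4 pays for
    rounding. For [w < 1] the claimed bound exceeds 1. *)
Lemma decay_of_prod (z y : R) : 0 <= y -> z <= 1 ->
  (0 < y -> forall m, z <= \prod_(i < m) (2 / (avg_width i * y))) -> z <= decay y.
Proof.
have s1b := s1.
rewrite le_eqVlt => /orP[/eqP <-|y0] z1 hz.
  rewrite /decay mulr0 powR0 ?oppr0 ?powRr0; first lra.
  by rewrite gt_eqF// invr_gt0; lra.
have k0 := width_const_gt0.
pose w := (width_const / 4 * y) `^ s^-1.
have w0 : 0 <= w by exact: powR_ge0.
have [w1|w1] := ltP w 1.
  apply: le_trans z1 _; rewrite /decay -/w.
  apply: (@le_trans _ _ (4 * 2 `^ (-1))); first by rewrite powR_inv1//; lra.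
  by rewrite ler_pM2l// ler_powR//; lra.
pose n := Num.trunc w.
have /andP[n1 n2] : n%:R <= w < n.+1%:R by exact: truncn_itv.
have np : (0 < n)%N by rewrite truncn_gt0.
case: n np n1 n2 => // m _ m1 m2.
have ws : w `^ s = width_const / 4 * y.
  rewrite /w -powRrM mulVf ?powRr1//; last by rewrite gt_eqF//; lra.
  by apply: mulr_ge0; apply: ltW => //; apply: divr_gt0.
have Ms : m.+1%:R `^ s <= width_const / 4 * y.
  by rewrite -ws; apply: ge0_ler_powR; rewrite ?nnegrE//; lra.
apply: le_trans (hz y0 m) _; apply: le_trans (prod_avg_width m y0) _.
apply: (@le_trans _ _ ((1/2) ^+ m)).
  apply: lerXn2r; rewrite ?nnegrE//.
    by apply: divr_ge0; [apply: mulr_ge0; [apply: divr_ge0 => //; exact: ltW|exact: powR_ge0]|exact: ltW].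
  rewrite ler_pdivrMr//.
  have -> : 1 / 2 * y = 2 / width_const * (width_const / 4 * y) by field; rewrite gt_eqF.
  by rewrite ler_pM2l// divr_gt0.
have -> : (1/2) ^+ m = 2 `^ (- m%:R) :> R.
  by rewrite powR_invn// div1r exprVn.
have -> : 2 `^ (- m%:R) = 4 * 2 `^ (- m.+2%:R) :> R.
  rewrite !powR_invn// !exprS; have : 2 ^+ m != 0 :> R by rewrite expf_neq0.
  by move: (2 ^+ m) => x nx; field.
rewrite /decay -/w ler_pM2l// ler_powR//; first lra.
by rewrite lerN2 ltW.
Qed.

(* Comes from keeping only the first four factors of the product. *)
Definition poly_const : R := (1 + 2 / width_const * 5 `^ s) ^+ 4.

Lemma poly_const_ge1 : 1 <= poly_const.
Proof.
have s1b := s1.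
have := width_const_gt0; rewrite /poly_const => k0; apply: exprn_ege1; rewrite lerDl.
by apply: mulr_ge0; [apply: divr_ge0 => //; exact: ltW|exact: powR_ge0].
Qed.

(** Taking [m = 4] gives [z <= (c / y)^4], the base 5 in [c] being [m + 1]. If [y > c] then
    [(c / y)(1 + y) <= 1 + c]; if [y <= c], the bound [z <= 1] suffices. *)
Lemma poly_of_prod (z y : R) : 0 <= y -> 0 <= z <= 1 ->
  (0 < y -> forall m, z <= \prod_(i < m) (2 / (avg_width i * y))) -> z * (1 + y) ^+ 4 <= poly_const.
Proof.
have s1b := s1.
move=> y0 /andP[z0 z1] hz; have k0 := width_const_gt0.
pose c := 2 / width_const * 5 `^ s.
have c0 : 0 < c by apply: mulr_gt0; [exact: divr_gt0|exact: powR_gt0].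
rewrite /poly_const -/c.
have [yc|yc] := lerP y c.
  rewrite -[leRHS]mul1r; apply: ler_pM => //; first by rewrite exprn_ge0//; lra.
  by apply: lerXn2r; rewrite ?nnegrE//; lra.
have yp : 0 < y by exact: lt_trans yc.
have := hz yp 4%N => h; have := le_trans h (prod_avg_width 4 yp); rewrite -/c => {}h.
apply: (@le_trans _ _ ((c / y) ^+ 4 * (1 + y) ^+ 4)).
  by rewrite ler_wpM2r// exprn_ge0//; lra.
rewrite -exprMn; apply: lerXn2r; rewrite ?nnegrE ?mulr_ge0 ?invr_ge0//; try lra.
have : c / y <= 1 by rewrite ler_pdivrMr// mul1r ltW.
rewrite mulrDr mulr1 mulfVK ?gt_eqF//; lra.
Qed.

End Widths.

(** * The bump function as a limit of averages *)

Section Bump.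
Variable R : realType.
Notation lm := (@lebesgue_measure R).
Variables s l x0 : R.
Hypotheses (s1 : 1 < s) (l0 : 0 < l).

(** Equal to 1 up to distance [5 l / 8] and to 0 from [7 l / 8] on. Averaging spreads by less than
    [l / 8] in total, which leaves the value 1 up to [l / 2] and the support within [l]. *)
Definition trapezoid (x : R) : R := Num.max 0 (Num.min 1 (4 * (7/8 - `|x - x0| / l))).

Fixpoint bump_approx (k : nat) : R -> R :=
  if k is k'.+1 then avg (l * avg_width s k') (bump_approx k') else trapezoid.

Definition bump (x : R) : R := limn (fun k => bump_approx k x).

Let S k : R := \sum_(i < k) avg_width s i.

Let max_lip (a b c : R) : `|Num.max c a - Num.max c b| <= `|a - b|.
Proof.
have l0b := l0.
rewrite ler_norml; have := ler_norm (a - b); have := ler_norm (b - a); rewrite (distrC b).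
by rewrite /Num.max; case: ifP => h1; case: ifP => h2; move: h1 h2;
  rewrite ?ltNge ?ltNgt => *; lra.
Qed.

Let min_lip (a b c : R) : `|Num.min c a - Num.min c b| <= `|a - b|.
Proof.
have l0b := l0.
rewrite ler_norml; have := ler_norm (a - b); have := ler_norm (b - a); rewrite (distrC b).
by rewrite /Num.min; case: ifP => h1; case: ifP => h2; move: h1 h2;
  rewrite ?ltNge ?ltNgt => *; lra.
Qed.

Lemma trapezoid_lip : lip (4 / l) trapezoid.
Proof.
have l0b := l0.
move=> x y; rewrite /trapezoid; apply: le_trans (max_lip _ _ _) _; apply: le_trans (min_lip _ _ _) _.
have -> : 4 * (7 / 8 - `|x - x0| / l) - 4 * (7 / 8 - `|y - x0| / l) =
   4 / l * (`|y - x0| - `|x - x0|) by field; rewrite gt_eqF.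
have h : 0 < 4 / l by rewrite divr_gt0.
rewrite normrM gtr0_norm// ler_pM2l//.
apply: le_trans (ler_dist_dist _ _) _; rewrite distrC.
by rewrite opprB addrA subrK.
Qed.

Lemma bump_approx_lip k : lip (4 / l) (bump_approx k).
Proof.
have l0b := l0.
by elim: k => [|k IH] /=; [exact: trapezoid_lip|apply: avg_lip => //; rewrite mulr_gt0// avg_width_gt0].
Qed.

Let cfb k : continuous (bump_approx k).
Proof. exact: lip_continuous (bump_approx_lip k). Qed.

Let lb0 k : 0 < l * avg_width s k.
Proof. by rewrite mulr_gt0// avg_width_gt0. Qed.

Lemma bump_approx01 k x : 0 <= bump_approx k x <= 1.
Proof.
have l0b := l0.
elim: k x => [|k IH] x /=.
  by rewrite /trapezoid le_max lexx/= ge_max ler01 ge_min lexx.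
apply/andP; split.
  by apply: avg_ge_cst => // t _; have /andP[] := IH (x + t).
by apply: avg_le_cst => // t _; have /andP[] := IH (x + t).
Qed.

Lemma bump_approx_eq1 k x : `|x - x0| <= l * (5/8 - S k) -> bump_approx k x = 1.
Proof.
have l0b := l0.
elim: k x => [|k IH] x /=.
  rewrite /S big_ord0 subr0 => h; rewrite /trapezoid.
  have : `|x - x0| / l <= 5/8 by rewrite ler_pdivrMr// mulrC.
  move=> h2; rewrite min_l; last lra.
  by rewrite max_r.
rewrite /S big_ord_recr/= -/(S k) => h.
have e t : `|t| <= l * avg_width s k -> bump_approx k (x + t) = 1.
  move=> tb; apply: IH; rewrite -addrAC; apply: le_trans (ler_normD _ _) _; lra.
apply/le_anti/andP; split.
  by apply: avg_le_cst => // t /e ->.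
by apply: avg_ge_cst => // t /e ->.
Qed.

Lemma bump_approx_eq0 k x : l * (7/8 + S k) <= `|x - x0| -> bump_approx k x = 0.
Proof.
have l0b := l0.
elim: k x => [|k IH] x /=.
  rewrite /S big_ord0 addr0 => h; rewrite /trapezoid.
  have : 7/8 <= `|x - x0| / l by rewrite ler_pdivlMr// mulrC.
  move=> h2; rewrite min_r; last lra.
  by rewrite max_l//; lra.
rewrite /S big_ord_recr/= -/(S k) => h.
have e t : `|t| <= l * avg_width s k -> bump_approx k (x + t) = 0.
  move=> tb; apply: IH.
  have := ler_normB (x + t - x0) t.
  have -> : x + t - x0 - t = x - x0 by ring.
  lra.
apply/le_anti/andP; split.
  by apply: avg_le_cst => // t /e ->.
by apply: avg_ge_cst => // t /e ->.
Qed.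

Let S18 k : 0 <= S k < 1/8. Proof. exact: sum_avg_width_lt. Qed.

Lemma bump_approx_supp k : supp_in (x0 - l) (x0 + l) (bump_approx k).
Proof.
have l0b := l0.
move=> x; have [h|h] := ltP `|x - x0| l.
  rewrite indicE mem_set/= ?in_itv/=; last by move: h; rewrite ltr_norml; lra.
  by have /andP[a b] := bump_approx01 k x; rewrite ger0_norm.
by rewrite bump_approx_eq0 ?normr0//; apply: le_trans h; have := S18 k; nra.
Qed.

(** The [k]-th average moves values by at most [4 * avg_width s k]. Adding 4 times the partial sums
    of the widths makes the sequence nondecreasing and bounded, and those sums converge too. *)
Lemma bump_approx_cvg x : bump_approx k x @[k --> \oo] --> bump x.
Proof.
have l0b := l0.
have c1 : cvgn S.
  apply: nondecreasing_is_cvgn.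
    apply/nondecreasing_seqP => n; rewrite /S big_ord_recr/= lerDl.
    exact/ltW/avg_width_gt0.
  by exists (1/8) => _ [n _ <-]; have := S18 n; lra.
have c2 : cvgn (fun k => bump_approx k x + 4 * S k).
  apply: nondecreasing_is_cvgn.
    apply/nondecreasing_seqP => n; rewrite /S big_ord_recr/=.
    have l40 : 0 <= 4 / l by rewrite divr_ge0// ltW.
    have := avg_dist x (lb0 n) l40 (bump_approx_lip n).
    have -> : 4 / l * (l * avg_width s n) = 4 * avg_width s n by field; rewrite gt_eqF.
    rewrite ler_norml; lra.
  by exists 2 => _ [n _ <-]; have := S18 n; have := bump_approx01 n x; lra.
have -> : (fun k => bump_approx k x) = (fun k => (bump_approx k x + 4 * S k) - 4 * S k).
  by apply/funext => k; ring.
rewrite /bump (_ : (fun k => bump_approx k x) = (fun k => (bump_approx k x + 4 * S k) - 4 * S k)); last first.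
  by apply/funext => k; ring.
have : cvgn (fun k => (bump_approx k x + 4 * S k) - 4 * S k).
  apply: is_cvgB => //; apply: is_cvgM => //; exact: is_cvg_cst.
by [].
Qed.

Let bump_lim x (P : set R) : closed P -> (forall k, P (bump_approx k x)) -> P (bump x).
Proof.
have l0b := l0.
move=> cP h; have nP : \forall k \near \oo, P (bump_approx k x) by exact: nearW.
have := @closed_cvg _ _ _ _ (fun k => bump_approx k x) P cP nP (bump x) (@bump_approx_cvg x).
exact.
Qed.

Lemma bump01 x : 0 <= bump x <= 1.
Proof.
have l0b := l0.
have := @bump_lim x [set y | 0 <= y <= 1].
rewrite /=; apply; last by move=> k; exact: bump_approx01.
have -> : [set y : R | 0 <= y <= 1] = `[0, 1]%classic.
  by apply/seteqP; split => y /=; rewrite in_itv.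
exact: itv_closed.
Qed.

Lemma bump_eq1 x : `|x - x0| <= l / 2 -> bump x = 1.
Proof.
have l0b := l0.
move=> h; apply: (@bump_lim x [set 1]) => [|k]; first exact: closed_eq.
by apply: bump_approx_eq1; apply: le_trans h _; have := S18 k; nra.
Qed.

Lemma bump_eq0 x : l <= `|x - x0| -> bump x = 0.
Proof.
have l0b := l0.
move=> h; apply: (@bump_lim x [set 0]) => [|k]; first exact: closed_eq.
by apply: bump_approx_eq0; apply: le_trans h; have := S18 k; nra.
Qed.

Lemma bump_measurable : measurable_fun setT bump.
Proof.
have l0b := l0.
apply: (measurable_fun_cvg (fun k => continuous_measurable_fun (@cfb k))) => x _.
exact: bump_approx_cvg.
Qed.

Lemma bump_supp : supp_in (x0 - l) (x0 + l) bump.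
Proof.
have l0b := l0.
move=> x; have [h|h] := ltP `|x - x0| l.
  rewrite indicE mem_set/= ?in_itv/=; last by move: h; rewrite ltr_norml; lra.
  by have /andP[a b] := bump01 x; rewrite ger0_norm.
by rewrite bump_eq0 ?normr0.
Qed.

(** Each of the first [m] averages contributes its factor. A later one averages phase integrals over
    phases, and so keeps any bound uniform in the phase; with [m] fixed, the bound survives the
    limit in [k]. *)
Lemma bump_approx_pint k m eta th : eta != 0 ->
  `|phase_integral (bump_approx (m + k)) eta th| <= 2 * l * \prod_(i < m) (2 / (avg_width s i * (l * `|eta|))).
Proof.
have l0b := l0.
move=> e0; elim: k th => [|k IH] th.
  rewrite addn0; elim: m th => [|m IHm] th.
    rewrite big_ord0 mulr1.
    have -> : 2 * l = (x0 + l) - (x0 - l) by ring.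
    apply: phase_integral_bound; [lra|by apply: continuous_measurable_fun; exact: cfb|exact: bump_approx_supp].
  apply: le_trans (phase_integral_avg (lb0 m) e0 (bump_approx_lip m) (bump_approx_supp m) IHm th) _.
  rewrite big_ord_recr/= (_ : l * avg_width s m * `|eta| = avg_width s m * (l * `|eta|)); last by ring.
  by move: (\prod_(i < m) _) => P; rewrite le_eqVlt; apply/orP; left; apply/eqP; ring.
rewrite addnS /=.
have := avg_fubini eta th (lb0 (m + k)) (bump_approx_lip (m + k)) (bump_approx_supp (m + k)).
set B := l * avg_width s (m + k) => h.
have B0 : 0 < B by exact: lb0.
have := congr1 Num.norm h; rewrite normrM gtr0_norm; last lra.
move=> h2; rewrite -(@ler_pM2l _ (2 * B)); last lra.
rewrite h2.
have cp : continuous (fun t => phase_integral (bump_approx (m + k)) eta (th - eta * t)).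
  have -> : (fun t => phase_integral (bump_approx (m + k)) eta (th - eta * t)) =
     (fun t => cos (eta * t) * phase_integral (bump_approx (m + k)) eta th + sin (eta * t) * phase_integral (bump_approx (m + k)) eta (th - pi / 2)).
    by apply/funext => t; exact: (phase_integral_phase eta th t (@cfb _) (bump_approx_supp _)).
  move=> t; apply: cvgD; apply: cvgM; try exact: cvg_cst.
    apply: (@continuous_comp _ _ _ (fun x : R => eta * x) cos); last exact: continuous_cos.
    by apply: cvgM; [exact: cvg_cst|exact: cvg_id].
  apply: (@continuous_comp _ _ _ (fun x : R => eta * x) sin); last exact: continuous_sin.
  by apply: cvgM; [exact: cvg_cst|exact: cvg_id].
have ip : lm.-integrable `[- B, B] (EFin \o (fun t => phase_integral (bump_approx (m + k)) eta (th - eta * t))).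
  apply: continuous_compact_integrable; first exact: segment_compact.
  exact: continuous_subspaceT.
apply: le_trans (le_normr_Rintegral _ ip) _; first exact: measurable_itv.
rewrite mulrC -Rint_cst//.
apply: le_Rintegral => //.
- exact: (integrable_norm ip).
- apply: continuous_compact_integrable; first exact: segment_compact.
  by apply: continuous_subspaceT; exact: cst_continuous.
Qed.

(** Dominated convergence in [bump_approx_pint] as [k] grows, with the indicator of the support as
    majorant. *)
Lemma bump_phase_integral m eta th : eta != 0 ->
  `|phase_integral bump eta th| <= 2 * l * \prod_(i < m) (2 / (avg_width s i * (l * `|eta|))).
Proof.
have l0b := l0.
move=> e0.
have cc : continuous (fun x : R => cos (eta * x + th)).
  move=> x; apply: (@continuous_comp _ _ _ (fun x : R => eta * x + th) cos); last exact: continuous_cos.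
  by apply: cvgD; [apply: cvgM; [exact: cvg_cst|exact: cvg_id]|exact: cvg_cst].
have c : (\int[lm]_x (bump_approx k x * cos (eta * x + th))%:E)%E @[k --> \oo] -->
    (\int[lm]_x (bump x * cos (eta * x + th))%:E)%E.
  apply: (@dominated_cvg _ (measurableTypeR R) R lm setT measurableT
    (fun k x => (bump_approx k x * cos (eta * x + th))%:E) (fun x => (bump x * cos (eta * x + th))%:E) (fun x : R => (\1_(`[x0 - l, x0 + l]%classic : set R) x)%:E)).
  - move=> k; apply/measurable_EFinP; apply: measurable_funM.
      by apply: continuous_measurable_fun; exact: cfb.
    exact: continuous_measurable_fun.
  - move=> x _; apply/fine_cvgP; split; first exact: nearW.
    by apply: cvgM; [exact: bump_approx_cvg|exact: cvg_cst].
  - by [].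
  - apply: (@bounded_integrable _ _ (measurableTypeR R) _ (`[x0 - l, x0 + l]%classic : set R) _ 1) => //.
      exact: itv_fin.
    by move=> x; rewrite mul1r ger0_norm.
  - move=> k x _; rewrite lee_fin normrM; apply: le_trans (bump_approx_supp k x).
    by rewrite ler_piMr// normcos_le1.
have c' : phase_integral (bump_approx (m + k)) eta th @[k --> \oo] --> phase_integral bump eta th.
  have : phase_integral (bump_approx k) eta th @[k --> \oo] --> phase_integral bump eta th.
    apply: fine_cvg; rewrite /phase_integral /Rintegral fineK//.
    exact: (integrable_fin_num measurableT (phase_integral_integrable_m eta th bump_measurable bump_supp)).
  by rewrite -(cvg_shiftn m); under eq_fun do rewrite addnC.
have c2 : `|phase_integral (bump_approx (m + k)) eta th| @[k --> \oo] --> `|phase_integral bump eta th| by apply: cvg_norm.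
rewrite -(cvg_lim (@Rhausdorff R) c2); apply: limr_le; first exact: cvgP c2.
by apply: nearW => k; exact: bump_approx_pint.
Qed.

Lemma bump_phase_integral_le eta th : `|phase_integral bump eta th| <= 2 * l.
Proof.
have l0b := l0.
have -> : 2 * l = (x0 + l) - (x0 - l) by ring.
apply: phase_integral_bound; [lra|exact: bump_measurable|exact: bump_supp].
Qed.

End Bump.

(** * Wave packets on the interior cells *)

Section Tensor.
Variable R : realType.
Notation lm := (@lebesgue_measure R).
Notation mu := (@leb2 R).
Local Open Scope complex_scope.

Lemma tensor_integrable (u v : R -> R) :
  lm.-integrable setT (EFin \o u) -> lm.-integrable setT (EFin \o v) ->
  mu.-integrable setT (fun z => (u z.1 * v z.2)%:E).
Proof.
move=> iu iv.
have [mu_ fu] := integrableP _ _ _ iu; have [mv fv] := integrableP _ _ _ iv.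
have mu' : measurable_fun setT u by exact/measurable_EFinP.
have mv' : measurable_fun setT v by exact/measurable_EFinP.
have mF : @measurable_fun _ _ (measurableTypeR R * measurableTypeR R)%type _ setT
    (fun z : R * R => (u z.1 * v z.2)%:E).
  apply/measurable_EFinP; apply: measurable_funM.
    exact: (measurableT_comp mu').
  exact: (measurableT_comp mv').
suff h : (lm \x lm)%E.-integrable setT (fun z => (u z.1 * v z.2)%:E) by exact: h.
apply/(integrable12ltyP _ _ mF).
have -> : (\int[lm]_x \int[lm]_y `|(u (x, y).1 * v (x, y).2)%:E| =
    \int[lm]_x ((`|u x|)%:E * \int[lm]_y `|(v y)%:E|))%E.
  apply: eq_integral => x _.
  rewrite -ge0_integralZl ?lee_fin//; last by apply: measurableT_comp => //; exact: mv.
  by apply: eq_integral => y _; rewrite /= normrM EFinM.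
rewrite ge0_integralZr//.
- by rewrite lte_mul_pinfty ?integral_ge0// ge0_fin_numE// integral_ge0.
- by apply/measurable_EFinP; apply: measurableT_comp => //; exact: mu'.
- exact: integral_ge0.
Qed.

Lemma tensor_integral (u v : R -> R) :
  lm.-integrable setT (EFin \o u) -> lm.-integrable setT (EFin \o v) ->
  Rintegral mu setT (fun z => u z.1 * v z.2) =
  (\int[lm]_(x in setT) u x) * (\int[lm]_(x in setT) v x).
Proof.
move=> iu iv; have iF := tensor_integrable iu iv.
rewrite [LHS]/Rintegral.
have -> : (\int[mu]_z (u z.1 * v z.2)%:E = \int[lm]_x \int[lm]_y (u x * v y)%:E)%E.
  by rewrite -(integral12_prod_meas1 iF).
have -> : (\int[lm]_x \int[lm]_y (u x * v y)%:E = \int[lm]_x ((\int[lm]_(y in setT) v y)%:E * (u x)%:E))%E.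
  apply: eq_integral => x _.
  rewrite /Rintegral fineK; last exact: (integrable_fin_num _ iv).
  rewrite muleC -integralZl//.
rewrite integralZl// fineM//; first by rewrite mulrC.
exact: (integrable_fin_num _ iu).
Qed.

Definition cintegral1 (U : R -> R[i]) : R[i] :=
  (\int[lm]_(x in setT) complex.Re (U x)) +i* (\int[lm]_(x in setT) complex.Im (U x)).

Lemma cintegral_tensor (U V : R -> R[i]) :
  lm.-integrable setT (EFin \o (fun x => complex.Re (U x))) ->
  lm.-integrable setT (EFin \o (fun x => complex.Im (U x))) ->
  lm.-integrable setT (EFin \o (fun x => complex.Re (V x))) ->
  lm.-integrable setT (EFin \o (fun x => complex.Im (V x))) ->
  cintegral (fun z => U z.1 * V z.2) = cintegral1 U * cintegral1 V.
Proof.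
move=> u1 u2 v1 v2; rewrite /cintegral /cintegral1; simpc.
have i11 := tensor_integrable u1 v1; have i22 := tensor_integrable u2 v2.
have i12 := tensor_integrable u1 v2; have i21 := tensor_integrable u2 v1.
congr (_ +i* _).
  rewrite -!tensor_integral// -RintegralB//.
  by congr Rintegral; apply/funext => z; case: (U z.1); case: (V z.2).
rewrite -!tensor_integral// -RintegralD//.
by congr Rintegral; apply/funext => z; case: (U z.1); case: (V z.2).
Qed.

End Tensor.

(** * Enumeration of pairs of integers *)

Section Zigzag.

(** Even codes give the nonnegative integers and odd codes the negative ones, so a code is at most
    twice the modulus. This ties the rank of a frequency to its size in [isqrt_int_pair]. *)
Definition zig (a : nat) : int := if odd a then - (a.+1./2)%:Z else (a./2)%:Z.

Definition zag (z : int) : nat := match z with Posz n => n.*2 | Negz n => n.*2.+1 end.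

Lemma zigK a : zag (zig a) = a.
Proof.
rewrite /zig; case: ifP => oa; last by rewrite /= even_halfK// oa.
case E: (a.+1./2) => [|k]; first lia.
by rewrite -NegzE /=; lia.
Qed.

Lemma zagK z : zig (zag z) = z.
Proof.
case: z => n /=; rewrite /zig /= odd_double /= ?doubleK//.
Qed.

Lemma zig_norm a : (a <= `|zig a|.*2)%N.
Proof. by rewrite /zig; case: ifP => oa; rewrite ?abszN /=; lia. Qed.

Definition int_pair (m : nat) : int * int := (zig (shell m).1, zig (shell m).2).

Definition int_pair_rank (n : int * int) : nat := unshell (zag n.1, zag n.2).

Lemma int_pairK m : int_pair_rank (int_pair m) = m.
Proof. by rewrite /int_pair_rank /int_pair; case: (shell m) (shellK m) => a b /= h; rewrite !zigK. Qed.

Lemma int_pair_rankK n : int_pair (int_pair_rank n) = n.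
Proof. by rewrite /int_pair /int_pair_rank unshellK /= !zagK; case: n. Qed.

Lemma isqrt_int_pair m : (isqrt m <= (maxn `|(int_pair m).1| `|(int_pair m).2|).*2)%N.
Proof.
rewrite -shell_max /int_pair; case: (shell m) => a b /=.
have := zig_norm a; have := zig_norm b; lia.
Qed.

End Zigzag.

(** * Integrals of exponentials over a period *)

Section CisIntegrals.
Variable R : realType.
Notation lm := (@lebesgue_measure R).
Local Open Scope complex_scope.

Lemma sin_2pi (a : R) (p : int) : sin (a + 2 * pi * p%:~R) = sin a.
Proof.
have h n (b : R) : sin (b + 2 * pi * n%:R) = sin b.
  have -> : 2 * pi * n%:R = pi *+ 2 *+ n :> R by rewrite -[RHS]mulr_natr -[pi *+ 2]mulr_natl.
  exact: (periodicn (@sinD2pi R)).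
case: p => n; first exact: h.
have -> : (Negz n)%:~R = - n.+1%:R :> R by rewrite NegzE mulrNz.
by rewrite -[LHS](h n.+1) mulrN subrK.
Qed.

Lemma cos_2pi (a : R) (p : int) : cos (a + 2 * pi * p%:~R) = cos a.
Proof.
have e x : cos x = sin (x + pi / 2) :> R by rewrite sinDpihalf.
by rewrite !e addrAC sin_2pi.
Qed.

Lemma cont_cosM (eta : R) : continuous (fun x : R => cos (eta * x)).
Proof.
move=> x; apply: (@continuous_comp _ _ _ (fun x : R => eta * x) cos); last exact: continuous_cos.
by apply: cvgM; [exact: cvg_cst|exact: cvg_id].
Qed.

Lemma cont_sinM (eta : R) : continuous (fun x : R => sin (eta * x)).
Proof.
move=> x; apply: (@continuous_comp _ _ _ (fun x : R => eta * x) sin); last exact: continuous_sin.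
by apply: cvgM; [exact: cvg_cst|exact: cvg_id].
Qed.

Lemma itvoo_fin (a b : R) : (lm (`]a, b[%classic : set R) < +oo)%E.
Proof. by rewrite lebesgue_measure_itv/=; case: ifP => // _; rewrite ltry. Qed.

Lemma Rint_open (a b : R) (g : R -> R) : continuous g ->
  \int[lm]_(x in setT) (\1_(`]a, b[%classic : set R) x * g x) = \int[lm]_(x in `[a, b]) g x.
Proof.
move=> cg.
have ig : lm.-integrable `[a, b] (EFin \o g).
  apply: continuous_compact_integrable; first exact: segment_compact.
  exact: continuous_subspaceT.
have sub1 : [set` `]a, b]] `<=` [set` `[a, b]] by move=> x /=; rewrite !in_itv/=; lra.
have sub2 : [set` `]a, b[] `<=` [set` `[a, b]] by move=> x /=; rewrite !in_itv/=; lra.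
rewrite -[RHS]Rintegral_itv_obnd_cbnd; last first.
  by apply: (@integrableS _ (measurableTypeR R) _ _ (`[a, b]%classic : set R)) => //; exact: measurable_itv.
rewrite -[RHS]Rintegral_itv_bndo_bndc; last first.
  by apply: (@integrableS _ (measurableTypeR R) _ _ (`[a, b]%classic : set R)) => //; exact: measurable_itv.
rewrite [RHS]Rintegral_mkcond; congr Rintegral; apply/funext => x.
by rewrite patchE indicE; case: ifP => _; rewrite ?mul1r ?mul0r.
Qed.

Variables (l x0 : R).

(** With [eta] a difference of two frequencies, one such factor per variable gives the integrand of
    the inner product of two exponentials; the weight [1 / (2 l)] makes its integral 1 at frequency
    0. *)
Definition trunc_cis (eta : R) (y : R) : R[i] :=
  (\1_(`]x0 - l, x0 + l[%classic : set R) y / (2 * l))%:C * cis (eta * y).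

Lemma trunc_cis_re eta : (fun y => complex.Re (trunc_cis eta y)) =
  (fun y => \1_(`]x0 - l, x0 + l[%classic : set R) y * (cos (eta * y) / (2 * l))).
Proof. by apply/funext => y; rewrite /trunc_cis /cis /= mul0r subr0; ring. Qed.

Lemma trunc_cis_im eta : (fun y => complex.Im (trunc_cis eta y)) =
  (fun y => \1_(`]x0 - l, x0 + l[%classic : set R) y * (sin (eta * y) / (2 * l))).
Proof. by apply/funext => y; rewrite /trunc_cis /cis /= mul0r addr0; ring. Qed.

Lemma trunc_cis_int eta : 0 < l ->
  lm.-integrable setT (EFin \o (fun y => complex.Re (trunc_cis eta y))) /\
  lm.-integrable setT (EFin \o (fun y => complex.Im (trunc_cis eta y))).
Proof.
move=> l0.
have aux (g : R -> R) : continuous g -> (forall x, `|g x| <= 1) ->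
  lm.-integrable setT (EFin \o (fun y => \1_(`]x0 - l, x0 + l[%classic : set R) y * (g y / (2 * l)))).
  move=> cg g1.
  apply: (@bounded_integrable _ _ (measurableTypeR R) _ (`]x0 - l, x0 + l[%classic : set R) _ (2 * l)^-1) => //.
  - exact: itvoo_fin.
  - apply: measurable_funM; first exact: measurable_indic.
    by apply: measurable_funM => //; exact: continuous_measurable_fun.
  - move=> x; rewrite normrM [X in X * _]ger0_norm// mulrC ler_wpM2r//.
    rewrite normrM [X in _ * X]ger0_norm ?invr_ge0; last lra.
    by rewrite ler_piMl// invr_ge0; lra.
rewrite trunc_cis_re trunc_cis_im; split; apply: aux.
- exact: cont_cosM.
- by move=> x; exact: normcos_le1.
- exact: cont_sinM.
- by move=> x; exact: normsin_le1.
Qed.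

Lemma cintegral1_trunc_cis (p : int) : 0 < l ->
  cintegral1 (trunc_cis (pi / l * p%:~R)) = (p == 0)%:R.
Proof.
move=> l0; have ll : x0 - l < x0 + l by lra.
rewrite /cintegral1 trunc_cis_re trunc_cis_im !Rint_open; last 2 first.
- move=> x; apply: cvgM; [exact: cont_sinM|exact: cvg_cst].
- move=> x; apply: cvgM; [exact: cont_cosM|exact: cvg_cst].
have ic eta : lm.-integrable `[x0 - l, x0 + l] (EFin \o (fun t => cos (eta * t))).
  apply: continuous_compact_integrable; first exact: segment_compact.
  by apply: continuous_subspaceT; exact: cont_cosM.
have isn eta : lm.-integrable `[x0 - l, x0 + l] (EFin \o (fun t => sin (eta * t))).
  apply: continuous_compact_integrable; first exact: segment_compact.
  by apply: continuous_subspaceT; exact: cont_sinM.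
rewrite !RintegralZr//.
have [->|p0] := eqVneq p 0.
  rewrite mulr0z mulr0.
  under eq_Rintegral do rewrite mul0r cos0.
  under [X in _ +i* (X / _)]eq_Rintegral do rewrite mul0r sin0.
  rewrite !Rintegral_cst//= lebesgue_measure_itv/= lte_fin ll -EFinB/= mul0r mul0r mul1r.
  by rewrite (_ : x0 + l - (x0 - l) = 2 * l) ?mulfV//; [apply/eqP; lra|ring].
have e0 : pi / l * p%:~R != 0 :> R.
  by rewrite mulf_neq0 ?intr_eq0// mulf_neq0 ?invr_eq0 ?gt_eqF ?pi_gt0//.
rewrite Rint_cos// Rint_sin//.
have -> : pi / l * p%:~R * (x0 + l) = pi / l * p%:~R * (x0 - l) + 2 * pi * p%:~R.
  by field; rewrite gt_eqF.
by rewrite sin_2pi cos_2pi !subrr !mul0r.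
Qed.

End CisIntegrals.

(** * The exponential system on a square *)

Section ExpCell.
Variable R : realType.
Notation T := (R * R)%type.
Notation mu := (@leb2 R).
Notation lm := (@lebesgue_measure R).
Local Open Scope complex_scope.
Variables (l : R) (c : T).
Hypothesis l0 : 0 < l.

(** Open, because the exponentials have period [2 l] and agree at opposite end points, which they
    could not separate. *)
Definition box : set T := `]c.1 - l, c.1 + l[%classic `*` `]c.2 - l, c.2 + l[%classic.

Definition plane_wave (n : int * int) (x : T) : R[i] :=
  cis (pi / l * n.1%:~R * x.1) * cis (pi / l * n.2%:~R * x.2).

Definition exp_sys (m : nat) (x : T) : R[i] := (\1_box x / (2 * l))%:C * plane_wave (int_pair m) x.

Lemma box_measurable : measurable box.
Proof. by apply: measurableX; exact: measurable_itv. Qed.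

Lemma box_fin : (mu box < +oo)%E.
Proof.
rewrite [ltLHS](_ : _ = (lm (`](c.1 - l)%R, (c.1 + l)%R[ : set R) * lm (`](c.2 - l)%R, (c.2 + l)%R[ : set R))%E); last first.
  by apply: product_measure1E; exact: measurable_itv.
by rewrite lte_mul_pinfty ?ge0_fin_numE ?itvoo_fin.
Qed.

Lemma indic_box x : \1_box x = \1_(`]c.1 - l, c.1 + l[%classic : set R) x.1 *
  \1_(`]c.2 - l, c.2 + l[%classic : set R) x.2 :> R.
Proof. by rewrite !indicE -natrM mulnb /box -in_setX; case: x. Qed.

Lemma nsq_plane_wave n x : nsq (plane_wave n x) = 1.
Proof. by rewrite /plane_wave nsqM !nsq_cis mulr1. Qed.

Lemma plane_waveM n n' x : plane_wave n x * plane_wave n' x = plane_wave (n.1 + n'.1, n.2 + n'.2) x.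
Proof.
rewrite /plane_wave mulrACA -!cisD /= !intrD.
by congr cis; ring.
Qed.

Let mlin (eta : R) (pr : T -> R) : measurable_fun setT pr ->
  measurable_fun setT (fun x => cos (eta * pr x)) /\ measurable_fun setT (fun x => sin (eta * pr x)).
Proof.
move=> mpr; split.
  by apply: (measurableT_comp (continuous_measurable_fun (@cont_cosM R eta))).
by apply: (measurableT_comp (continuous_measurable_fun (@cont_sinM R eta))).
Qed.

Lemma plane_wave_measurable n : measurable_fun setT (fun x => complex.Re (plane_wave n x)) /\
  measurable_fun setT (fun x => complex.Im (plane_wave n x)).
Proof.
have [c1 s1] := @mlin (pi / l * n.1%:~R) fst measurable_fst.
have [c2 s2] := @mlin (pi / l * n.2%:~R) snd measurable_snd.
rewrite /plane_wave /cis; simpc; rewrite /=; split.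
  by apply: measurable_funB; apply: measurable_funM.
by apply: measurable_funD; apply: measurable_funM.
Qed.

Lemma weighted_wave_L2 (w : T -> R) (M : R) n : 0 <= M -> measurable_fun setT w ->
  (forall x, `|w x| <= M * \1_box x) -> L2plane (fun x => (w x)%:C * plane_wave n x).
Proof.
move=> M0 mw wM; have [m1 m2] := plane_wave_measurable n.
apply: (L2plane_bounded (M := M) box_measurable box_fin) => //.
- rewrite (_ : (fun x => _) = (fun x => w x * complex.Re (plane_wave n x))); first exact: measurable_funM.
  by apply/funext => x; case: (plane_wave n x) => p q /=; rewrite mul0r subr0.
- rewrite (_ : (fun x => _) = (fun x => w x * complex.Im (plane_wave n x))); first exact: measurable_funM.
  by apply/funext => x; case: (plane_wave n x) => p q /=; rewrite mul0r addr0.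
- move=> x; rewrite nsqM nsq_plane_wave mulr1 /nsq/= expr0n addr0 -(real_normK (num_real (w x))).
  by apply: lerXn2r => //; rewrite nnegrE mulr_ge0.
Qed.

Let i2l : 0 <= (2 * l)^-1.
Proof. by have l1 := l0; rewrite invr_ge0; lra. Qed.

Lemma exp_sys_L2 m : L2plane (exp_sys m).
Proof.
apply: (@weighted_wave_L2 (fun x => \1_box x / (2 * l)) (2 * l)^-1) => //.
  by apply: measurable_funM => //; apply: measurable_indic; exact: box_measurable.
by move=> x; rewrite ger0_norm ?mulr_ge0// mulrC.
Qed.

Lemma exp_sys_inner m k : inner2 (exp_sys m) (exp_sys k) = (m == k)%:R.
Proof.
have [p Hp] : exists p : int, p = (int_pair m).1 - (int_pair k).1 by exists ((int_pair m).1 - (int_pair k).1).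
have [q Hq] : exists q : int, q = (int_pair m).2 - (int_pair k).2 by exists ((int_pair m).2 - (int_pair k).2).
have l1 := l0.
have -> : inner2 (exp_sys m) (exp_sys k) =
    cintegral (fun z => trunc_cis l c.1 (pi / l * p%:~R) z.1 * trunc_cis l c.2 (pi / l * q%:~R) z.2).
  rewrite /inner2; congr cintegral; apply/funext => x.
  have cj (t : R) : conjc (cis t) = cis (- t).
    by rewrite /cis /= sinN cosN.
  have cr (r : R) (z : R[i]) : conjc (r%:C * z) = r%:C * conjc z.
    by case: z => a b /=; congr (_ +i* _); ring.
  rewrite /exp_sys cr mulrACA.
  have -> : plane_wave (int_pair m) x * conjc (plane_wave (int_pair k) x) = cis (pi / l * p%:~R * x.1) * cis (pi / l * q%:~R * x.2).
    have cm (y z : R[i]) : conjc (y * z) = conjc y * conjc z.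
      by case: y => a b; case: z => a' b' /=; congr (_ +i* _); ring.
    rewrite /plane_wave cm !cj mulrACA -!cisD Hp Hq !intrB.
    by congr cis; ring.
  rewrite /trunc_cis [RHS]mulrACA; congr (_ * _).
  have mC (a b : R) : a%:C * b%:C = (a * b)%:C by rewrite rmorphM.
  rewrite !mC; congr (_%:C).
  rewrite indic_box !indicE; case: (_ \in _); case: (_ \in _); rewrite /= ?mul0r ?mulr0 ?mul0r//; ring.
have [u1 u2] := trunc_cis_int c.1 (pi / l * p%:~R) l0.
have [v1 v2] := trunc_cis_int c.2 (pi / l * q%:~R) l0.
rewrite cintegral_tensor// !cintegral1_trunc_cis// -natrM mulnb Hp Hq !subr_eq0.
congr (nat_of_bool _)%:R.
apply/andP/eqP => [[/eqP h1 /eqP h2]|->]; last by rewrite !eqxx.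
by rewrite -(int_pairK m) -(int_pairK k); congr int_pair_rank; rewrite [LHS]surjective_pairing h1 h2 -surjective_pairing.
Qed.

Lemma exp_sys_orth m k : m <> k -> inner2 (exp_sys m) (exp_sys k) = 0.
Proof. by move=> mk; rewrite exp_sys_inner; case: eqP. Qed.

Lemma exp_sys_unit m : exp_sys m = (fun=> 0) \/ N2 (exp_sys m) = 1.
Proof.
right; have := inner2_self (exp_sys_L2 m); rewrite exp_sys_inner eqxx => h.
by have := congr1 (@complex.Re R) h.
Qed.

Definition is_plane_wave (v : T -> R[i]) := exists n, v = plane_wave n.

Lemma is_plane_wave1 : is_plane_wave (fun=> 1).
Proof.
exists (0, 0); apply/funext => x; rewrite /plane_wave /= mulr0 !mul0r /cis cos0 sin0.
by simpc.
Qed.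

Lemma plane_wave_approx n : approximable exp_sys (fun x => (\1_box x)%:C * plane_wave n x).
Proof.
have := approx_Z exp_sys_L2 (2 * l)%:C (exp_sys_L2 (int_pair_rank n)) (approx_e exp_sys (int_pair_rank n)).
congr approximable; apply/funext => x; rewrite /exp_sys int_pair_rankK mulrA -rmorphM; congr (_%:C * _).
by rewrite mulrC divfK// mulf_neq0// gt_eqF.
Qed.

(* A half-line cuts the cell along an arc of the circle of arguments; it is separated by an
   affine function of cos (theta - theta0). *)
Let sep_arc (x0 : R) (pr : T -> R) (n : int * int) (A : set R) :
  (forall x, plane_wave n x = cis (pi / l * pr x)) ->
  (forall x, plane_wave (- n.1, - n.2) x = cis (- (pi / l * pr x))) ->
  (forall x, box x -> x0 - l < pr x < x0 + l) ->
  halfline A -> exists p, separates box is_plane_wave p (pr @^-1` A).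
Proof.
move=> en enN prb.
have cst0 : separates box is_plane_wave (fun=> 0) setT.
  split; first exact: (Cspan_cst is_plane_wave1).
  by move=> x _; split=> [|_|/(_ I)//]; rewrite ?lexx ?ler01//; lra.
move=> [->|[a ->]]; first by exists (fun=> 0).
have l1 := l0.
have pi0 := pi_gt0 R.
have pil : 0 < pi / l by rewrite divr_gt0.
have [h1|h1] := leP (x0 + l) a.
  exists (fun=> 0); split; first exact: (Cspan_cst is_plane_wave1).
  move=> x bx; have := prb x bx => h; split=> [|_|[]]; first by rewrite lexx ler01.
    lra.
  by rewrite /= in_itv/=; lra.
have [h2|h2] := leP a (x0 - l).
  exists (fun=> 1); split; first exact: (Cspan_cst is_plane_wave1).
  move=> x bx; have := prb x bx => h; split=> [|/=|_]; first by rewrite lexx ler01.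
    by rewrite in_itv/=; lra.
  lra.
(* The points before [a] fill the interval from [x0 - l] to [a]: seen as an arc, [mid] is its
   midpoint and [half] its half-length. *)
pose half := pi / l * ((a - (x0 - l)) / 2).
pose mid := pi / l * ((a + (x0 - l)) / 2).
exists (fun x => (1/2 + cos half / 4) + (- (1/4)) * cos (pi / l * pr x - mid)); split.
  have -> : cpx (fun x => (1/2 + cos half / 4) + (- (1/4)) * cos (pi / l * pr x - mid)) =
    (fun x => (1/2 + cos half / 4)%:C + ((- (1/8))%:C * cis (- mid) * plane_wave n x +
       (- (1/8))%:C * cis mid * plane_wave (- n.1, - n.2) x)).
    have cc (w : R) : cis w + cis (- w) = (2 * cos w)%:C.
      by rewrite /cis sinN cosN; simpc; congr (_ +i* _); ring.
    have mC (u v : R) : u%:C * v%:C = (u * v)%:C by rewrite rmorphM.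
    apply/funext => x; rewrite en enN.
    rewrite -[_ * cis (- mid) * _]mulrA -[_ * cis mid * _]mulrA -!cisD.
    have -> : mid - pi / l * pr x = - (pi / l * pr x - mid) by ring.
    have -> : - mid + pi / l * pr x = pi / l * pr x - mid by ring.
    rewrite -mulrDr cc mC /cpx [LHS]rmorphD; congr (_ + _%:C).
    by field.
  apply: Cspan_add; first exact: (Cspan_cst is_plane_wave1).
  by apply: Cspan_add; apply: Cspan_scale; apply: CspanM; eexists; reflexivity.
move=> x bx; have hx := prb x bx.
have hh : 0 < half < pi.
  rewrite /half mulr_gt0//=; last lra.
  rewrite mulrAC -mulrA gtr_pMr// ltr_pdivrMr//; lra.
have zE : pi / l * pr x - mid = pi / l * (pr x - (a + (x0 - l)) / 2) by rewrite /mid; ring.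
have cb := cos_geN1 half; have cb2 := cos_le1 half.
have zb := cos_geN1 (pi / l * pr x - mid); have zb2 := cos_le1 (pi / l * pr x - mid).
split; rewrite /= ?in_itv/=; first by apply/andP; split; lra.
  move=> xa; suff : cos half < cos (pi / l * pr x - mid) by lra.
  have h3 : `|pi / l * pr x - mid| < half.
    rewrite zE /half normrM (gtr0_norm pil) ltr_pM2l// ltr_norml; lra.
  have -> : cos (pi / l * pr x - mid) = cos `|pi / l * pr x - mid|.
    by case: (ger0P (pi / l * pr x - mid)) => // _; rewrite cosN.
  rewrite ltr_cos// in_itv/=; first by rewrite normr_ge0/=; lra.
  lra.
move=> /negP; rewrite -leNgt => ax.
suff : cos (pi / l * pr x - mid) <= cos half by lra.
(* Past the arc the angle runs from [half] to [2 * pi - half], where the cosine is at most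
   [cos half]; angles above [pi] are reflected. *)
have z1 : half <= pi / l * pr x - mid.
  by rewrite zE /half ler_pM2l//; lra.
have z2 : pi / l * pr x - mid <= 2 * pi - half.
  have -> : 2 * pi = pi / l * (2 * l) by field; rewrite gt_eqF.
  by rewrite zE /half -mulrBr ler_pM2l//; lra.
set z := pi / l * pr x - mid in z1 z2 *.
have mono u v : 0 <= u -> u <= v -> v <= pi -> cos v <= cos u.
  move=> u0 uv vp; rewrite leNgt ltr_cos ?in_itv/=; [|lra|lra].
  by rewrite -leNgt.
have [zp|zp] := leP z pi; first by apply: mono; lra.
have -> : cos z = cos (2 * pi - z).
  rewrite -[RHS]cosN opprB.
  by have := @cos_2pi R (z - 2 * pi) 1; rewrite mulr1 subrK.
apply: mono; lra.
Qed.

Lemma exp_sys_parseval g : L2plane g -> (forall x, ~ box x -> g x = 0) ->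
  (\sum_(0 <= m <oo) (nsq (inner2 g (exp_sys m)))%:E = (N2 g)%:E)%E.
Proof.
have l1 := l0.
apply: (@parseval_separating R exp_sys exp_sys_L2 box box_measurable box_fin is_plane_wave is_plane_wave1) => //.
- move=> _ _ [n ->] [n' ->]; exists (n.1 + n'.1, n.2 + n'.2).
  by apply/funext => x; exact: plane_waveM.
- move=> _ [n ->]; apply: (@weighted_wave_L2 (fun x => \1_box x) 1) => //.
    by apply: measurable_indic; exact: box_measurable.
  by move=> x; rewrite mul1r ger0_norm.
- by move=> _ [n ->]; exact: plane_wave_approx.
- move=> A; apply: (@sep_arc c.1 fst (1, 0)).
  + by move=> x; rewrite /plane_wave /= mulr1 mulr0 mul0r /cis cos0 sin0; simpc.
  + by move=> x; rewrite /plane_wave /= oppr0 mulr0 mul0r mulrN mulr1 mulNr /cis cos0 sin0; simpc.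
  + by move=> x [/=]; rewrite in_itv.
- move=> A; apply: (@sep_arc c.2 snd (0, 1)).
  + by move=> x; rewrite /plane_wave /= mulr1 mulr0 mul0r /cis cos0 sin0; simpc.
  + by move=> x; rewrite /plane_wave /= oppr0 mulr0 mul0r mulrN mulr1 mulNr /cis cos0 sin0; simpc.
  + by move=> x [_ /=]; rewrite in_itv.
- exact: exp_sys_orth.
- exact: exp_sys_unit.
Qed.

End ExpCell.

Section Weights.
Variable R : realType.
Notation T := (R * R)%type.
Notation mu := (@leb2 R).
Local Open Scope complex_scope.
Implicit Types (w : T -> R) (f e : T -> R[i]).

Lemma inner2_weight w f e :
  inner2 f (fun x => (w x)%:C * e x) = inner2 (fun x => (w x)%:C * f x) e.
Proof.
rewrite /inner2; congr cintegral; apply/funext => x.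
by case: (f x) => a b; case: (e x) => p q /=; congr (_ +i* _); ring.
Qed.

Lemma nsq_weight (r : R) (z : R[i]) : nsq (r%:C * z) = r ^+ 2 * nsq z.
Proof. by rewrite nsqM [nsq r%:C]/nsq /= expr0n addr0. Qed.

Lemma weight_L2 w f : measurable_fun setT w -> (forall x, `|w x| <= 1) -> L2plane f ->
  L2plane (fun x => (w x)%:C * f x).
Proof.
move=> mw w1 [m1 m2 fin]; split.
- rewrite (_ : (fun x => _) = (fun x => w x * complex.Re (f x))); first exact: measurable_funM.
  by apply/funext => x; case: (f x) => p q /=; rewrite mul0r subr0.
- rewrite (_ : (fun x => _) = (fun x => w x * complex.Im (f x))); first exact: measurable_funM.
  by apply/funext => x; case: (f x) => p q /=; rewrite mul0r addr0.
- apply: le_lt_trans fin; rewrite /L2sqnorm.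
  have mn : measurable_fun setT (fun x => nsq (f x)).
    by apply: measurable_funD; exact: measurable_funX.
  under eq_integral do rewrite nsqE nsq_weight.
  under [leRHS]eq_integral do rewrite nsqE.
  apply: ge0_le_integral => //.
  + by move=> x _; rewrite lee_fin mulr_ge0 ?sqr_ge0 ?nsq_ge0.
  + by apply/measurable_EFinP; apply: measurable_funM => //; exact: measurable_funX.
  + exact/measurable_EFinP.
  + move=> x _; rewrite lee_fin ler_piMl ?nsq_ge0// -(real_normK (num_real _)).
    by rewrite exprn_ile1.
Qed.

Lemma L2sqnorm_weight w f : L2sqnorm setT (fun x => (w x)%:C * f x) =
  (\int[mu]_x (w x ^+ 2 * nsq (f x))%:E)%E.
Proof. by apply: eq_integral => x _; rewrite nsqE nsq_weight. Qed.

End Weights.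

(** * Wave packets: Parseval identity and Fourier decay *)

Section WavePacket.
Variable R : realType.
Notation T := (R * R)%type.
Notation mu := (@leb2 R).
Notation lm := (@lebesgue_measure R).
Local Open Scope complex_scope.
Variables (s l : R) (c : T).
Hypotheses (s1 : 1 < s) (l0 : 0 < l).

Definition window (x : T) : R := bump s l c.1 x.1 * bump s l c.2 x.2.

Definition wave_packet (m : nat) (x : T) : R[i] := (window x)%:C * exp_sys l c m x.

Lemma window_measurable : measurable_fun setT window.
Proof.
apply: measurable_funM.
  exact: (measurableT_comp (bump_measurable c.1 s1 l0)).
exact: (measurableT_comp (bump_measurable c.2 s1 l0)).
Qed.

Lemma window01 x : 0 <= window x <= 1.
Proof.
have /andP[a1 a2] := bump01 c.1 s1 l0 x.1; have /andP[b1 b2] := bump01 c.2 s1 l0 x.2.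
by rewrite /window mulr_ge0// mulr_ile1.
Qed.

Lemma window_norm x : `|window x| <= 1.
Proof. by have /andP[a b] := window01 x; rewrite ger0_norm. Qed.

Lemma window_eq1 x : `|x.1 - c.1| <= l / 2 -> `|x.2 - c.2| <= l / 2 -> window x = 1.
Proof. by move=> h1 h2; rewrite /window !bump_eq1 ?mulr1. Qed.

Lemma window_supp x : ~ box l c x -> window x = 0.
Proof.
move=> nb; rewrite /window.
have [h1|h1] := leP l `|x.1 - c.1|; first by rewrite bump_eq0 ?mul0r.
have [h2|h2] := leP l `|x.2 - c.2|; first by rewrite [bump _ _ c.2 _]bump_eq0 ?mulr0.
exfalso; apply: nb; move: h1 h2; rewrite !ltr_norml => h1 h2.
by split; rewrite /= in_itv/=; apply/andP; split; lra.
Qed.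

Lemma window_neq0 x : window x != 0 -> `|x.1 - c.1| < l /\ `|x.2 - c.2| < l.
Proof.
move=> w0; have [bx|nb] := pselect (box l c x); last by rewrite window_supp// eqxx in w0.
by case: bx => /=; rewrite !in_itv/= !ltr_norml => h1 h2; split; apply/andP; split; lra.
Qed.

Lemma wave_packet_L2 m : L2plane (wave_packet m).
Proof. by apply: weight_L2; [exact: window_measurable|exact: window_norm|exact: exp_sys_L2]. Qed.

Lemma wave_packet_supp m x : ~ box l c x -> wave_packet m x = 0.
Proof. by move=> nb; rewrite /wave_packet window_supp// mul0r. Qed.

Lemma wave_packet_parseval f : L2plane f ->
  (\sum_(0 <= m <oo) (nsq (inner2 f (wave_packet m)))%:E = \int[mu]_x (window x ^+ 2 * nsq (f x))%:E)%E.
Proof.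
move=> hf; rewrite -L2sqnorm_weight.
have wf := weight_L2 window_measurable window_norm hf.
rewrite L2sqnormE// -(exp_sys_parseval l0 wf (c := c)); last by move=> x nb; rewrite window_supp// mul0r.
by apply: eq_eseriesr => m _; rewrite inner2_weight.
Qed.

(* The normalised modulus, up to a factor, of the Fourier transform of a one-dimensional window. *)
Definition window_gain (x0 eta : R) : R :=
  Num.max `|phase_integral (bump s l x0) eta 0| `|phase_integral (bump s l x0) eta (- (pi / 2))| / (2 * l).

Lemma window_gain_ind (P : R -> Prop) (x0 eta : R) :
  (forall th, P (`|phase_integral (bump s l x0) eta th| / (2 * l))) -> P (window_gain x0 eta).
Proof. by move=> h; rewrite /window_gain /Num.max; case: ifP. Qed.

Let l2 : 0 < 2 * l. Proof. by rewrite mulr_gt0. Qed.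

Lemma window_gain01 x0 eta : 0 <= window_gain x0 eta <= 1.
Proof.
apply: (@window_gain_ind (fun z => 0 <= z <= 1)) => th; rewrite divr_ge0 ?(ltW l2)//=.
by rewrite ler_pdivrMr// mul1r; exact: bump_phase_integral_le.
Qed.

Let window_gain_prod x0 eta th m : 0 < l * `|eta| ->
  `|phase_integral (bump s l x0) eta th| / (2 * l) <= \prod_(i < m) (2 / (avg_width s i * (l * `|eta|))).
Proof.
rewrite pmulr_rgt0// normr_gt0 => e0.
by rewrite ler_pdivrMr// mulrC; exact: bump_phase_integral.
Qed.

Let ly (eta : R) : 0 <= l * `|eta|.
Proof. by rewrite mulr_ge0// ltW. Qed.

Let pn01 (x0 eta th : R) : 0 <= `|phase_integral (bump s l x0) eta th| / (2 * l) <= 1.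
Proof.
rewrite divr_ge0 ?(ltW l2)//= ler_pdivrMr// mul1r; exact: bump_phase_integral_le.
Qed.

Lemma window_gain_decay x0 eta : window_gain x0 eta <= decay s (l * `|eta|).
Proof.
apply: (@window_gain_ind (fun z => z <= _)) => th; apply: (decay_of_prod s1) => //.
  by have /andP[] := pn01 x0 eta th.
by move=> y0 m; exact: window_gain_prod.
Qed.

Lemma window_gain_poly x0 eta : window_gain x0 eta * (1 + l * `|eta|) ^+ 4 <= poly_const s.
Proof.
apply: (@window_gain_ind (fun z => z * _ <= _)) => th; apply: (poly_of_prod s1) => //.
by move=> y0 m; exact: window_gain_prod.
Qed.

Let Wint (x0 eta k : R) :
  lm.-integrable setT (EFin \o (fun y => complex.Re ((k * bump s l x0 y)%:C * cis (eta * y)))) /\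
  lm.-integrable setT (EFin \o (fun y => complex.Im ((k * bump s l x0 y)%:C * cis (eta * y)))).
Proof.
have i1 th := phase_integral_integrable_m eta th (bump_measurable x0 s1 l0) (bump_supp x0 s1 l0).
split.
- have := integrableZl measurableT k (i1 0).
  congr integrable; apply/funext => y /=; congr EFin.
  by rewrite mul0r subr0 addr0 mulrA.
- have := integrableZl measurableT k (i1 (- (pi / 2))).
  congr integrable; apply/funext => y /=; congr EFin.
  by rewrite mul0r addr0 cosB cos_pihalf sin_pihalf; ring.
Qed.

Let cintW (x0 eta k : R) :
  cintegral1 (fun y => (k * bump s l x0 y)%:C * cis (eta * y)) =
  k%:C * (phase_integral (bump s l x0) eta 0 +i* phase_integral (bump s l x0) eta (- (pi / 2))).
Proof.
have i1 th := phase_integral_integrable_m eta th (bump_measurable x0 s1 l0) (bump_supp x0 s1 l0).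
rewrite /cintegral1 /phase_integral; simpc; rewrite -!RintegralZl//.
congr (_ +i* _); apply: eq_Rintegral => y _ /=.
  by rewrite mul0r subr0 addr0 mulrA.
by rewrite mul0r addr0 cosB cos_pihalf sin_pihalf; ring.
Qed.

(** The integral factors over the two variables, at the offset of [xi] from the packet frequency.
    Each factor has squared modulus at most [2 (2 l gain)^2], the gain bounding real and imaginary
    part separately, and the normalisation contributes [(2 l)^(- 2)]; together [16 l^2]. *)
Lemma wave_packet_fourier m xi :
  nsq (fourier2 (wave_packet m) xi) <= 16 * l ^+ 2 *
    (window_gain c.1 (pi / l * (int_pair m).1%:~R - xi.1) * window_gain c.2 (pi / l * (int_pair m).2%:~R - xi.2)) ^+ 2.
Proof.
apply: le_trans (nsq_fourier2_le _ _) _.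
set e1 := pi / l * _ - xi.1; set e2 := pi / l * _ - xi.2.
have -> : cintegral (fun x => wave_packet m x * expNi (dot2 x xi)) =
    cintegral (fun z : T => ((2 * l)^-1 * bump s l c.1 z.1)%:C * cis (e1 * z.1) *
      ((1 * bump s l c.2 z.2)%:C * cis (e2 * z.2))).
  congr cintegral; apply/funext => x.
  have -> : expNi (dot2 x xi) = cis (- (xi.1 * x.1)) * cis (- (xi.2 * x.2)).
    have -> : expNi (dot2 x xi) = cis (- dot2 x xi) by rewrite /expNi /cis cosN sinN.
    by rewrite -cisD /dot2; congr cis; ring.
  have -> : cis (e1 * x.1) = cis (pi / l * (int_pair m).1%:~R * x.1) * cis (- (xi.1 * x.1)).
    by rewrite -cisD /e1; congr cis; ring.
  have -> : cis (e2 * x.2) = cis (pi / l * (int_pair m).2%:~R * x.2) * cis (- (xi.2 * x.2)).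
    by rewrite -cisD /e2; congr cis; ring.
  have -> : wave_packet m x = ((2 * l)^-1 * bump s l c.1 x.1)%:C * (1 * bump s l c.2 x.2)%:C * plane_wave l (int_pair m) x.
    have mC (u v : R) : u%:C * v%:C = (u * v)%:C by rewrite rmorphM.
    rewrite /wave_packet /exp_sys mulrA !mC; congr (_%:C * _); rewrite /window.
    have [bx|nb] := pselect (box l c x); first by rewrite indicE mem_set//=; ring.
    have := window_supp nb; rewrite /window indicE memNset// => h.
    by rewrite mul0r mulr0 mul1r -mulrA h mulr0.
  by rewrite /plane_wave; ring.
have [u1 u2] := Wint c.1 e1 (2 * l)^-1.
have [v1 v2] := Wint c.2 e2 1.
rewrite (@cintegral_tensor R (fun y => ((2 * l)^-1 * bump s l c.1 y)%:C * cis (e1 * y))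
  (fun y => (1 * bump s l c.2 y)%:C * cis (e2 * y)))// !cintW.
have key x0 eta : nsq (phase_integral (bump s l x0) eta 0 +i* phase_integral (bump s l x0) eta (- (pi / 2))) <=
    2 * (2 * l * window_gain x0 eta) ^+ 2.
  rewrite /nsq /=.
  have h th : `|phase_integral (bump s l x0) eta th| <= 2 * l * window_gain x0 eta ->
      phase_integral (bump s l x0) eta th ^+ 2 <= (2 * l * window_gain x0 eta) ^+ 2.
    by move=> h; rewrite -(real_normK (num_real _)); apply: lerXn2r; rewrite ?nnegrE// (le_trans _ h).
  have e : 2 * l * window_gain x0 eta = Num.max `|phase_integral (bump s l x0) eta 0| `|phase_integral (bump s l x0) eta (- (pi / 2))|.
    by rewrite /window_gain mulrC divfK// gt_eqF.
  have h1 := h 0; have h2 := h (- (pi / 2)).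
  have hh1 : `|phase_integral (bump s l x0) eta 0| <= 2 * l * window_gain x0 eta by rewrite e le_max lexx.
  have hh2 : `|phase_integral (bump s l x0) eta (- (pi / 2))| <= 2 * l * window_gain x0 eta by rewrite e le_max lexx orbT.
  have := h1 hh1; have := h2 hh2; lra.
rewrite !nsqM.
have k1 := key c.1 e1; have k2 := key c.2 e2.
have -> : nsq ((2 * l)^-1)%:C = ((2 * l)^-1) ^+ 2 by rewrite /nsq/= expr0n addr0.
have -> : nsq (1 : R)%:C = 1 by rewrite /nsq/= expr0n addr0 expr1n.
rewrite mul1r.
apply: (@le_trans _ _ ((2 * l)^-1 ^+ 2 * (2 * (2 * l * window_gain c.1 e1) ^+ 2) * (2 * (2 * l * window_gain c.2 e2) ^+ 2))).
  apply: ler_pM => //; first by rewrite mulr_ge0 ?sqr_ge0 ?nsq_ge0.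
    exact: nsq_ge0.
  by rewrite ler_wpM2l// sqr_ge0.
rewrite le_eqVlt; apply/orP; left; apply/eqP; field.
by rewrite gt_eqF.
Qed.

End WavePacket.

(** * Counting and covering cells *)

Section Spread.

Lemma card_spread N p (A : {set 'I_N}) :
  (forall i i', i \in A -> i' \in A -> (i' < i + p)%N) -> (#|A| <= p)%N.
Proof.
move=> hA; have [->|[i0 i0A]] := set_0Vmem A; first by rewrite cards0.
pose m := [arg min_(i < i0 in A) i].
have [mA mmin] : m \in A /\ forall i, i \in A -> (m <= i)%N.
  by rewrite /m; case: arg_minnP => // i iA h.
rewrite cardE -(size_map val) -(size_iota m p); apply: uniq_leq_size.
  by rewrite map_inj_uniq ?enum_uniq//; exact: val_inj.
move=> _ /mapP[i + ->]; rewrite mem_enum => iA; rewrite mem_iota mmin//=.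
exact: hA.
Qed.

(** A uniform bound on duplicate-free lists yields finiteness and cardinality at once, so counting
    never presupposes a finite set. *)
Lemma finite_by_seq (T : choiceType) (A : set T) (b : nat) :
  (forall F : seq T, uniq F -> (forall x, x \in F -> A x) -> (size F <= b)%N) ->
  finite_set A /\ (#|` fset_set A| <= b)%N.
Proof.
move=> h; have fA : finite_set A.
  apply: contrapT => /(infinite_set_fset b.+1)[B BA].
  have : (size B <= b)%N by apply: h => [|x xB]; [exact: fset_uniq|exact: BA].
  by rewrite leqNgt => /negP nB bB; exact: nB.
split=> //; apply: h; first exact: fset_uniq.
by move=> x; rewrite in_fset_set// inE.
Qed.

Lemma size_fibers (Q : finType) (F : seq (Q * nat)) (A : Q -> set nat) (b : Q -> nat) :
  uniq F -> (forall x, x \in F -> A x.1 x.2) ->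
  (forall q (G : seq nat), uniq G -> (forall m, m \in G -> A q m) -> (size G <= b q)%N) ->
  (size F <= \sum_q b q)%N.
Proof.
move=> uF FA grid_radius.
have -> : size F = (\sum_q size [seq x <- F | x.1 == q])%N.
  elim: F {uF FA} => [|x F IH]; first by rewrite /= big1.
  rewrite (eq_bigr (fun q => (x.1 == q) + size [seq y <- F | y.1 == q])%N); last first.
    by move=> q _ /=; case: eqP.
  rewrite big_split/= -IH (bigD1 x.1)//= eqxx big1 ?addn0// => q qx.
  by rewrite eq_sym (negPf qx).
apply: leq_sum => q _; rewrite -(size_map snd); apply: grid_radius.
  rewrite map_inj_in_uniq ?filter_uniq// => -[q1 m1] [q2 m2] /=.
  by rewrite !mem_filter /= => /andP[/eqP -> _] /andP[/eqP -> _] ->.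
move=> m /mapP[[q' m'] /=]; rewrite mem_filter /= => /andP[/eqP <- xF] ->.
exact: (FA _ xF).
Qed.

End Spread.

Section Norm.
Variable R : realType.
Implicit Types x y : R * R.

Lemma enorm2_ge0 x : 0 <= enorm2 x.
Proof. exact: sqrtr_ge0. Qed.

Lemma enorm2_sqr x : enorm2 x ^+ 2 = x.1 ^+ 2 + x.2 ^+ 2.
Proof. by rewrite sqr_sqrtr /dot2 -?expr2// addr_ge0 ?sqr_ge0. Qed.

Lemma enorm2_leP x (r : R) : 0 <= r -> x.1 ^+ 2 + x.2 ^+ 2 <= r ^+ 2 -> enorm2 x <= r.
Proof. by move=> r0; rewrite -enorm2_sqr ler_pXn2r ?nnegrE ?enorm2_ge0. Qed.

Lemma enorm2_coord x : `|x.1| <= enorm2 x /\ `|x.2| <= enorm2 x.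
Proof.
have h := enorm2_ge0 x.
by split; rewrite -(@ler_pXn2r _ 2)// ?nnegrE// (real_normK (num_real _)) enorm2_sqr ?lerDl ?lerDr sqr_ge0.
Qed.

(** [3 / 2] is a rational upper bound for the square root of 2. *)
Lemma enorm2_box x (r : R) : `|x.1| <= r -> `|x.2| <= r -> enorm2 x <= 3 / 2 * r.
Proof.
move=> h1 h2; have r0 : 0 <= r by apply: le_trans h1.
apply: enorm2_leP; first by rewrite mulr_ge0.
have e1 : x.1 ^+ 2 <= r ^+ 2 by rewrite -(real_normK (num_real _)); apply: lerXn2r; rewrite ?nnegrE.
have e2 : x.2 ^+ 2 <= r ^+ 2 by rewrite -(real_normK (num_real x.2)); apply: lerXn2r; rewrite ?nnegrE.
have := sqr_ge0 r; rewrite exprMn; nra.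
Qed.

Lemma enorm2_triangle x y : enorm2 (x + y) <= enorm2 x + enorm2 y.
Proof.
have hx := enorm2_ge0 x; have hy := enorm2_ge0 y.
apply: enorm2_leP; first exact: addr_ge0.
have sx := enorm2_sqr x; have sy := enorm2_sqr y.
have cs : x.1 * y.1 + x.2 * y.2 <= enorm2 x * enorm2 y.
  apply: le_trans (ler_norm _) _.
  rewrite -(@ler_pXn2r _ 2)// ?nnegrE ?mulr_ge0// (real_normK (num_real _)) exprMn sx sy.
  have := sqr_ge0 (x.1 * y.2 - x.2 * y.1); rewrite !expr2; nra.
rewrite [leRHS]sqrrD sx sy /= !expr2 -mulr_natl; nra.
Qed.

Lemma enorm2N x : enorm2 (- x) = enorm2 x.
Proof. by rewrite /enorm2 /dot2 /= !mulrNN. Qed.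

Lemma enorm2_dist x y : `|enorm2 x - enorm2 y| <= enorm2 (x - y).
Proof.
rewrite ler_norml; have := enorm2_triangle (x - y) y; have := enorm2_triangle (y - x) x.
rewrite !subrK -[enorm2 (y - x)]enorm2N opprB; lra.
Qed.

Lemma enorm2Z (k : R) x : 0 <= k -> enorm2 (k * x.1, k * x.2) = k * enorm2 x.
Proof.
move=> k0; apply/eqP; rewrite -(@eqrXn2 _ 2)// ?mulr_ge0 ?enorm2_ge0//.
by rewrite exprMn !enorm2_sqr /= !exprMn mulrDr.
Qed.

End Norm.

(** * Lattice points in an annulus *)

Section Lattice.
Local Close Scope classical_set_scope.
Variable R : realType.
Variable h : nat.
Notation N := (h.*2.+1).

(** The ordinals stand for the integers from [- h] to [h], which keeps the cells in a finite
    type. *)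
Definition grid_coord (i : 'I_N) : R := (nat_of_ord i)%:R - h%:R.

Definition lattice_pt (q : 'I_N * 'I_N) : R * R := (grid_coord q.1, grid_coord q.2).

Lemma grid_coord_lt (i i' : 'I_N) p : grid_coord i' - grid_coord i < p%:R -> (i' < i + p)%N.
Proof. by rewrite /grid_coord opprB addrA subrK ltrBlDr -natrD ltr_nat addnC. Qed.

Lemma card_near (y r : R) (p : nat) (A : {set 'I_N}) : 2 * r < p%:R ->
  (forall i, i \in A -> `|y - grid_coord i| <= r) -> (#|A| <= p)%N.
Proof.
move=> rp hA; apply: card_spread => i i' /hA h1 /hA h2; apply: grid_coord_lt.
move: h1 h2; rewrite !ler_norml; lra.
Qed.

(* Rows with |coordinate| at most that of the column meet the annulus in O(1) points, because
   there the slope of the circle is at most 1; 748 = 44 * 17 with 44 points per row. *)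
Let card_half (rho : R) (P : 'I_N -> 'I_N -> bool) : 1 <= rho ->
  (forall i j, P i j -> [/\ `|grid_coord i| <= `|grid_coord j|, `|grid_coord i| < rho + 7 &
     exists E, [/\ `|E - rho| < 7, 0 <= E & E ^+ 2 = grid_coord i ^+ 2 + grid_coord j ^+ 2]]) ->
  (\sum_i #|[set j | P i j]|)%:R <= 748 * rho.
Proof.
move=> rho1 hP.
pose nr i := `|grid_coord i| < rho + 7.
have row i : (#|[set j | P i j]| <= (if nr i then 44 else 0))%N.
  case: ifPn => hi; last first.
    rewrite leqn0 cards_eq0; apply/eqP/setP => j; rewrite !inE.
    by apply/negP => /hP[_ h2 _]; rewrite /nr h2 in hi.
  have -> : [set j | P i j] = [set j | P i j & (0 <= grid_coord j)%R] :|: [set j | P i j & (grid_coord j < 0)%R].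
    by apply/setP => j; rewrite !inE -andb_orr; case: ltP; rewrite ?andbT.
  apply: leq_trans (leq_card_setU _ _) _; rewrite (_ : 44 = 22 + 22)%N//.
  (* Both radii lie within 7 of [rho], and [u <= a], [u <= b] bound their sum by [3/2 (a + b)].
     Hence [(b - a)(b + a) <= 14 * 3/2 * (a + b)], so [b - a <= 21]; the two signs of the coordinate
     give 44 per row. *)
  have aux a b E E' (u : R) : 0 <= u -> u <= a -> u <= b -> `|E - rho| < 7 -> `|E' - rho| < 7 ->
      0 <= E -> 0 <= E' -> E ^+ 2 = u ^+ 2 + a ^+ 2 -> E' ^+ 2 = u ^+ 2 + b ^+ 2 -> b - a < 22%:R.
    move=> u0 ua ub; rewrite !ltr_norml => /andP[e1 e2] /andP[e3 e4] E0 E0' Ea Eb.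
    have [ba|ab] := leP b a; first lra.
    have Ea2 : E <= 3/2 * a.
      rewrite -(@ler_pXn2r _ 2)// ?nnegrE//; [|lra].
      by rewrite Ea exprMn !expr2; nra.
    have Eb2 : E' <= 3/2 * b.
      rewrite -(@ler_pXn2r _ 2)// ?nnegrE//; [|lra].
      by rewrite Eb exprMn !expr2; nra.
    have d : (b - a) * (b + a) = (E' - E) * (E' + E).
      have -> : (b - a) * (b + a) = b ^+ 2 - a ^+ 2 by ring.
      have -> : (E' - E) * (E' + E) = E' ^+ 2 - E ^+ 2 by ring.
      by rewrite Ea Eb; ring.
    have h2 : (E' - E) * (E' + E) <= 14 * (3/2 * (b + a)) by nra.
    rewrite ltNge; apply/negP => hh.
    nra.
  apply: leq_add; apply: card_spread => j j'; rewrite !inE => /andP[/hP[h1 _ [E [e1 e2 e3]]] j0]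
    /andP[/hP[h1' _ [E' [e1' e2' e3']]] j0']; apply: grid_coord_lt.
    apply: (aux _ _ E E' `|grid_coord i|) => //; rewrite ?(real_normK (num_real _))//.
      by rewrite -(ger0_norm j0).
    by rewrite -(ger0_norm j0').
  have -> : grid_coord j' - grid_coord j = (- grid_coord j) - (- grid_coord j') by ring.
  apply: (aux _ _ E' E `|grid_coord i|) => //; rewrite ?(real_normK (num_real _)) ?sqrrN//.
    by rewrite -(ltr0_norm j0').
  by rewrite -(ltr0_norm j0).
have h1 : (\sum_i #|[set j | P i j]| <= 44 * #|[set i | nr i]|)%N.
  rewrite mulnC -sum_nat_const; apply: leq_trans (leq_sum _ (fun i _ => row i)) _.
  rewrite [leqRHS]big_mkcond/=; apply: leq_sum => i _.
  by rewrite inE.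
(* There are at most [2 rho + 15] rows, and this is at most [17 rho] since [rho >= 1]. *)
have h2 : (#|[set i | nr i]| <= (Num.trunc (2 * rho + 14)%R).+1)%N.
  apply: (@card_near 0 (rho + 7)).
    have := truncnS_gt (2 * rho + 14); lra.
  by move=> i; rewrite inE /nr sub0r normrN => /ltW.
have h3 : (Num.trunc (2 * rho + 14))%:R <= 2 * rho + 14.
  by rewrite truncn_le; lra.
have : (\sum_i #|[set j | P i j]|)%:R <= 44 * ((Num.trunc (2 * rho + 14)).+1)%:R :> R.
  by rewrite -natrM ler_nat; apply: leq_trans h1 _; rewrite leq_mul2l h2.
rewrite -natr1; lra.
Qed.

Lemma card_pairs (P : 'I_N -> 'I_N -> bool) :
  (#|[set q : 'I_N * 'I_N | P q.1 q.2]| = \sum_i #|[set j | P i j]|)%N.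
Proof.
rewrite -sum1_card big_mkcond/= (eq_bigr (fun q => if P q.1 q.2 then 1 else 0)%N); last first.
  by move=> q _; rewrite inE.
rewrite -(pair_big_dep xpredT (fun _ => xpredT) (fun i j => if P i j then 1 else 0)%N)/=.
by apply: eq_bigr => i _; rewrite -big_mkcond/= -sum1_card; apply: eq_bigl => j; rewrite inE.
Qed.

(** The diagonals split the lattice into two halves exchanged by swapping coordinates, so 1496 is
    twice 748. The half-width 7 covers both cell selections. *)
Lemma card_annulus (rho : R) : 1 <= rho ->
  (#|[set q | `|rho - enorm2 (lattice_pt q)| < 7]|)%:R <= 1496 * rho.
Proof.
move=> rho1.
pose A1 := [set q : 'I_N * 'I_N | (`|rho - enorm2 (lattice_pt q)| < 7) && (`|grid_coord q.1| <= `|grid_coord q.2|)].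
pose A2 := [set q : 'I_N * 'I_N | (`|rho - enorm2 (lattice_pt q)| < 7) && (`|grid_coord q.2| <= `|grid_coord q.1|)].
have sub : [set q | `|rho - enorm2 (lattice_pt q)| < 7] \subset A1 :|: A2.
  by apply/fintype.subsetP => q; rewrite !inE => ->/=; case: leP => //= /ltW ->.
have key i j : `|rho - enorm2 (lattice_pt (i, j))| < 7 ->
    [/\ `|grid_coord i| < rho + 7, `|grid_coord j| < rho + 7 & `|enorm2 (lattice_pt (i, j)) - rho| < 7].
  have [/= c1 c2] := enorm2_coord (lattice_pt (i, j)).
  by rewrite distrC => H; have := H; rewrite ltr_norml => H2; split => //; lra.
have c1 : (#|A1|)%:R <= 748 * rho.
  rewrite /A1 (card_pairs (fun i j => (`|rho - enorm2 (lattice_pt (i, j))| < 7) && (`|grid_coord i| <= `|grid_coord j|))).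
  apply: card_half => // i j /andP[/key[k1 k2 k3] k4]; split=> //.
  by exists (enorm2 (lattice_pt (i, j))); rewrite enorm2_ge0 enorm2_sqr.
have c2 : (#|A2|)%:R <= 748 * rho.
  have -> : #|A2| = #|[set q : 'I_N * 'I_N | (`|rho - enorm2 (lattice_pt (q.2, q.1))| < 7) && (`|grid_coord q.1| <= `|grid_coord q.2|)]|.
    have swK : cancel (fun q : 'I_N * 'I_N => (q.2, q.1)) (fun q => (q.2, q.1)) by case.
    rewrite -(card_imset _ (can_inj swK)); congr #|pred_of_set _|.
    apply/setP => q; apply/imsetP/idP => [[q' + ->]|]; rewrite !inE//.
    by move=> qA; exists (q.2, q.1); [rewrite inE; exact: qA|exact: surjective_pairing].
  rewrite (card_pairs (fun i j => (`|rho - enorm2 (lattice_pt (j, i))| < 7) && (`|grid_coord i| <= `|grid_coord j|))).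
  apply: card_half => // i j /andP[/key[k1 k2 k3] k4]; split=> //.
  exists (enorm2 (lattice_pt (j, i))); split; [exact: k3|exact: enorm2_ge0|].
  by rewrite enorm2_sqr [RHS]addrC.
have : (#|[set q | (`|rho - enorm2 (lattice_pt q)| < 7)%R]| <= #|A1| + #|A2|)%N.
  by apply: leq_trans (subset_leq_card sub) _; exact: leq_card_setU.
rewrite -(ler_nat R) natrD; lra.
Qed.

End Lattice.

(** * Whitney covering of the disk *)

Section Cells.
Variable R : realType.
Variables (j : nat) (s : R).
Notation T := (R * R)%type.
Notation mu := (@leb2 R).

Definition grid_radius : nat := (2 ^ j).+1.
Notation N := (grid_radius.*2.+1).

Definition cell : finType := (('I_N * 'I_N) + ('I_j * ('I_N * 'I_N)))%type.

Notation rad := (2 ^+ j : R).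

(* Only the selected cells carry a nonzero system; the index set contains the others too, with
   the function 0, so that it is a plain finite type. *)
Definition boundary_sel (q : 'I_N * 'I_N) : bool := `|rad - enorm2 (lattice_pt R q)| < 4.

(** In units of [2^k], [cell_weight_cover] needs depths from 3 to 6, widened by a rounding error of
    3/4. The lower bound 2 exceeds the bound 3/2 on the half-diagonal, which keeps the whole square
    inside the disk. *)
Definition interior_sel (k : 'I_j) (q : 'I_N * 'I_N) : bool := 2 <= rad / 2 ^+ k - enorm2 (lattice_pt R q) < 7.

Definition boundary_cell (q : 'I_N * 'I_N) : set T :=
  [set x | disk rad x /\ (`|x.1 - (lattice_pt R q).1| <= 1/2 /\ `|x.2 - (lattice_pt R q).2| <= 1/2)].

Definition interior_ctr (k : 'I_j) (q : 'I_N * 'I_N) : T := (2 ^+ k * (lattice_pt R q).1, 2 ^+ k * (lattice_pt R q).2).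

Definition cell_weight (q : cell) (x : T) : R :=
  match q with
  | inl c => if boundary_sel c then \1_(boundary_cell c) x else 0
  | inr (k, c) => if interior_sel k c then window s (2 ^+ k) (interior_ctr k c) x ^+ 2 else 0
  end.

Lemma grid_coord_nearest (y : R) : `|y| <= rad -> exists i : 'I_N, `|y - grid_coord R i| <= 1/2.
Proof.
rewrite ler_norml => yr.
have hE : grid_radius%:R = rad + 1 :> R by rewrite /grid_radius -natr1 natrX.
have y0 : 0 <= y + grid_radius%:R + 1/2 by rewrite hE; lra.
have /andP[t1 t2] := truncn_itv y0.
set i := Num.trunc _ in t1 t2; rewrite -[i.+1%:R]natr1 in t2.
have iN : (i < N)%N.
  rewrite -(ltr_nat R); apply: le_lt_trans t1 _.
  by rewrite -[(grid_radius.*2.+1)%:R]natr1 -mul2n natrM hE; lra.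
exists (Ordinal iN); rewrite /grid_coord /= ler_norml; lra.
Qed.

Lemma dyadic_scale (d : R) n : 3 <= d -> d < 6 * 2 ^+ n ->
  exists2 k : nat, (k <= n)%N & 3 * 2 ^+ k <= d < 6 * 2 ^+ k.
Proof.
move=> d3; elim: n => [|n IH] dn.
  by exists 0%N => //; rewrite dn expr0 mulr1 d3.
have [h|h] := leP (3 * 2 ^+ n.+1) d; first by exists n.+1 => //; rewrite h dn.
have /IH[k kn hk] : d < 6 * 2 ^+ n by move: h; rewrite exprS; lra.
by exists k => //; exact: leqW.
Qed.

Hypothesis s1 : 1 < s.

Lemma cell_weight_ge0 q x : 0 <= cell_weight q x.
Proof. by case: q => [c|[k c]] /=; case: ifP => // _; exact: sqr_ge0. Qed.

(** Depth below 3 is served by a boundary cell. Otherwise [3 * 2^k <= depth < 6 * 2^k] for some [k],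
    and rounding [x / 2^k] to the lattice puts [x] in the half-size square where the window equals
    1; [k < j] because the depth is at most the radius. *)
Lemma cell_weight_cover x : disk rad x -> exists q, cell_weight q x = 1.
Proof.
move=> dx; have dx' : enorm2 x < rad by [].
have [x1 x2] := enorm2_coord x.
have [d3|d3] := ltP (rad - enorm2 x) 3.
  have [i hi] : exists i : 'I_N, `|x.1 - grid_coord R i| <= 1/2 by apply: grid_coord_nearest; lra.
  have [i' hi'] : exists i : 'I_N, `|x.2 - grid_coord R i| <= 1/2 by apply: grid_coord_nearest; lra.
  exists (inl (i, i')) => /=.
  have nb : enorm2 (x - lattice_pt R (i, i')) <= 3 / 2 * (1/2) by apply: enorm2_box.
  have := enorm2_dist x (lattice_pt R (i, i')); rewrite ler_norml => nd.
  have -> : boundary_sel (i, i').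
    by rewrite /boundary_sel ltr_norml; apply/andP; split; lra.
  by rewrite indicE mem_set.
have [k kj /andP[hk1 hk2]] : exists2 k : nat, (k <= j)%N & 3 * 2 ^+ k <= rad - enorm2 x < 6 * 2 ^+ k.
  apply: dyadic_scale => //; have := enorm2_ge0 x; have : 0 < rad by rewrite exprn_gt0.
  lra.
have kj' : (k < j)%N.
  rewrite ltn_neqAle kj andbT; apply/eqP => kE; move: hk1; rewrite kE.
  have := enorm2_ge0 x; have : 0 < rad by rewrite exprn_gt0.
  lra.
pose l : R := 2 ^+ k; have l0 : 0 < l by rewrite exprn_gt0.
have l1 : 1 <= l by rewrite exprn_ege1//; lra.
have near_l (y : R) : `|y| <= enorm2 x -> exists i : 'I_N, `|y / l - grid_coord R i| <= 1/2.
  move=> yx; apply: grid_coord_nearest; rewrite normrM normfV (gtr0_norm l0) ler_pdivrMr//.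
  have : rad <= rad * l by rewrite ler_peMr// exprn_ge0.
  lra.
have [i hi] := near_l _ x1; have [i' hi'] := near_l _ x2.
exists (inr (Ordinal kj', (i, i'))) => /=.
pose y : T := (l^-1 * x.1, l^-1 * x.2).
have nb : enorm2 (y - lattice_pt R (i, i')) <= 3 / 2 * (1/2).
  by apply: enorm2_box; rewrite /y /= mulrC.
have := enorm2_dist y (lattice_pt R (i, i')); rewrite ler_norml => nd.
have ey : enorm2 y = l^-1 * enorm2 x by rewrite /y enorm2Z// invr_ge0 ltW.
have r1 : 3 <= rad / l - enorm2 y.
  by rewrite ey [l^-1 * _]mulrC -mulrBl ler_pdivlMr.
have r2 : rad / l - enorm2 y < 6.
  by rewrite ey [l^-1 * _]mulrC -mulrBl ltr_pdivrMr.
have -> : interior_sel (Ordinal kj') (i, i').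
  by rewrite /interior_sel /= -/l; apply/andP; split; lra.
have sc (z u : R) : `|z / l - u| <= 1/2 -> `|z - l * u| <= l / 2.
  move=> h; have -> : z - l * u = l * (z / l - u) by field; rewrite gt_eqF.
  rewrite normrM (gtr0_norm l0); have := ler_wpM2l (ltW l0) h; lra.
by rewrite window_eq1 ?expr1n//; exact: sc.
Qed.

(** [49 = 4 + 9 * 5]. A point meets at most 2 by 2 unit squares, and at scale [2^k] at most 3 by 3
    squares of half-side [2^k]. The centre's depth lies between [2 * 2^k] and [7 * 2^k] and differs
    from the depth [d] of the point by at most [3/2 * 2^k]; so [2^k <= 2 d] and [d < 9 * 2^k], which
    at most five scales satisfy. *)
Lemma cell_weight_overlap x : \sum_q cell_weight q x <= 49.
Proof.
pose nset (y r : R) : {set 'I_N} := finset (fun i : 'I_N => `|y - grid_coord R i| <= r).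
have nearb (y : R) (r : R) (p : nat) : 2 * r < p%:R -> (#|nset y r| <= p)%N.
  by move=> rp; apply: (card_near (y := y) rp) => i; rewrite inE.
have pairb (P : 'I_N * 'I_N -> bool) (y z r : R) (p : nat) : 2 * r < p%:R ->
    (forall q, P q -> `|y - grid_coord R q.1| <= r /\ `|z - grid_coord R q.2| <= r) ->
    (#|finset P| <= p * p)%N.
  move=> rp hP.
  apply: (@leq_trans #|finset.setX (nset y r) (nset z r)|).
    apply: subset_leq_card; apply/fintype.subsetP => -[i i']; rewrite !inE => /hP[h1 h2].
    by rewrite h1 h2.
  by rewrite cardsX leq_mul// nearb.
have bnd (I : finType) (f : I -> R) (P : pred I) (m : nat) : (forall i, f i <= (P i)%:R) ->
    (#|finset P| <= m)%N -> \sum_i f i <= m%:R.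
  move=> fP Pm; apply: (@le_trans _ _ (\sum_i (P i)%:R)); first exact: ler_sum.
  rewrite -natr_sum ler_nat; apply: leq_trans Pm.
  rewrite -sum1_card [leqRHS]big_mkcond/=; apply: leq_sum => i _.
  by rewrite inE; case: (P i).
rewrite big_sumType /=.
have b1 : \sum_(c : 'I_N * 'I_N) cell_weight (inl c) x <= 4.
  apply: (bnd _ _ (fun q : 'I_N * 'I_N => (`|x.1 - grid_coord R q.1| <= 1/2) && (`|x.2 - grid_coord R q.2| <= 1/2)) (2 * 2)%N).
    move=> q; rewrite /cell_weight; case: ifP => // _; rewrite indicE ler_nat.
    by case: (boolP (x \in _)) => //; rewrite inE => -[_ [-> ->]].
  apply: (pairb _ x.1 x.2 (1/2)); first lra.
  by move=> q /andP[].
have b2 : \sum_(i : 'I_j * ('I_N * 'I_N)) cell_weight (inr i) x <= 45.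
  pose d := rad - enorm2 x.
  have key (k : 'I_j) (c : 'I_N * 'I_N) : cell_weight (inr (k, c)) x != 0 ->
      [/\ `|x.1 / 2 ^+ k - grid_coord R c.1| <= 1, `|x.2 / 2 ^+ k - grid_coord R c.2| <= 1,
        d < 9 * 2 ^+ k & 2 ^+ k <= 2 * d].
    rewrite /=; case: ifP => [/andP[i1 i2]|_]; last by rewrite eqxx.
    rewrite expf_eq0/= => w0.
    pose l : R := 2 ^+ k; have l0 : 0 < l by rewrite exprn_gt0.
    have [w1 w2] := window_neq0 s1 l0 w0.
    have sc (z u : R) : `|z - l * u| < l -> `|z / l - u| <= 1.
      move=> h; have -> : z / l - u = (z - l * u) / l by field; rewrite gt_eqF.
      by rewrite normrM normfV (gtr0_norm l0) ler_pdivrMr// mul1r ltW.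
    have s1' := sc _ _ w1; have s2' := sc _ _ w2.
    have nb : enorm2 (x - interior_ctr k c) <= 3 / 2 * l by apply: enorm2_box; exact: ltW.
    have nd := enorm2_dist x (interior_ctr k c).
    have ec : enorm2 (interior_ctr k c) = l * enorm2 (lattice_pt R c) by rewrite /interior_ctr enorm2Z// ltW.
    have r1 : 2 * l <= rad - l * enorm2 (lattice_pt R c).
      have -> : rad - l * enorm2 (lattice_pt R c) = (rad / l - enorm2 (lattice_pt R c)) * l by field; rewrite gt_eqF.
      by rewrite ler_pM2r.
    have r2 : rad - l * enorm2 (lattice_pt R c) < 7 * l.
      have -> : rad - l * enorm2 (lattice_pt R c) = (rad / l - enorm2 (lattice_pt R c)) * l by field; rewrite gt_eqF.
      by rewrite ltr_pM2r.
    rewrite -/l; split => //; move: nd; rewrite ler_norml ec /d => nd; lra.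
  have -> : \sum_(i : 'I_j * ('I_N * 'I_N)) cell_weight (inr i) x = \sum_(k < j) \sum_c cell_weight (inr (k, c)) x.
    by rewrite (pair_bigA _ (fun k c => cell_weight (inr (k, c)) x)); apply: eq_bigr => -[].
  pose rk (k : 'I_j) := (d < 9 * 2 ^+ k) && (2 ^+ k <= 2 * d).
  have row (k : 'I_j) : \sum_c cell_weight (inr (k, c)) x <= (9 * rk k)%:R.
    have [hk|hk] := boolP (rk k); last first.
      rewrite muln0 big1// => c _; apply/eqP; apply: contraNT hk => /key[_ _ a b].
      by rewrite /rk a b.
    rewrite muln1; apply: (bnd _ _ (fun q : 'I_N * 'I_N => (`|x.1 / 2 ^+ k - grid_coord R q.1| <= 1) && (`|x.2 / 2 ^+ k - grid_coord R q.2| <= 1)) (3 * 3)%N).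
      move=> c; have [->|/key[-> -> _ _]] := eqVneq (cell_weight (inr (k, c)) x) 0 => //.
      rewrite /=; case: ifP => // _; have /andP[a b] := window01 (interior_ctr k c) s1 (exprn_gt0 k (ltr0Sn R 1)) x.
      by rewrite expr2 mulr_ile1.
    apply: (pairb _ (x.1 / 2 ^+ k) (x.2 / 2 ^+ k) 1); first lra.
    by move=> q /andP[].
  apply: (@le_trans _ _ (\sum_(k < j) (9 * rk k)%:R)).
    by apply: ler_sum => k _; exact: row.
  rewrite -natr_sum (_ : 45 = (9 * 5)%:R)// ler_nat -big_distrr/= leq_mul2l/=.
  have -> : (\sum_(k < j) rk k)%N =
      #|finset rk|.
    rewrite -sum1_card [RHS]big_mkcond/=; apply: eq_bigr => k _.
    by rewrite inE; case: (rk k).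
  apply: card_spread => k k'; rewrite !inE /rk => /andP[a1 a2] /andP[a3 a4].
  rewrite ltnNge; apply/negP => kk.
  have : (2 ^+ (k + 5) : R) <= 2 ^+ k' by apply: ler_weXn2l => //; lra.
  rewrite exprD; lra.
by apply: le_trans (lerD b1 b2) _; lra.
Qed.

End Cells.

Section Monotone.
Context {d} {X : measurableType d} {R : realType} (mu : {measure set X -> \bar R}).
Import HBNNSimple.
Local Open Scope ereal_scope.

(* Unlike ge0_le_integral, this needs no measurability. *)
Lemma ge0_le_integral_sub (D : set X) (f g : X -> \bar R) :
  (forall x, D x -> 0 <= f x <= g x) -> (forall x, 0 <= g x) ->
  \int[mu]_(x in D) f x <= \int[mu]_x g x.
Proof.
move=> fg g0; rewrite integral_mkcond.
have p0 x : 0 <= (f \_ D) x by rewrite patchE; case: ifPn => //; rewrite inE => /fg/andP[].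
rewrite !ge0_integralTE//; apply: le_ereal_sup => _ [h hf <-]; exists h => // x.
apply: le_trans (hf x) _; rewrite patchE; case: ifPn => //.
by rewrite inE => /fg/andP[].
Qed.

End Monotone.

(** * Geometry of the spectral domain *)

Section Geometry.
Variable R : realType.
Notation T := (R * R)%type.
Notation mu := (@leb2 R).
Notation lm := (@lebesgue_measure R).
Implicit Types (S E : set T) (p q x : T).

(** Meant for the tubes around the boundary of [S], whose measurability is never established: the
    product measure integrates the measures of sections, and both operations are monotone on
    arbitrary arguments. *)
Lemma leb2_mono (A B : set T) : A `<=` B -> (mu A <= mu B)%E.
Proof.
move=> AB; rewrite /leb2 /product_measure1 /=.
apply: ge0_le_integral_sub => x //= _; rewrite measure_ge0 /=.
apply: le_outer_measure.
by move=> y; rewrite /xsection /= !inE; exact: AB.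
Qed.

(** Connectedness of the segment: if it avoided the boundary, its part in [S] would be both open and
    closed in it. *)
Lemma segment_meets_boundary S p q : open S -> (p \in S) != (q \in S) ->
  exists2 y, boundary S y & enorm2 (p - y) <= enorm2 (p - q).
Proof.
move=> oS pq; apply: contrapT => nb.
pose g (t : R) : T := (p.1 + t * (q.1 - p.1), p.2 + t * (q.2 - p.2)).
have g0 : g 0 = p by rewrite /g !mul0r !addr0; case: (p).
have g1 : g 1 = q by rewrite /g !mul1r ![_ + (_ - _)]addrC !subrK; case: (q).
have cg : continuous g.
  have caff (a b : R) : continuous (fun t : R => a + t * b).
    by move=> t; apply: cvgD; [exact: cvg_cst|apply: cvgMr_tmp; exact: cvg_id].
  move=> t; apply: (@cvg_pair _ R R _ (nbhs (g t).1) (nbhs (g t).2) _ _ _ (fun t => p.1 + t * (q.1 - p.1)) (fun t => p.2 + t * (q.2 - p.2))); exact: caff.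
pose I : set R := `[0, 1]%classic.
have gnb t : I t -> closure S (g t) -> S (g t).
  rewrite /I /= in_itv/= => /andP[t0 t1] cS; apply: contrapT => nS; apply: nb.
  exists (g t); first by split => //; move/interior_subset.
  have -> : p - g t = (t * (p - q).1, t * (p - q).2) by congr pair; rewrite /g /=; ring.
  by rewrite enorm2Z// ler_piMl// enorm2_ge0.
pose B := I `&` g @^-1` S.
have I0 : I 0 by rewrite /I /= in_itv/= lexx ler01.
have I1 : I 1 by rewrite /I /= in_itv/= lexx ler01.
have BI : B !=set0 -> B = I.
  move=> B0; apply: (@segment_connected R 0 1) => //.
    by exists (g @^-1` S) => //; apply: open_comp => // t _; exact: cg.
  exists (g @^-1` closure S).
    by apply: preimage_closed; [move=> t _; exact: cg|exact: closed_closure].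
  rewrite eqEsubset; split=> t [It ht]; split => //; [exact: subset_closure|exact: gnb].
have [pS|npS] := boolP (p \in S).
  have : B 1 by rewrite BI//; exists 0; split => //; rewrite /= g0; exact: set_mem.
  by case=> _ /=; rewrite g1 => qS; move: pq; rewrite pS mem_set.
have qS : S q by apply: set_mem; move: pq; rewrite (negbTE npS); case: (q \in S).
have : B 0 by rewrite BI//; exists 1; split => //; rewrite /= g1.
by case=> _ /=; rewrite g0 => pS; move: npS; rewrite mem_set.
Qed.

Lemma dist2_lip E p q : (dist2 p E <= dist2 q E + (enorm2 (p - q))%:E)%E.
Proof.
rewrite -leeBlDr//; apply: le_ereal_inf_tmp => _ [y Ey <-].
rewrite leeBlDr//; apply: (@le_trans _ _ (enorm2 (p - y))%:E).
  by apply: ereal_inf_lbound; exists y.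
rewrite -EFinD lee_fin [leRHS]addrC; have -> : p - y = (p - q) + (q - y) by rewrite addrA subrK.
exact: enorm2_triangle.
Qed.

(** Turns distance from the boundary into distance from every frequency on the other side of it,
    which is the form the energy bounds use. *)
Lemma dist2_crossing S p q (t : R) : open S -> (p \in S) != (q \in S) ->
  ~ (dist2 p (boundary S) <= t%:E)%E -> t < enorm2 (p - q).
Proof.
move=> oS pq; apply: contra_notT; rewrite -leNgt => h.
have [y By hy] := segment_meets_boundary oS pq.
apply: (@le_trans _ _ (enorm2 (p - y))%:E); first by apply: ereal_inf_lbound; exists y.
by rewrite lee_fin (le_trans hy).
Qed.

(** The Hausdorff measure, known only to be below [+oo], is bounded by a nonnegative real absorbed
    into the constant, and the maximum is replaced by a sum. *)
Lemma well_shaped_tube S : well_shaped S -> exists2 C : R, 0 < C &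
  forall t : R, 0 < t ->
    (mu [set x | dist2 x (boundary S) <= t%:E] <= (C * (t ^+ 2 + t))%:E)%E.
Proof.
move=> [_ Hfin [C' C0 hC]].
have [h h0 Hh] : exists2 h : R, 0 <= h & (hausdorff1 (boundary S) <= h%:E)%E.
  move: Hfin; case: (hausdorff1 _) => [r _|//|_].
    by exists `|r| => //; rewrite lee_fin ler_norm.
  by exists 0 => //; rewrite leNye.
exists (C' * (1 + h)); first by rewrite mulr_gt0//; lra.
move=> t t0; apply: le_trans (hC t t0) _.
rewrite -mulrA [leRHS]EFinM; apply: lee_wpmul2l; first by rewrite lee_fin ltW.
rewrite ge_max lee_fin; apply/andP; split; first by rewrite expr2; nra.
apply: (@le_trans _ _ (t%:E * h%:E)%E); first by apply: lee_wpmul2l => //; rewrite lee_fin ltW.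
by rewrite -EFinM lee_fin expr2; nra.
Qed.

Lemma bounded_coord S : bounded_set S -> exists2 M : R, 0 < M &
  forall x, S x -> `|x.1| <= M /\ `|x.2| <= M.
Proof.
move=> [M [_ hM]]; exists (`|M| + 1); first by have := normr_ge0 M; lra.
move=> x Sx; have MM : M < `|M| + 1 by have := ler_norm M; lra.
by have := hM _ MM x Sx; rewrite /= prod_normE ge_max => /andP[].
Qed.

(* Disjoint squares of side a at the lattice points fit into a wider tube. *)
Lemma lattice_in_tube E (a t K : R) (F : seq (int * int)) : 0 < a -> 3 / 2 * a <= t ->
  (mu [set x | dist2 x E <= (2 * t)%:E] <= K%:E)%E -> uniq F ->
  (forall n, n \in F -> (dist2 (a * n.1%:~R, a * n.2%:~R)%R E <= t%:E)%E) ->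
  (size F)%:R * a ^+ 2 <= K.
Proof.
move=> a0 at_ hK uF hF.
(* Half-open intervals make the squares pairwise disjoint, so their areas add up. *)
pose Iv (i : int) : set R := `[a * i%:~R, a * (i + 1)%:~R[%classic.
have mIv i : measurable (Iv i) by exact: measurable_itv.
pose sq (n : int * int) : set T := Iv n.1 `*` Iv n.2.
have sqP n x : sq n x -> [/\ a * n.1%:~R <= x.1, x.1 < a * n.1%:~R + a, a * n.2%:~R <= x.2 & x.2 < a * n.2%:~R + a].
  by rewrite /sq /Iv /= !in_itv/= !intrD !mulrDr !mulr1 => -[/andP[-> ->] /andP[-> ->]].
have msq n : measurable (sq n) by exact: measurableX.
have lsq (n : int) : lm (Iv n) = a%:E.
  rewrite /Iv lebesgue_measure_itv/= lte_fin intrD mulrDr mulr1 ltrDl a0 -EFinB.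
  by congr EFin; ring.
have musq n : mu (sq n) = (a ^+ 2)%:E.
  rewrite [LHS](_ : _ = (lm (Iv n.1) * lm (Iv n.2))%E); last first.
    by apply: product_measure1E; exact: mIv.
  by rewrite !lsq -EFinM.
have un (y : R) (i i' : int) : a * i%:~R <= y -> y < a * i%:~R + a -> a * i'%:~R <= y -> y < a * i'%:~R + a -> i = i'.
  have half (k k' : int) : a * k%:~R <= y -> y < a * k'%:~R + a -> (k <= k')%R.
    move=> h1 h2; have : a * k%:~R < a * (k' + 1)%:~R by rewrite intrD mulrDr mulr1; exact: le_lt_trans h1 h2.
    by rewrite ltr_pM2l// ltr_int ltzD1.
  by move=> h1 h2 h3 h4; apply/eqP; rewrite eq_le (half i i')// (half i' i).
pose U (G : seq (int * int)) := \big[setU/set0]_(n <- G) sq n.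
have mU G : measurable (U G) by apply: bigsetU_measurable.
have UP G x : U G x -> exists2 n, n \in G & sq n x.
  rewrite /U; elim: G => [|n G IH]; first by rewrite big_nil.
  rewrite big_cons => -[h|/IH[m mG h]]; first by exists n; rewrite ?mem_head.
  by exists m; rewrite // inE mG orbT.
have muU G : uniq G -> mu (U G) = ((size G)%:R * a ^+ 2)%:E.
  elim: G => [_|n G IH]; first by rewrite /U big_nil mul0r; exact: measure0.
  rewrite cons_uniq => /andP[nG uG].
  have -> : U (n :: G) = sq n `|` U G by rewrite /U big_cons.
  have -> : mu (sq n `|` U G) = (mu (sq n) + mu (U G))%E.
    apply: measureU; [exact: msq|exact: mU|].
    rewrite -subset0 => x [/sqP[h1 h2 h3 h4] /UP[m mG /sqP[h5 h6 h7 h8]]].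
    move: nG; have -> : n = m by case: (n) (m) h1 h2 h3 h4 h5 h6 h7 h8 => ? ? [? ?] /= *; congr pair; apply: un; eassumption.
    by rewrite mG.
  have IG : mu (U G) = ((size G)%:R * a ^+ 2)%:E by exact: IH.
  have e1 : mu (sq n) = (a ^+ 2)%:E := musq n.
  rewrite IG e1 -EFinD /= -[(size G).+1%:R]natr1.
  by congr EFin; ring.
have -> : (size F)%:R * a ^+ 2 <= K = ((mu (U F) <= K%:E)%E : bool) by rewrite muU.
apply: le_trans hK; apply: leb2_mono => x /UP[n /hF hn /sqP[h1 h2 h3 h4]] /=.
apply: le_trans (dist2_lip E x (a * n.1%:~R, a * n.2%:~R)) _.
have -> : (2 * t)%:E = (t%:E + t%:E)%E by rewrite -EFinD mulr2n mulrDl mul1r.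
apply: leeD => //; rewrite lee_fin; apply: le_trans at_; apply: enorm2_box => /=.
  by rewrite ler_norml; apply/andP; split; lra.
by rewrite ler_norml; apply/andP; split; lra.
Qed.

End Geometry.

(** * Summation over the index set *)

Section Sums.
Variable R : realType.

Lemma esum_finprod (Q : finType) (a : Q * nat -> \bar R) : (forall x, 0 <= a x)%E ->
  (\esum_(x in setT) a x = \sum_q \sum_(0 <= m <oo) a (q, m))%E.
Proof.
move=> a0.
have -> : [set: Q * nat] = [set: Q] `*`` (fun=> [set: nat]).
  by rewrite eqEsubset; split => // -[].
rewrite (@eq_esum _ _ _ a (fun x => a (x.1, x.2))); last by move=> -[].
rewrite -(@esum_esum R Q nat setT (fun=> setT) (fun q m => a (q, m)))//.
have fQ : finite_set [set: Q] by exact: finite_finset.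
rewrite esum_fset//; last by move=> q _; apply: esum_ge0.
rewrite (@fsbigE _ _ _ _ _ (enum Q)) ?enum_uniq//; last by move=> q _; rewrite mem_enum.
rewrite big_enum_cond/=; apply: eq_big => q; first exact: mem_set.
by move=> _; rewrite nneseries_esumT.
Qed.

Lemma telescope_sum (X : R) : 0 <= X ->
  (\sum_(0 <= m <oo) (X / (m.+1%:R * m.+2%:R))%:E <= X%:E)%E.
Proof.
move=> X0; apply: lime_le.
  by apply: is_cvg_nneseries => n _ _; rewrite lee_fin divr_ge0// mulr_ge0.
apply: nearW => n; rewrite big_mkord sumEFin lee_fin.
have -> : \sum_(i < n) X / (i.+1%:R * i.+2%:R) = X * (1 - (n.+1%:R)^-1).
  elim: n => [|n IH]; first by rewrite big_ord0 invr1 subrr mulr0.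
  rewrite big_ord_recr/= IH -mulrDr; congr (X * _).
  have := ltr0Sn R n; have := ltr0Sn R n.+1; rewrite -[n.+2%:R]natr1 -[n.+1%:R]natr1 => h1 h2.
  by field; rewrite !gt_eqF.
by rewrite ler_piMr// lerBlDr lerDl invr_ge0.
Qed.

(** The telescoping weight sums to at most 1 over [m], so each of the finitely many cells
    contributes at most [X], whichever indices [A] retains. *)
Lemma esum_cells_le (Q : finType) (A : set (Q * nat)) (b : Q * nat -> \bar R) (X : R) : 0 <= X ->
  (forall x, A x -> (b x <= (X / (x.2.+1%:R * x.2.+2%:R))%:E)%E) ->
  (\esum_(x in A) b x <= (#|Q|%:R * X)%:E)%E.
Proof.
move=> X0 grid_radius.
pose c (x : Q * nat) : \bar R := (X / (x.2.+1%:R * x.2.+2%:R))%:E.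
have c0 x : (0 <= c x)%E by rewrite lee_fin divr_ge0// mulr_ge0.
apply: (@le_trans _ _ (\esum_(x in setT) c x)).
  apply: (le_trans (le_esum grid_radius)); rewrite [leLHS]esum_mkcond; apply: le_esum => x _.
  by case: ifP.
rewrite esum_finprod//.
apply: (@le_trans _ _ (\sum_(q : Q) X%:E)%E); last by rewrite sumEFin lee_fin sumr_const mulr_natl.
by apply: lee_sum => q _; exact: telescope_sum.
Qed.

(** The index is quadratic in the size of the frequency, so the summable weight costs a fourth power
    of that size; hence the exponent 4 in [poly_const]. *)
Lemma succ2_le_isqrt m : m.+1%:R * m.+2%:R <= 2 * (1 + (isqrt m)%:R) ^+ 4 :> R.
Proof.
have /andP[_ h] := isqrtP m.
have h' : m.+1%:R <= (1 + (isqrt m)%:R) ^+ 2 :> R.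
  by rewrite addrC natr1 -natrX ler_nat -mulnn.
have h2 : m.+2%:R <= 2 * m.+1%:R :> R.
  rewrite -[m.+2%:R]natr1; have : 1 <= m.+1%:R :> R by rewrite ler1n.
  lra.
have h1 : 0 <= m.+1%:R :> R by [].
have -> : 2 * (1 + (isqrt m)%:R) ^+ 4 = 2 * ((1 + (isqrt m)%:R) ^+ 2 * (1 + (isqrt m)%:R) ^+ 2) :> R by ring.
nra.
Qed.

End Sums.

Section Decay.
Variables (R : realType) (s : R).
Hypothesis s1 : 1 < s.

Lemma decay_le (X y : R) : 0 <= X -> X `^ s <= width_const s / 4 * y -> decay s y <= 4 * 2 `^ (- X).
Proof.
move=> X0 h; rewrite /decay ler_pM2l//; apply: ler_powR; first by lra.
rewrite lerN2.
have s0 : s != 0 by apply/eqP => s0; have s1' := s1; lra.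
have e : X = (X `^ s) `^ s^-1 by rewrite -powRrM mulfV// powRr1.
rewrite [leLHS]e; apply: ge0_ler_powR => //; rewrite ?nnegrE ?powR_ge0//.
  by rewrite invr_ge0; have s1' := s1; lra.
by apply: le_trans h; exact: powR_ge0.
Qed.

End Decay.

(** * Energies *)

Section Energy.
Variables (R : realType) (s l t X M : R) (c : R * R).
Hypotheses (s1 : 1 < s) (l1 : 1 <= l) (t0 : 0 <= t) (X0 : 0 <= X) (M0 : 0 <= M).
Hypothesis Xt : X `^ s <= width_const s / 6 * (l * t).

Let l0 : 0 < l. Proof. exact: lt_le_trans ltr01 l1. Qed.

Definition freq_pt (m : nat) : R * R := (pi / l * (int_pair m).1%:~R, pi / l * (int_pair m).2%:~R).

Notation dl := (4 * 2 `^ (- X)).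
Notation G m xi := (window_gain s l c.1 (pi / l * (int_pair m).1%:~R - xi.1) * window_gain s l c.2 (pi / l * (int_pair m).2%:~R - xi.2)).

Let G01 m xi : 0 <= G m xi <= 1.
Proof.
have /andP[a1 a2] := window_gain01 s1 l0 c.1 (pi / l * (int_pair m).1%:~R - xi.1).
have /andP[b1 b2] := window_gain01 s1 l0 c.2 (pi / l * (int_pair m).2%:~R - xi.2).
by rewrite mulr_ge0// mulr_ile1.
Qed.

(** A Euclidean distance above [t] forces one coordinate above [2 t / 3], and the gain in the other
    is at most 1. The factor 2/3 turns the 4 of [decay] into the 6 of the hypothesis [Xt]. *)
Let G_small m (xi : R * R) : t < enorm2 (freq_pt m - xi) -> G m xi <= dl.
Proof.
move=> te; set e1 := (_ - xi.1); set e2 := (_ - xi.2).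
have /andP[a1 a2] := window_gain01 s1 l0 c.1 e1; have /andP[b1 b2] := window_gain01 s1 l0 c.2 e2.
have small (e : R) : t < 3 / 2 * `|e| -> decay s (l * `|e|) <= dl.
  move=> h; apply: decay_le => //; apply: le_trans Xt _.
  have : 0 < width_const s by exact: width_const_gt0.
  have := ltr_pM2l l0 t (3 / 2 * `|e|); rewrite h; nra.
have [h|h] := ltP t (3 / 2 * `|e1|).
  apply: le_trans _ (small _ h); apply: le_trans _ (window_gain_decay s1 l0 c.1 e1).
  by rewrite ler_piMr.
have [h'|h'] := ltP t (3 / 2 * `|e2|).
  apply: le_trans _ (small _ h'); apply: le_trans _ (window_gain_decay s1 l0 c.2 e2).
  by rewrite ler_piMl.
have : enorm2 (freq_pt m - xi) <= 3 / 2 * (2 / 3 * t).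
  by apply: enorm2_box; rewrite /freq_pt /= -/e1 -/e2; lra.
lra.
Qed.

Let Gsq_small m (xi : R * R) : t < enorm2 (freq_pt m - xi) ->
  nsq (fourier2 (wave_packet s l c m) xi) <= 16 * l ^+ 2 * dl * G m xi.
Proof.
move=> te; apply: le_trans (wave_packet_fourier c s1 l0 m xi) _.
rewrite -[leRHS]mulrA; apply: ler_wpM2l; first by rewrite mulr_ge0// exprn_ge0// ltW.
have /andP[h1 h2] := G01 m xi.
by rewrite expr2; apply: ler_wpM2r => //; exact: G_small.
Qed.

Let freq_le (n : int) (b : R) : `|pi / l * n%:~R| <= b -> `|n|%N%:R <= l * b.
Proof.
move=> h; rewrite natr_absz intr_norm; move: h.
have p2 := pi_ge2 R; have n0 := normr_ge0 (n%:~R : R).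
rewrite normrM gtr0_norm; last by rewrite divr_gt0// pi_gt0.
rewrite mulrAC ler_pdivrMr// [l * b]mulrC => h.
by apply: le_trans h; nra.
Qed.

Let count_le m (b : R) : `|(int_pair m).1|%N%:R <= b -> `|(int_pair m).2|%N%:R <= b ->
  m.+1%:R * m.+2%:R <= 32 * (1 + b) ^+ 4.
Proof.
move=> h1 h2; apply: le_trans (succ2_le_isqrt R m) _.
have grid_radius : (isqrt m)%:R <= 2 * b.
  apply: (@le_trans _ _ ((maxn `|(int_pair m).1|%N `|(int_pair m).2|%N).*2%:R)); first by rewrite ler_nat isqrt_int_pair.
  rewrite -mul2n natrM ler_pM2l//; rewrite /maxn; by case: ifP.
have b0 : 0 <= b by apply: le_trans h1.
have i0 : 0 <= (isqrt m)%:R :> R by [].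
have : (1 + (isqrt m)%:R) ^+ 4 <= (2 * (1 + b)) ^+ 4.
  by apply: lerXn2r; rewrite ?nnegrE; lra.
rewrite exprMn; lra.
Qed.

(* One spare power of the gain pays for the summation over the frequencies. *)
Let G_count m (xi : R * R) : `|xi.1| <= M -> `|xi.2| <= M ->
  G m xi <= 32 * (1 + l * M) ^+ 4 * poly_const s / (m.+1%:R * m.+2%:R).
Proof.
move=> x1 x2; set e1 := (_ - xi.1); set e2 := (_ - xi.2).
have /andP[a1 a2] := window_gain01 s1 l0 c.1 e1; have /andP[b1 b2] := window_gain01 s1 l0 c.2 e2.
rewrite ler_pdivlMr ?mulr_gt0//.
have lM : 0 <= l * M by rewrite mulr_ge0// ltW.
have aux (g e : R) : 0 <= g -> g * (1 + l * `|e|) ^+ 4 <= poly_const s -> G m xi <= g ->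
    `|(int_pair m).1|%N%:R <= l * M + l * `|e| -> `|(int_pair m).2|%N%:R <= l * M + l * `|e| ->
    G m xi * (m.+1%:R * m.+2%:R) <= 32 * (1 + l * M) ^+ 4 * poly_const s.
  move=> g0 hg Gg n1 n2; have hc := count_le n1 n2.
  have le0 : 0 <= l * `|e| by rewrite mulr_ge0// ltW.
  have h4 : (1 + (l * M + l * `|e|)) ^+ 4 <= (1 + l * M) ^+ 4 * (1 + l * `|e|) ^+ 4.
    by rewrite -exprMn; apply: lerXn2r; rewrite ?nnegrE; nra.
  have P0 : 0 <= (1 + l * M) ^+ 4 by apply: exprn_ge0; lra.
  apply: (@le_trans _ _ (g * (32 * ((1 + l * M) ^+ 4 * (1 + l * `|e|) ^+ 4)))).
    have /andP[G0 _] := G01 m xi.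
    apply: ler_pM => //; apply: le_trans hc _; by rewrite ler_pM2l.
  have -> : g * (32 * ((1 + l * M) ^+ 4 * (1 + l * `|e|) ^+ 4)) =
      32 * (1 + l * M) ^+ 4 * (g * (1 + l * `|e|) ^+ 4) by ring.
  by apply: ler_wpM2l => //; rewrite mulr_ge0.
have fr (n : int) (y e : R) : `|y| <= M -> `|pi / l * n%:~R - y| <= `|e| -> `|n|%N%:R <= l * M + l * `|e|.
  move=> yM h; rewrite -mulrDr; apply: freq_le.
  have := ler_normD (pi / l * n%:~R - y) y; rewrite subrK; lra.
(* The larger offset controls both integer frequencies, so the polynomial decay of its gain alone
   pays for the weight. *)
have [e12|e21] := leP `|e1| `|e2|.
  apply: (aux (window_gain s l c.2 e2) e2) => //; [exact: window_gain_poly|by rewrite ler_piMl|exact: fr x1 _|].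
  by apply: (fr _ _ _ x2); rewrite -/e2.
apply: (aux (window_gain s l c.1 e1) e1) => //; [exact: window_gain_poly|by rewrite ler_piMr| |].
  by apply: (fr _ _ _ x1); rewrite -/e1.
by apply: (fr _ _ _ x2); rewrite -/e2 ltW.
Qed.

Lemma energy_far_in m (xi : R * R) : `|xi.1| <= M -> `|xi.2| <= M -> t < enorm2 (freq_pt m - xi) ->
  nsq (fourier2 (wave_packet s l c m) xi) <=
    16 * l ^+ 2 * dl * (32 * (1 + l * M) ^+ 4 * poly_const s / (m.+1%:R * m.+2%:R)).
Proof.
move=> x1 x2 te; apply: le_trans (Gsq_small te) _; apply: ler_wpM2l; last exact: G_count.
by rewrite mulr_ge0 ?mulr_ge0 ?powR_ge0 ?exprn_ge0// ltW.
Qed.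

(** Here the packet's own frequency is bounded by [M], so the index [m] is bounded and the summable
    weight costs a constant ([cnt]). The spare gain pays instead for integrability over the
    unbounded set of [xi]. *)
Lemma energy_far_out m (xi : R * R) : `|(freq_pt m).1| <= M -> `|(freq_pt m).2| <= M -> t < enorm2 (freq_pt m - xi) ->
  nsq (fourier2 (wave_packet s l c m) xi) <=
    16 * l ^+ 2 * dl * (32 * (1 + l * M) ^+ 4 * (poly_const s * (2 * (1 + M ^+ 2))) ^+ 2 / (m.+1%:R * m.+2%:R)) *
    ((oneDsqr xi.1)^-1 * (oneDsqr xi.2)^-1).
Proof.
move=> p1 p2 te; apply: le_trans (Gsq_small te) _; rewrite -[leRHS]mulrA; apply: ler_wpM2l.
  by rewrite mulr_ge0 ?mulr_ge0 ?powR_ge0 ?exprn_ge0// ltW.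
have b0 : 1 <= poly_const s by exact: poly_const_ge1.
have one (x0 p y : R) : `|p| <= M -> window_gain s l x0 (p - y) <= poly_const s * (2 * (1 + M ^+ 2)) * (oneDsqr y)^-1.
  move=> pM; rewrite ler_pdivlMr; last by rewrite /oneDsqr; have := sqr_ge0 y; lra.
  have /andP[g0 _] := window_gain01 s1 l0 x0 (p - y).
  apply: (@le_trans _ _ (window_gain s l x0 (p - y) * ((1 + l * `|p - y|) ^+ 4 * (2 * (1 + M ^+ 2))))); last first.
    rewrite mulrA ler_wpM2r//; last exact: window_gain_poly.
    by have := sqr_ge0 M; lra.
  apply: ler_wpM2l => //.
  have pp : p ^+ 2 <= M ^+ 2 by rewrite -(real_normK (num_real p)) lerXn2r ?nnegrE.
  (* Peetre's inequality, with [|p| <= M]. *)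
  have h1 : oneDsqr y <= 2 * (1 + M ^+ 2) * (1 + `|p - y| ^+ 2).
    rewrite /oneDsqr (real_normK (num_real _)).
    have := sqr_ge0 (p + (p - y)); have := sqr_ge0 (p - y); have := sqr_ge0 M; nra.
  apply: le_trans h1 _; rewrite [leLHS]mulrC ler_wpM2r//; first by have := sqr_ge0 M; lra.
  have n0 := normr_ge0 (p - y).
  have n1 : `|p - y| <= l * `|p - y| by rewrite ler_peMl.
  apply: (@le_trans _ _ ((1 + l * `|p - y|) ^+ 2)); first nra.
  by apply: ler_weXn2l => //; lra.
have cnt : 1 <= 32 * (1 + l * M) ^+ 4 / (m.+1%:R * m.+2%:R).
  by rewrite ler_pdivlMr ?mulr_gt0// mul1r; apply: count_le; exact: freq_le.
have /andP[g0 _] := window_gain01 s1 l0 c.1 (pi / l * (int_pair m).1%:~R - xi.1).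
have /andP[g0' _] := window_gain01 s1 l0 c.2 (pi / l * (int_pair m).2%:~R - xi.2).
have o1 := one c.1 _ xi.1 p1; have o2 := one c.2 _ xi.2 p2.
have := ler_pM g0 g0' o1 o2.
set Z := poly_const s * (2 * (1 + M ^+ 2)); set u := (oneDsqr xi.1)^-1; set v := (oneDsqr xi.2)^-1 => h.
have -> : 32 * (1 + l * M) ^+ 4 * Z ^+ 2 / (m.+1%:R * m.+2%:R) * (u * v) =
  (32 * (1 + l * M) ^+ 4 / (m.+1%:R * m.+2%:R)) * (Z * u * (Z * v)) by ring.
apply: le_trans h _; rewrite ler_peMl//.
by rewrite (le_trans _ (ler_pM g0 g0' o1 o2))// mulr_ge0.
Qed.

End Energy.

(** * Energy of one frame element on the wrong side of the domain *)

Section CellEnergy.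
Variable R : realType.
Notation T := (R * R)%type.
Notation mu := (@leb2 R).
Notation lm := (@lebesgue_measure R).

Lemma L2sqnorm_box (S : set T) (M B : R) (F : T -> R[i]) : 0 <= M -> 0 <= B ->
  (forall x, S x -> `|x.1| <= M /\ `|x.2| <= M) -> (forall x, S x -> nsq (F x) <= B) ->
  (L2sqnorm S F <= (B * (2 * M) ^+ 2)%:E)%E.
Proof.
move=> M0 B0 SM FB; pose E : set T := `[- M, M]%classic `*` `[- M, M]%classic.
have mE : measurable E by apply: measurableX; exact: measurable_itv.
apply: (@le_trans _ _ (\int[mu]_x (B%:E * (\1_E x)%:E))%E).
  apply: ge0_le_integral_sub => x; last by rewrite -EFinM lee_fin mulr_ge0.
  move=> Sx; rewrite lee_fin sqr_ge0 nsqE -EFinM lee_fin indicE mem_set ?mulr1; first exact: FB.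
  by have [h1 h2] := SM _ Sx; split; rewrite /= in_itv/= -ler_norml.
rewrite ge0_integralZl ?lee_fin//; last exact/measurable_EFinP/measurable_indic.
have muE : (mu E <= ((2 * M) ^+ 2)%:E)%E.
  by rewrite /E leb2_box ?lee_fin; [have -> : M - - M = 2 * M by ring|lra|lra].
by rewrite integral_indic// setIT EFinM lee_wpmul2l ?lee_fin.
Qed.

Let oneD_ge1 (y : R) : 1 <= oneDsqr y. Proof. by rewrite /oneDsqr lerDl sqr_ge0. Qed.

(** [H] is the integral over the plane of the product of the two weights, finite by Fubini and the
    arctangent integral. *)
Lemma L2sqnorm_weight2 : exists2 H : R, 0 <= H &
  forall (D : set T) (B : R) (F : T -> R[i]), 0 <= B ->
    (forall x, D x -> nsq (F x) <= B * ((oneDsqr x.1)^-1 * (oneDsqr x.2)^-1)) ->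
    (L2sqnorm D F <= (B * H)%:E)%E.
Proof.
pose h (y : R) := (oneDsqr y)^-1.
have h0 y : 0 <= h y by rewrite invr_ge0; have := oneD_ge1 y; lra.
have ch : continuous h.
  move=> y; apply: cvgV; first by have := oneD_ge1 y; rewrite gt_eqF//; lra.
  by apply: continuous_oneDsqr.
have mh : measurable_fun setT h by exact: continuous_measurable_fun.
have ih : lm.-integrable setT (EFin \o h).
  apply/integrableP; split; first exact/measurable_EFinP.
  under eq_integral do rewrite /= ger0_norm//.
  rewrite ge0_symfun_integralT//; last by move=> y; rewrite /= /h /oneDsqr sqrrN.
  have -> : [set x : R | 0 <= x] = `[0, +oo[%classic by rewrite set_itvcy.
  by rewrite integral0y_oneDsqr -EFinM ltry.
have I2 := tensor_integrable ih ih.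
exists (fine (\int[mu]_z (h z.1 * h z.2)%:E)%E).
  by apply: fine_ge0; apply: integral_ge0 => z _; rewrite lee_fin mulr_ge0.
move=> D B F B0 FB.
apply: (@le_trans _ _ (\int[mu]_z (B%:E * (h z.1 * h z.2)%:E))%E).
  apply: ge0_le_integral_sub => x; last by rewrite -EFinM lee_fin !mulr_ge0.
  by move=> Dx; rewrite lee_fin sqr_ge0 nsqE -EFinM lee_fin FB.
rewrite ge0_integralZl ?lee_fin//; last 2 first.
  by apply/measurable_EFinP; apply: measurable_funM; exact: measurableT_comp.
  by move=> x _; rewrite lee_fin mulr_ge0.
rewrite EFinM fineK//; exact: integrable_fin_num.
Qed.

(** With [i = isqrt m], [256^i = 16^i * 16^i]: one factor dominates [(1 + i)^4], hence the summable
    weight, and the other dominates [2^X]. *)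
Lemma inv256_le m (X : R) : X <= (isqrt m)%:R ->
  (256 ^+ isqrt m)^-1 <= 2 * 2 `^ (- X) / (m.+1%:R * m.+2%:R).
Proof.
set i := isqrt m => Xi.
rewrite ler_pdivlMr ?mulr_gt0// mulrC ler_pdivrMr ?exprn_gt0 ?ltr0n//.
apply: le_trans (succ2_le_isqrt R m) _; rewrite -/i -mulrA ler_pM2l//.
have h1 : (1 + i%:R) ^+ 4 <= 16 ^+ i :> R.
  have -> : 16 ^+ i = (2 ^+ i) ^+ 4 :> R by rewrite -exprM mulnC exprM (_ : 2 ^+ 4 = 16 :> R)// -natrX.
  apply: lerXn2r; rewrite ?nnegrE ?exprn_ge0// ?addr_ge0//.
  by rewrite addrC natr1 -natrX ler_nat ltn_expl.
have h2 : 1 <= 2 `^ (- X) * 16 ^+ i :> R.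
  apply: (@le_trans _ _ (2 `^ (- i%:R) * 2 ^+ i)); first by rewrite powRN powR_mulrn// mulVf// gt_eqF// exprn_gt0.
  apply: ler_pM; rewrite ?powR_ge0 ?exprn_ge0//.
    by apply: ler_powR; [lra|rewrite lerN2].
  by apply: lerXn2r; rewrite ?nnegrE//; lra.
have -> : 256 ^+ i = 16 ^+ i * 16 ^+ i :> R.
  by rewrite -exprMn (_ : 16 * 16 = 256 :> R)//; lra.
apply: le_trans h1 _; rewrite mulrA ler_peMl// exprn_ge0//.
Qed.

(** Both kinds of cells are brought to one bound, with [C0] chosen before scale, tube width, centre
    and index. The power [rho ^ 6] comes from [l ^ 2 * (1 + l * M) ^ 4] with [l <= rho]. For a
    packet the wrong side depends on where its frequency lies; a polynomial of high index is small
    on [S] in every case. *)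
Lemma cell_energy (S : set T) (s : R) : well_shaped S -> 1 < s ->
  exists2 C0 : R, 0 < C0 & forall X rho : R, 0 <= X -> 1 <= rho ->
    (forall (l t : R) (c : T) m, 1 <= l <= rho -> 0 <= t -> X `^ s <= width_const s / 6 * (l * t) ->
      ~ (dist2 (freq_pt l m) (boundary S) <= t%:E)%E ->
      (L2sqnorm (if freq_pt l m \in S then ~` S else S) (fourier2 (wave_packet s l c m)) <=
        (C0 * rho ^+ 6 * 2 `^ (- X) / (m.+1%:R * m.+2%:R))%:E)%E) /\
    (forall (E : set T) (c : T) m, measurable E -> (forall x, E x -> `|x.1 - c.1| <= 1/2 /\ `|x.2 - c.2| <= 1/2) ->
      X <= (isqrt m)%:R ->
      (L2sqnorm S (fourier2 (poly_sys E c m)) <= (C0 * rho ^+ 6 * 2 `^ (- X) / (m.+1%:R * m.+2%:R))%:E)%E).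
Proof.
move=> wS s1; have [[bS oS _] _ _] := wS.
have [M M0 SM] := bounded_coord bS; have [Ct Ct0 hC] := cis2_taylor M.
have [H H0 hH] := L2sqnorm_weight2.
have b1 : 1 <= poly_const s by exact: poly_const_ge1.
have [K K0 KE] : exists2 K : R, 0 < K & K = 16 * 4 * 32 by exists (16 * 4 * 32) => //; lra.
pose A1 := K * (1 + M) ^+ 4 * (poly_const s * (2 * M) ^+ 2).
pose A2 := K * (1 + M) ^+ 4 * ((poly_const s * (2 * (1 + M ^+ 2))) ^+ 2 * H).
pose A3 := 2 * Ct * (2 * M) ^+ 2.
have M1 : 0 < (1 + M) ^+ 4 by rewrite exprn_gt0//; lra.
have bC0 : 0 < poly_const s by lra.
have M2 : 0 < (2 * M) ^+ 2 by rewrite exprn_gt0//; lra.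
have A10 : 0 < A1 by rewrite /A1; repeat (apply: mulr_gt0 => //).
have A20 : 0 <= A2.
  rewrite /A2; apply: mulr_ge0; first by rewrite mulr_ge0// ltW.
  by rewrite mulr_ge0// sqr_ge0.
have A30 : 0 < A3 by rewrite /A3; repeat (apply: mulr_gt0 => //).
have fA1 : A1 <= A1 + A2 + A3 by rewrite -addrA lerDl addr_ge0// ltW.
have fA2 : A2 <= A1 + A2 + A3 by rewrite [A1 + _]addrC -addrA lerDl addr_ge0// ltW.
have fA3 : A3 <= A1 + A2 + A3 by rewrite lerDr addr_ge0// ltW.
exists (A1 + A2 + A3); first exact: lt_le_trans A30 fA3.
move=> X rho X0 rho1; set E0 := 2 `^ (- X); have E00 : 0 <= E0 by exact: powR_ge0.
have rho6 : 1 <= rho ^+ 6 by rewrite exprn_ege1.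
have fin (A : R) m : A <= A1 + A2 + A3 ->
    A * rho ^+ 6 * E0 / (m.+1%:R * m.+2%:R) <= (A1 + A2 + A3) * rho ^+ 6 * E0 / (m.+1%:R * m.+2%:R).
  move=> h; rewrite ler_wpM2r ?invr_ge0 ?mulr_ge0// ler_wpM2r// ler_wpM2r//; lra.
split; last first.
  move=> E c m mE Ec Xm.
  have := L2sqnorm_box (F := fourier2 (poly_sys E c m)) (B := Ct / 256 ^+ isqrt m) (ltW M0) _ SM.
  move=> /(_ _ _)/le_trans; apply.
  - by rewrite divr_ge0 ?exprn_ge0 ?ler0n ?(ltW Ct0).
  - by move=> x /SM[h1 h2]; apply: (poly_fourier mE Ec m Ct0 hC).
  rewrite lee_fin; apply: le_trans _ (fin A3 m fA3).
  rewrite mulrAC; set w := (_ * m.+2%:R)^-1.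
  have w0 : 0 <= w by rewrite invr_ge0 mulr_ge0.
  apply: (@le_trans _ _ (Ct * (2 * M) ^+ 2 * (2 * E0 * w))).
    by apply: ler_wpM2l; [rewrite mulr_ge0 ?sqr_ge0// ltW|exact: inv256_le].
  have -> : Ct * (2 * M) ^+ 2 * (2 * E0 * w) = A3 * (E0 * w) by rewrite /A3; ring.
  have -> : A3 * rho ^+ 6 * E0 * w = A3 * (rho ^+ 6 * (E0 * w)) by rewrite !mulrA.
  by apply: ler_wpM2l; [exact: ltW|rewrite ler_peMl// mulr_ge0].
move=> l t c m /andP[l1 lrho] t0 Xt far.
have l0 : 0 < l by exact: lt_le_trans ltr01 l1.
have lM : l ^+ 2 * (1 + l * M) ^+ 4 <= rho ^+ 6 * (1 + M) ^+ 4.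
  have -> : rho ^+ 6 * (1 + M) ^+ 4 = rho ^+ 2 * (rho * (1 + M)) ^+ 4 by ring.
  have q1 : 0 <= 1 + l * M by rewrite addr_ge0// mulr_ge0// ltW.
  have q2 : 1 + l * M <= rho * (1 + M).
    by have := ler_wpM2r (ltW M0) lrho; rewrite mulrDr mulr1; lra.
  apply: ler_pM; [by rewrite sqr_ge0|by rewrite exprn_ge0| |].
    by rewrite lerXn2r ?nnegrE//; lra.
  by rewrite lerXn2r ?nnegrE//; lra.
have scale (Z : R) : 0 <= Z -> 16 * l ^+ 2 * (4 * E0) * (32 * (1 + l * M) ^+ 4 * Z / (m.+1%:R * m.+2%:R)) <=
    K * (1 + M) ^+ 4 * Z * rho ^+ 6 * E0 / (m.+1%:R * m.+2%:R).
  move=> Z0; set w := (_ * m.+2%:R)^-1; have w0 : 0 <= w by rewrite invr_ge0 mulr_ge0.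
  have -> : 16 * l ^+ 2 * (4 * E0) * (32 * (1 + l * M) ^+ 4 * Z * w) =
     (l ^+ 2 * (1 + l * M) ^+ 4) * (K * Z * E0 * w) by rewrite KE; ring.
  have -> : K * (1 + M) ^+ 4 * Z * rho ^+ 6 * E0 * w =
     (rho ^+ 6 * (1 + M) ^+ 4) * (K * Z * E0 * w) by ring.
  have Kp : 0 <= K by exact: ltW.
  apply: ler_wpM2r => //; by repeat (apply: mulr_ge0 => //).
have pos (Z : R) : 0 <= Z -> 0 <= 16 * l ^+ 2 * (4 * E0) * (32 * (1 + l * M) ^+ 4 * Z / (m.+1%:R * m.+2%:R)).
  move=> Z0; have q4 : 0 <= (1 + l * M) ^+ 4 by rewrite exprn_ge0// addr_ge0// mulr_ge0// ltW.
  have w0 : 0 <= (m.+1%:R * m.+2%:R)^-1 :> R by rewrite invr_ge0 mulr_ge0.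
  have l2 : 0 <= l ^+ 2 by exact: sqr_ge0.
  by repeat (apply: mulr_ge0 => //).
case: ifPn => [pS|pS].
  have [p1 p2] := SM _ (set_mem pS).
  pose Z := (poly_const s * (2 * (1 + M ^+ 2))) ^+ 2; have Z0 : 0 <= Z by exact: sqr_ge0.
  have := hH (~` S) _ (fourier2 (wave_packet s l c m)) (pos _ Z0).
  move=> /(_ _)/le_trans; apply.
    move=> xi nxi.
    have pq : (freq_pt l m \in S) != (xi \in S) by rewrite pS; apply/eqP => /esym/set_mem; exact: nxi.
    apply: (@energy_far_out R s l t X M c) => //; first exact: ltW.
    exact: (dist2_crossing oS pq far).
  rewrite lee_fin; apply: le_trans _ (fin A2 m fA2).
  apply: le_trans (ler_wpM2r H0 (scale _ Z0)) _.
  by rewrite le_eqVlt; apply/orP; left; apply/eqP; rewrite /A2 -/Z; ring.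
pose Z := poly_const s; have Z0 : 0 <= Z by rewrite /Z; lra.
have := L2sqnorm_box (F := fourier2 (wave_packet s l c m)) (ltW M0) (pos _ Z0) SM.
move=> /(_ _)/le_trans; apply.
  move=> xi Sxi; have [h1 h2] := SM _ Sxi.
  have pq : (freq_pt l m \in S) != (xi \in S) by rewrite (negbTE pS) mem_set.
  apply: (@energy_far_in R s l t X M c) => //; first exact: ltW.
  exact: (dist2_crossing oS pq far).
rewrite lee_fin; apply: le_trans _ (fin A1 m fA1).
have M20 : 0 <= (2 * M) ^+ 2 by exact: sqr_ge0.
apply: le_trans (ler_wpM2r M20 (scale _ Z0)) _.
by rewrite le_eqVlt; apply/orP; left; apply/eqP; rewrite /A1 -/Z; ring.
Qed.

End CellEnergy.

(** * The frame elements and the number of cells *)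

Section System.
Variables (R : realType) (j : nat) (s : R).
Notation T := (R * R)%type.
Notation rad := (2 ^+ j : R).

Definition psi_cell (q : cell j) (m : nat) : T -> R[i] :=
  match q with
  | inl c => if boundary_sel R c then poly_sys (boundary_cell c) (lattice_pt R c) m else fun=> 0
  | inr (k, c) => if interior_sel R k c then wave_packet s (2 ^+ k) (interior_ctr R k c) m else fun=> 0
  end.

Lemma disk_measurable (r : R) : measurable (disk r).
Proof.
have [r0|r0] := leP r 0.
  rewrite (_ : disk r = set0); first exact: measurable0.
  by rewrite -subset0 => x; rewrite /disk /= => h; have := enorm2_ge0 x; lra.
have -> : disk r = setT `&` (fun x : T => x.1 ^+ 2 + x.2 ^+ 2) @^-1` `]-oo, r ^+ 2[%classic.
  rewrite setTI; apply/seteqP; split => x; rewrite /disk /= in_itv/= -enorm2_sqr => h.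
    by rewrite ltr_pXn2r ?nnegrE ?enorm2_ge0// ltW.
  by move: h; rewrite ltr_pXn2r ?nnegrE ?enorm2_ge0// ltW.
have mf : measurable_fun setT (fun x : T => x.1 ^+ 2 + x.2 ^+ 2).
  by apply: measurable_funD; apply: measurable_funX; [exact: measurable_fst|exact: measurable_snd].
by apply: mf => //; exact: measurable_itv.
Qed.

Lemma boundary_cell_measurable c : measurable (@boundary_cell R j c).
Proof.
have -> : @boundary_cell R j c = disk rad `&` (`[(lattice_pt R c).1 - 1/2, (lattice_pt R c).1 + 1/2]%classic `*`
    `[(lattice_pt R c).2 - 1/2, (lattice_pt R c).2 + 1/2]%classic).
  by apply/seteqP; split => x; rewrite /boundary_cell /= !in_itv/= !ler_norml => -[d h]; split => //;
    [case: h => h1 h2|case: h => h1 h2]; split; lra.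
by apply: measurableI; [exact: disk_measurable|apply: measurableX; exact: measurable_itv].
Qed.

Lemma boundary_cell_near c x : @boundary_cell R j c x -> `|x.1 - (lattice_pt R c).1| <= 1/2 /\ `|x.2 - (lattice_pt R c).2| <= 1/2.
Proof. by case. Qed.

(** A crude count, at most [(1 + j)] grids of [(4 * 2^j)^2] points with [j < 2^j]; it enters only
    the energy, where a power of [eps / R] absorbs it. *)
Lemma card_cell : (1 <= j)%N -> #|cell j|%:R <= 32 * rad ^+ 3.
Proof.
move=> j1; rewrite card_sum !card_prod !card_ord -natrX -natrX -natrM ler_nat.
have : (j < 2 ^ j)%N by exact: ltn_expl.
have : (2 <= 2 ^ j)%N by rewrite -{1}(expn1 2) leq_exp2l.
rewrite /grid_radius; set r := (2 ^ j)%N => r2 jr.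
have nN : (r.+1.*2.+1 <= 4 * r)%N by lia.
have NN := leq_mul nN nN.
apply: (@leq_trans ((1 + j) * (4 * r * (4 * r)))%N).
  by rewrite mulnDl mul1n leq_add// leq_mul2l NN orbT.
have jr2 : (1 + j <= 2 * r)%N by lia.
apply: (leq_trans (leq_mul jr2 (leqnn _))); rewrite (_ : r ^ 3 = r * r * r)%N; last by rewrite !expnS expn0 muln1 mulnA.
lia.
Qed.

Lemma card_boundary_sel : #|finset (@boundary_sel R j)|%:R <= 1496 * rad.
Proof.
have r1 : 1 <= rad by rewrite exprn_ege1//; lra.
apply: le_trans (card_annulus (grid_radius j) r1); rewrite ler_nat; apply: subset_leq_card.
apply/fintype.subsetP => c; rewrite !inE /boundary_sel => h; apply: lt_trans h _; lra.
Qed.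

Lemma card_interior_sel (k : 'I_j) : #|finset (interior_sel R k)|%:R * 2 ^+ k <= 1496 * rad.
Proof.
have k0 : 0 < 2 ^+ k :> R by rewrite exprn_gt0.
have r1 : 1 <= rad / 2 ^+ k by rewrite ler_pdivlMr// mul1r; apply: ler_weXn2l; [lra|exact: ltnW].
rewrite -ler_pdivlMr// -mulrA; apply: le_trans (card_annulus (grid_radius j) r1); rewrite ler_nat; apply: subset_leq_card.
apply/fintype.subsetP => c; rewrite !inE /interior_sel => /andP[h1 h2]; rewrite ltr_norml; apply/andP; split; lra.
Qed.

End System.

(** * Exceptional frequencies near the boundary of the domain *)

Section Count.
Variable R : realType.

Lemma size_lt_bound (p : nat) (F : seq nat) : uniq F -> (forall m, m \in F -> (m < p)%N) -> (size F <= p)%N.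
Proof.
move=> uF h; rewrite -[leqRHS](size_iota 0); apply: uniq_leq_size => // m /h.
by rewrite mem_iota.
Qed.

(** Since [pi < 4], the condition [6 <= K] lets squares of side [pi / l] fit into the doubled tube.
    Dividing its area [C * (4 t^2 + 2 t)], with [t = K Y / l], by the area of a square leaves terms
    of order [Y^2] and [l Y], both at most [l Y^2] because [l] and [Y] are at least 1. *)
Lemma size_lattice (E : set (R * R)) (l K Y C : R) (F : seq nat) : 1 <= l -> 6 <= K -> 1 <= Y -> 0 < C ->
  (forall t : R, 0 < t -> (leb2 [set x | dist2 x E <= t%:E] <= (C * (t ^+ 2 + t))%:E)%E) ->
  uniq F -> (forall m, m \in F -> (dist2 (freq_pt l m) E <= (K * Y / l)%:E)%E) ->
  (size F)%:R <= C * (4 * K ^+ 2 + 2 * K) * l * Y ^+ 2.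
Proof.
move=> l1 K6 Y1 C0 hC uF hF.
have l0 : 0 < l by exact: lt_le_trans ltr01 l1.
have p2 := pi_ge2 R; have p4 := pihalf_lt2 R.
have t0 : 0 < K * Y / l by rewrite divr_gt0// mulr_gt0//; lra.
have t2 : 0 < 2 * (K * Y / l) by lra.
have h := @lattice_in_tube R E (pi / l) (K * Y / l) _ (map int_pair F) _ _ (hC _ t2) _ _.
have : (size (map int_pair F))%:R * (pi / l) ^+ 2 <= C * ((2 * (K * Y / l)) ^+ 2 + 2 * (K * Y / l)).
  apply: h.
  - by rewrite divr_gt0// pi_gt0.
  - rewrite mulrA ler_pM2r ?invr_gt0//; nra.
  - by rewrite map_inj_uniq//; exact: can_inj int_pairK.
  - by move=> n /mapP[m mF ->]; exact: hF.
rewrite size_map; set w := l^-1.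
have w0 : 0 < w by rewrite invr_gt0.
have lw : l * w = 1 by rewrite /w mulfV// gt_eqF.
move=> H.
have : (size F)%:R * pi ^+ 2 <= C * (4 * K ^+ 2 * Y ^+ 2 + 2 * K * Y * l).
  have l2 : 0 <= l ^+ 2 by exact: sqr_ge0.
  have := ler_wpM2l l2 H.
  have -> : l ^+ 2 * ((size F)%:R * (pi * w) ^+ 2) = (size F)%:R * pi ^+ 2 * (l * w) ^+ 2 by ring.
  have -> : l ^+ 2 * (C * ((2 * (K * Y * w)) ^+ 2 + 2 * (K * Y * w))) =
    C * (4 * K ^+ 2 * Y ^+ 2 * (l * w) ^+ 2 + 2 * K * Y * l * (l * w)) by ring.
  by rewrite lw expr1n !mulr1.
have s0 : 0 <= (size F)%:R :> R by [].
have : (size F)%:R <= (size F)%:R * pi ^+ 2 :> R by rewrite ler_peMr// exprn_ege1//; lra.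
move=> h1 h2; apply: (le_trans h1); apply: (le_trans h2).
rewrite -!mulrA ler_pM2l//.
have Y2 : Y <= Y ^+ 2 by rewrite expr2 ler_peMl//; lra.
have YY : Y ^+ 2 <= l * Y ^+ 2 by rewrite ler_peMl// sqr_ge0.
have lY : Y * l <= l * Y ^+ 2 by rewrite mulrC ler_pM2l.
have K2 : 0 <= K ^+ 2 by exact: sqr_ge0.
have -> : (4 * (K * K) + 2 * K) * (l * Y ^+ 2) = 4 * (K ^+ 2 * (l * Y ^+ 2)) + 2 * (K * (l * Y ^+ 2)) by ring.
have -> : 4 * (K * (K * Y ^+ 2)) = 4 * (K ^+ 2 * Y ^+ 2) by ring.
apply: lerD.
  by rewrite ler_pM2l// ler_wpM2l.
by rewrite ler_pM2l// ler_wpM2l//; lra.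
Qed.

End Count.

(** * The partition of the index set *)

Section Partition.
Variable R : realType.
Notation T := (R * R)%type.

Lemma log2_scale (j N : nat) (eps : R) : (1 <= j)%N -> 0 < eps < 1 / 2 ->
  let L := log2 (2 ^+ j / eps) in
  [/\ 2 <= L, j%:R <= L & 2 `^ (- (N%:R * L)) = (eps / 2 ^+ j) ^+ N].
Proof.
move=> j1 /andP[e0 e2] L.
have r0 : 0 < 2 ^+ j :> R by rewrite exprn_gt0.
have q0 : 0 < 2 ^+ j / eps by rewrite divr_gt0.
have l2 : 0 < ln 2 :> R by rewrite ln_gt0//; lra.
have LE : L * ln 2 = ln (2 ^+ j / eps) by rewrite /L /log2 divfK// gt_eqF.
have jL : j%:R + 1 <= L.
  rewrite /L /log2 ler_pdivlMr// mulrDl mul1r lnM ?posrE ?invr_gt0//.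
  have -> : ln (2 ^+ j) = j%:R * ln 2 :> R by rewrite lnXn// mulr_natl.
  rewrite lerD2l ler_ln ?posrE ?invr_gt0//.
  by rewrite -(invrK 2) lef_pV2 ?posrE ?invr_gt0//; lra.
have j1' : 1 <= j%:R :> R by rewrite ler1n.
split; [lra|lra|].
have E : 2 `^ L = 2 ^+ j / eps by rewrite /powR gt_eqF// LE lnK.
have -> : eps / 2 ^+ j = (2 ^+ j / eps)^-1 by rewrite invf_div.
by rewrite powRN [N%:R * L]mulrC powRrM E powR_mulrn ?(ltW q0)// exprVn.
Qed.

Lemma sum_if_card (I : finType) (P : pred I) (x : R) :
  \sum_i (if P i then x else 0) = #|finset P|%:R * x.
Proof.
rewrite -big_mkcond/= (eq_bigl (fun i => i \in finset P)); last by move=> i; rewrite inE.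
by rewrite sumr_const mulr_natl.
Qed.

Lemma L2sqnorm_fourier_0 (S : set T) : L2sqnorm S (fourier2 (fun=> 0)) = 0%E.
Proof.
rewrite /L2sqnorm integral0_eq// => xi _.
have -> : fourier2 (fun=> 0) xi = 0.
  rewrite /fourier2 (_ : (fun x => _) = (fun=> 0)) ?mulr0; last by apply/funext => x; rewrite mul0r.
  by rewrite /cintegral /Rintegral/= integral0 mulr0.
by rewrite nsqE /nsq /= expr0n addr0.
Qed.

(** Put [d = eps / rad <= 1/4]. Of the first 11 powers of [d], nine cancel [rad ^ 9] and leave
    [eps ^ 9 <= 1], and two give at most [eps ^ 2]. The remaining [n] powers outweigh [64 * C0],
    because [64 * C0 <= n <= 4^n]. *)
Lemma energy_absorb (C0 rad eps : R) : 0 < C0 -> 2 <= rad -> 0 < eps < 1 / 2 ->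
  64 * rad ^+ 3 * (C0 * rad ^+ 6 * (eps / rad) ^+ (11 + (Num.trunc (64 * C0)).+1)) <= eps ^+ 2.
Proof.
move=> C00 rad2 /andP[e0 e2]; pose d := eps / rad; rewrite -/d.
have r0 : 0 < rad by lra.
have d0 : 0 < d by rewrite divr_gt0.
have d4 : d <= 1 / 4 by rewrite ler_pdivrMr; lra.
have dr : d * rad = eps by rewrite /d divfK// gt_eqF.
set n := (Num.trunc (64 * C0)).+1.
have n0 : C0 * 64 * d ^+ n <= 1.
  have h1 : d ^+ n <= (1/4) ^+ n by rewrite lerXn2r ?nnegrE//; lra.
  have h2 : 64 * C0 <= 4 ^+ n.
    apply: (@le_trans _ _ n%:R); first exact/ltW/truncnS_gt.
    by rewrite -natrX ler_nat ltnW// ltn_expl.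
  have q4 : 0 < 4 ^+ n :> R by rewrite exprn_gt0.
  have e4 : (1 / 4) ^+ n = (4 ^+ n)^-1 :> R by rewrite mul1r exprVn.
  rewrite e4 in h1.
  apply: (@le_trans _ _ (4 ^+ n * (4 ^+ n)^-1)); last by rewrite mulfV// gt_eqF.
  have q5 : 0 <= d ^+ n by rewrite exprn_ge0// ltW.
  have q6 : 0 <= C0 * 64 by rewrite mulr_ge0// ltW.
  have h3 : C0 * 64 <= 4 ^+ n by rewrite mulrC.
  exact: ler_pM.
have -> : 64 * rad ^+ 3 * (C0 * rad ^+ 6 * d ^+ (11 + n)) = (C0 * 64 * d ^+ n) * (d ^+ 2 * (d * rad) ^+ 9).
  by rewrite exprD; ring.
rewrite dr.
have p0 : 0 <= d ^+ 2 * eps ^+ 9 by rewrite mulr_ge0 ?exprn_ge0// ltW.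
apply: (@le_trans _ _ (d ^+ 2 * eps ^+ 9)); first by rewrite ler_piMl.
have de : d <= eps by rewrite ler_pdivrMr//; nra.
have h1 : d ^+ 2 <= eps ^+ 2 by rewrite lerXn2r ?nnegrE// ltW.
have h2 : eps ^+ 9 <= 1 by rewrite exprn_ile1//; lra.
by rewrite -[leRHS]mulr1; apply: ler_pM; rewrite ?sqr_ge0 ?exprn_ge0 ?(ltW e0).
Qed.

(** A packet outside [I3] has its frequency farther than [t k] from the boundary, so it is assigned
    by the side on which that frequency lies: [I2] inside [S], [I1] outside. The constants [N], [K]
    and [D] are fixed before [j] and [eps]. *)
Theorem cell_partition (S : set T) (s : R) : well_shaped S -> 1 < s ->
  exists2 C : R, 0 < C & forall (j : nat) (eps : R), (1 <= j)%N -> 0 < eps < 1 / 2 ->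
  exists I1 I2 I3 : set (cell j * nat)%type,
    [/\ I1 `|` I2 `|` I3 = setT,
        [/\ I1 `&` I2 = set0, I1 `&` I3 = set0 & I2 `&` I3 = set0],
        (\esum_(nu in I1) L2sqnorm S (fourier2 (psi_cell s nu.1 nu.2)) +
         \esum_(nu in I2) L2sqnorm (~` S) (fourier2 (psi_cell s nu.1 nu.2)) <= (eps ^+ 2)%:E)%E,
        finite_set I3 &
        (#|` fset_set I3|)%:R <= C * 2 ^+ j * (log2 (2 ^+ j / eps)) `^ (1 + 2 * s)].
Proof.
move=> wS s1; have [C0 C00 hE] := cell_energy wS s1; have [Ct Ct0 hC] := well_shaped_tube wS.
have [c0 [c00 cb ci]] : exists c0 : R, [/\ 0 < c0,
    forall j, #|finset (@boundary_sel R j)|%:R <= c0 * 2 ^+ j &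
    forall j (k : 'I_j), #|finset (interior_sel R k)|%:R * 2 ^+ k <= c0 * 2 ^+ j].
  by exists 1496; split; [rewrite ltr0n|exact: card_boundary_sel|exact: card_interior_sel].
(* The exponent required by [energy_absorb]. *)
pose N := (11 + (Num.trunc (64 * C0)).+1)%N.
have k0 : 0 < width_const s by exact: width_const_gt0.
(* Solves [X^s = width_const s / 6 * (l * t)] for [X = N * L] and [t = K * L^s / l]. *)
pose K := 6 * N%:R `^ s / width_const s.
have N1 : 1 <= N%:R :> R by rewrite ler1n.
have K6 : 6 <= K.
  rewrite /K ler_pdivlMr//.
  have : 1 <= N%:R `^ s by rewrite -[leLHS](powRr0 (N%:R : R)); apply: ler_powR => //; lra.
  have : width_const s <= 1 by rewrite /width_const ler_pdivrMr; lra.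
  move: (width_const s) k0 (N%:R `^ s) => b b0 p b1 p1; lra.
pose D := Ct * (4 * K ^+ 2 + 2 * K).
have D0 : 0 < D by rewrite mulr_gt0// addr_gt0// mulr_gt0// ?exprn_gt0//; lra.
exists (c0 * ((N%:R + 1) ^+ 2 + D)).
  by rewrite mulr_gt0// addr_gt0// exprn_gt0//; lra.
move=> j eps j1 he; have /andP[e0 e2] := he.
pose L := log2 (2 ^+ j / eps); have [L2 jL powE] := log2_scale N j1 he; rewrite -/L in L2 jL powE.
rewrite -/L; set rad : R := 2 ^+ j.
pose X := N%:R * L; pose Y := L `^ s.
have X0 : 0 <= X by rewrite mulr_ge0//; lra.
have Y1 : 1 <= Y by rewrite -[leLHS](powRr0 L); apply: ler_powR; lra.
have rad1 : 1 <= rad by rewrite exprn_ege1//; lra.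
have [hint hbd] := hE X rad X0 rad1.
(* An index [m >= K0 * K0] has [isqrt m >= K0 >= X], as the energy bound for polynomials asks. *)
pose K0 := (Num.trunc X).+1.
have XK0 : X <= K0%:R by apply/ltW; exact: truncnS_gt.
have K0X : K0%:R <= (N%:R + 1) * L.
  rewrite /K0 -natr1 mulrDl mul1r; apply: lerD; last lra.
  by rewrite truncn_le.
pose t (k : 'I_j) := K * Y / 2 ^+ k.
pose near (k : 'I_j) m := (dist2 (freq_pt (2 ^+ k : R) m) (boundary S) <= (t k)%:E)%E.
pose J3 (q : cell j) : set nat := match q with
  | inl c => [set m | boundary_sel R c /\ (m < K0 * K0)%N]
  | inr (k, c) => [set m | interior_sel R k c /\ near k m] end.
(* Boundary cells contribute nothing here: their polynomials of high index are small on [S] and all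
   go to [I1]. *)
pose J2 (q : cell j) : set nat := match q with
  | inl c => set0
  | inr (k, c) => [set m | [/\ interior_sel R k c, ~ near k m & freq_pt (2 ^+ k : R) m \in S]] end.
pose I2 : set (cell j * nat) := [set nu | J2 nu.1 nu.2].
pose I3 : set (cell j * nat) := [set nu | J3 nu.1 nu.2].
have I23 : I2 `&` I3 = set0.
  rewrite -subset0 => -[[c|[k c]] m] [] //=.
  by rewrite /I2 /I3 /= => -[_ h _] [_].
(* The flag [b] selects the class: [true] is [I2], measured off [S], and [false] is [I1], measured
   on [S]. *)
have En : forall q m b, ~ J3 q m -> (if b then J2 q m else ~ J2 q m) ->
   (L2sqnorm (if b then ~` S else S) (fourier2 (psi_cell s q m)) <=
     (C0 * rad ^+ 6 * 2 `^ (- X) / (m.+1%:R * m.+2%:R))%:E)%E.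
  have Z0 m : (0 <= (C0 * rad ^+ 6 * 2 `^ (- X) / (m.+1%:R * m.+2%:R))%:E)%E.
    rewrite lee_fin; have r6 : 0 <= rad ^+ 6 by rewrite exprn_ge0//; lra.
    apply: divr_ge0; last by rewrite mulr_ge0.
    by rewrite mulr_ge0 ?powR_ge0// mulr_ge0// ltW.
  move=> [c|[k c]] m b /=.
    rewrite /psi_cell; case: (boolP (boundary_sel R c)) => sel; last by rewrite L2sqnorm_fourier_0.
    move=> nJ3; case: b => // _; apply: hbd; first exact: boundary_cell_measurable.
      exact: boundary_cell_near.
    have mK : (K0 * K0 <= m)%N by rewrite leqNgt; apply/negP => h; exact: nJ3.
    apply: le_trans XK0 _; rewrite ler_nat.
    have /andP[_ h] := isqrtP m; rewrite leqNgt; apply/negP => hlt.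
    by have := leq_ltn_trans mK h; rewrite ltnNge leq_mul.
  rewrite /psi_cell; case: (boolP (interior_sel R k c)) => sel; last by rewrite L2sqnorm_fourier_0.
  move=> nJ3 hJ2; have nn : ~ near k m by move=> h; exact: nJ3.
  have k1 : 1 <= 2 ^+ k :> R by rewrite exprn_ege1//; lra.
  have kp : 0 < 2 ^+ k :> R by exact: lt_le_trans ltr01 k1.
  have -> : b = (freq_pt (2 ^+ k : R) m \in S).
    case: b hJ2 => [[_ _ ->]//|hJ2]; apply/esym/negbTE/negP => h; exact: hJ2.
  apply: (hint _ (t k)) => //.
  - by rewrite k1 ler_weXn2l ?(ltnW (ltn_ord k))//; lra.
  - by rewrite /t divr_ge0 ?(ltW kp)// mulr_ge0//; lra.
  - rewrite le_eqVlt; apply/orP; left; apply/eqP.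
    rewrite /X powRM//; last lra.
    rewrite /t -/Y /K; field; rewrite !gt_eqF//.
pose b (q : cell j) : nat := match q with
  | inl c => if boundary_sel R c then (K0 * K0)%N else 0%N
  | inr (k, c) => if interior_sel R k c then Num.trunc (D * 2 ^+ k * Y ^+ 2) else 0%N end.
have count (F : seq (cell j * nat)) : uniq F -> (forall x, x \in F -> I3 x) -> (size F <= \sum_q b q)%N.
  move=> uF FI; apply: (size_fibers (A := J3) uF) => //.
  have vac (P : bool) (G : seq nat) : (forall m, m \in G -> P) -> ~~ P -> (size G <= 0)%N.
    by case: G => // m G h /negP[]; apply: (h m); rewrite mem_head.
  move=> [c|[k c]] G uG hG; rewrite /b.
    case: ifPn => [_|ns]; last by apply: (vac (boundary_sel R c)) => // m /hG[].
    by apply: size_lt_bound => // m /hG[].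
  case: ifPn => [_|ns]; last by apply: (vac (interior_sel R k c)) => // m /hG[].
  rewrite truncn_ge_nat; last first.
    by rewrite mulr_ge0 ?sqr_ge0// mulr_ge0 ?exprn_ge0// ltW.
  have k1 : 1 <= 2 ^+ k :> R by rewrite exprn_ege1// ler1n.
  by apply: (size_lattice k1 K6 Y1 Ct0 hC uG) => m /hG[].
have [fin3 card3] := finite_by_seq count.
(* The boundary layer gives order [rad * L^2]. The [j <= L] scales give order [rad * Y^2] each, in
   total [rad * L^(1 + 2 s)], which also dominates the first term. *)
have sum_b : (\sum_q b q)%N%:R <= c0 * ((N%:R + 1) ^+ 2 + D) * rad * L `^ (1 + 2 * s).
  rewrite natr_sum big_sumType /=.
  have b1 : \sum_(c : 'I_(grid_radius j).*2.+1 * 'I_(grid_radius j).*2.+1) (b (inl c))%:R <= c0 * rad * ((N%:R + 1) * L) ^+ 2.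
    rewrite (eq_bigr (fun c => if boundary_sel R c then (K0 * K0)%:R else 0)); last first.
      by move=> c _; rewrite /b; case: ifP.
    rewrite sum_if_card; apply: ler_pM => //.
    by rewrite natrM -expr2 lerXn2r ?nnegrE// (le_trans _ K0X).
  have b2 : \sum_(i : 'I_j * ('I_(grid_radius j).*2.+1 * 'I_(grid_radius j).*2.+1)) (b (inr i))%:R <= L * (c0 * rad * (D * Y ^+ 2)).
    have DY : 0 <= D * Y ^+ 2 by rewrite mulr_ge0 ?sqr_ge0// ltW.
    have -> : \sum_(i : 'I_j * ('I_(grid_radius j).*2.+1 * 'I_(grid_radius j).*2.+1)) (b (inr i))%:R =
        \sum_(k < j) \sum_c (b (inr (k, c)))%:R :> R.
      by rewrite (pair_bigA _ (fun k c => (b (inr (k, c)))%:R)); apply: eq_bigr => -[].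
    apply: (@le_trans _ _ (\sum_(k < j) c0 * rad * (D * Y ^+ 2))).
      apply: ler_sum => k _.
      apply: (@le_trans _ _ (\sum_c (if interior_sel R k c then D * 2 ^+ k * Y ^+ 2 else 0))).
        apply: ler_sum => c _; rewrite /b; case: ifP => // _; rewrite truncn_le.
        by rewrite mulr_ge0 ?sqr_ge0// mulr_ge0 ?exprn_ge0// ltW.
      rewrite sum_if_card; have -> : #|finset (interior_sel R k)|%:R * (D * 2 ^+ k * Y ^+ 2) =
        #|finset (interior_sel R k)|%:R * 2 ^+ k * (D * Y ^+ 2) by ring.
      by apply: ler_wpM2r => //; exact: (ci j k).
    rewrite sumr_const card_ord -[leLHS]mulr_natl; apply: ler_wpM2r; last exact: jL.
    by apply: mulr_ge0 DY; apply: mulr_ge0; [exact: ltW|exact: le_trans ler01 rad1].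
  apply: le_trans (lerD b1 b2) _.
  have L0 : 0 < L by lra.
  have LY : L * Y ^+ 2 = L `^ (1 + 2 * s).
    rewrite powRD; last by rewrite (gt_eqF L0) implybT.
    by rewrite powRr1 ?(ltW L0)// [2 * s]mulrC powRrM powR_mulrn ?powR_ge0.
  have LL : L ^+ 2 <= L `^ (1 + 2 * s).
    by rewrite -powR_mulrn ?(ltW L0)//; apply: ler_powR; lra.
  have -> : c0 * rad * ((N%:R + 1) * L) ^+ 2 = c0 * rad * (N%:R + 1) ^+ 2 * L ^+ 2 by ring.
  have -> : L * (c0 * rad * (D * Y ^+ 2)) = c0 * rad * D * (L * Y ^+ 2) by ring.
  have -> : c0 * ((N%:R + 1) ^+ 2 + D) * rad * L `^ (1 + 2 * s) =
    c0 * rad * (N%:R + 1) ^+ 2 * L `^ (1 + 2 * s) + c0 * rad * D * L `^ (1 + 2 * s) by ring.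
  have rp : 0 <= c0 * rad by apply: mulr_ge0; [exact: ltW|exact: le_trans ler01 rad1].
  by rewrite LY lerD2r; apply: ler_wpM2l => //; rewrite mulr_ge0// sqr_ge0.
(* Taking [I1] as the complement makes it absorb the zero functions of the unselected cells. *)
exists (~` (I2 `|` I3)), I2, I3; split.
- by rewrite -setUA setvU.
- split => //.
    by rewrite -subset0 => nu [h1 h2]; apply: h1; left.
  by rewrite -subset0 => nu [h1 h2]; apply: h1; right.
- pose W := C0 * rad ^+ 6 * 2 `^ (- X).
  have W0 : 0 <= W.
    have r6 : 0 <= rad ^+ 6 by rewrite exprn_ge0//; lra.
    by rewrite /W mulr_ge0 ?powR_ge0// mulr_ge0// ltW.
  (* Each of the two sums is bounded as if it ran over all cells; this doubles the 32 of [card_cell]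
     to the 64 of [energy_absorb]. *)
  apply: (@le_trans _ _ ((#|cell j|%:R * W)%:E + (#|cell j|%:R * W)%:E)%E).
    apply: leeD; apply: esum_cells_le => // -[q m] /= h.
      apply: (En q m false); first by move=> h3; apply: h; right.
      by move=> h2; apply: h; left.
    apply: (En q m true) => // h3.
    have : (I2 `&` I3) (q, m) by [].
    by rewrite I23.
  rewrite -EFinD lee_fin; have hc := card_cell R j1; rewrite -/rad in hc.
  have rad2 : 2 <= rad by rewrite -[leLHS]expr1 /rad; apply: ler_weXn2l => //; lra.
  apply: (@le_trans _ _ (64 * rad ^+ 3 * W)); first by have := ler_wpM2r W0 hc; lra.
  by rewrite /W powE; exact: energy_absorb.
- exact: fin3.
- apply: (@le_trans _ _ (\sum_q b q)%N%:R); first by rewrite ler_nat.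
  exact: sum_b.
Qed.

End Partition.

(** * Support in the disk and the frame bounds *)

Section Frame.
Variables (R : realType) (j : nat) (s : R).
Hypothesis s1 : 1 < s.
Notation T := (R * R)%type.
Notation mu := (@leb2 R).
Notation rad := (2 ^+ j : R).
Local Open Scope complex_scope.

Lemma psi_cell_L2disk (q : cell j) m : L2disk rad (psi_cell s q m).
Proof.
have z : L2disk rad (fun=> 0 : R[i]) by split => //; exact: L2plane0.
case: q => [c|[k c]] /=.
  case: ifPn => // sel; split.
    by have [h _ _] := poly_sys_ortho (boundary_cell_measurable c) (@boundary_cell_near R j c).
  by move=> x nd; apply: poly_sys_supp => -[].
case: ifPn => // /andP[i1 i2].
have l0 : 0 < 2 ^+ k :> R by rewrite exprn_gt0.
split; first exact: wave_packet_L2.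
move=> x nd; apply: (wave_packet_supp s1 l0) => -[/=]; rewrite !in_itv/= => h1 h2; apply: nd.
have nb : enorm2 (x - interior_ctr R k c) <= 3 / 2 * 2 ^+ k.
  by apply: enorm2_box; rewrite ler_norml; apply/andP; split; move: h1 h2 => /andP[? ?] /andP[? ?] /=; lra.
have := enorm2_dist x (interior_ctr R k c); rewrite ler_norml => nd.
have ec : enorm2 (interior_ctr R k c) = 2 ^+ k * enorm2 (lattice_pt R c) by rewrite /interior_ctr enorm2Z// ltW.
have r1 : 2 * 2 ^+ k <= rad - 2 ^+ k * enorm2 (lattice_pt R c).
  have -> : rad - 2 ^+ k * enorm2 (lattice_pt R c) = (rad / 2 ^+ k - enorm2 (lattice_pt R c)) * 2 ^+ k by field; rewrite gt_eqF.
  by rewrite ler_pM2r.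
by rewrite /disk /=; move: nd; rewrite ec => nd; lra.
Qed.

Lemma cell_weight_measurable (q : cell j) : measurable_fun setT (cell_weight s q).
Proof.
rewrite /cell_weight; case: q => [c|[k c]].
  case: (boundary_sel R c); last exact: measurable_cst.
  by apply: measurable_indic; exact: boundary_cell_measurable.
case: (interior_sel R k c); last exact: measurable_cst.
by apply: measurable_funX; apply: window_measurable => //; rewrite exprn_gt0.
Qed.

Lemma psi_cell_parseval (q : cell j) f : L2plane f ->
  (\sum_(0 <= m <oo) (nsq (inner2 f (psi_cell s q m)))%:E = \int[mu]_x (cell_weight s q x * nsq (f x))%:E)%E.
Proof.
move=> hf.
have zero : (\sum_(0 <= m <oo) (nsq (inner2 f (fun=> 0)))%:E = \int[mu]_x (0 * nsq (f x))%:E :> \bar R)%E.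
  under [RHS]eq_integral do rewrite mul0r.
  rewrite integral0 eseries0// => m _ _; rewrite /inner2; under eq_fun do rewrite conjc0 mulr0.
  by rewrite /cintegral /Rintegral/= integral0 /nsq/= expr0n addr0.
rewrite /psi_cell /cell_weight; case: q => [c|[k c]]; last first.
  by case: (interior_sel R k c) => //; apply: wave_packet_parseval => //; rewrite exprn_gt0.
case: (boundary_sel R c) => //.
have mE := @boundary_cell_measurable R j c; have nE := @boundary_cell_near R j c.
pose w := (\1_(boundary_cell c) : T -> R).
have mw : measurable_fun setT w by apply: measurable_indic; exact: mE.
have w1 x : `|w x| <= 1 by rewrite /w indicE ger0_norm ?ler0n// (ler_nat R _ 1) leq_b1.
have gL2 := weight_L2 mw w1 hf.
rewrite (eq_eseriesr (g := fun m => (nsq (inner2 (fun x => (w x)%:C * f x) (poly_sys (boundary_cell c) (lattice_pt R c) m)))%:E)).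
  rewrite (poly_parseval mE nE gL2); last by move=> x nx; rewrite /w indicE memNset// mul0r.
  rewrite -L2sqnormE// L2sqnorm_weight; apply: eq_integral => x _.
  by rewrite /w indicE -natrX; case: (_ \in _).
move=> m _; rewrite -inner2_weight; congr ((nsq (inner2 f _))%:E); apply/funext => x.
have [Ex|nE'] := pselect (boundary_cell c x); first by rewrite /w indicE mem_set// mul1r.
have -> : poly_sys (boundary_cell c) (lattice_pt R c) m x = 0 by exact: poly_sys_supp.
by rewrite mulr0.
Qed.

Lemma psi_frame : is_frame (L2disk rad) (fun nu : cell j * nat => psi_cell s nu.1 nu.2) 1 49.
Proof.
split; [lra|by move=> nu; exact: psi_cell_L2disk|move=> f [hf f0]].
have -> : (\esum_(nu in [set: cell j * nat]) (Normc.normc (inner2 f (psi_cell s nu.1 nu.2)) ^+ 2)%:E =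
    \int[mu]_x ((\sum_(q : cell j) cell_weight s q x) * nsq (f x))%:E)%E.
  rewrite esum_finprod; last by move=> nu; rewrite lee_fin sqr_ge0.
  rewrite (eq_bigr (fun q => \int[mu]_x (cell_weight s q x * nsq (f x))%:E)%E); last first.
    move=> q _; rewrite -psi_cell_parseval//; apply: eq_eseriesr => m _; congr EFin; exact: nsqE.
  rewrite -ge0_integral_sum//.
  - by apply: eq_integral => x _; rewrite sumEFin mulr_suml.
  - move=> q; apply/measurable_EFinP; apply: measurable_funM; first exact: cell_weight_measurable.
    by case: hf => m1 m2 _; apply: measurable_funD; exact: measurable_funX.
  - by move=> q x _; rewrite lee_fin mulr_ge0 ?cell_weight_ge0 ?nsq_ge0.
have W0 x : 0 <= \sum_(q : cell j) cell_weight s q x :> R by apply: sumr_ge0 => q _; exact: cell_weight_ge0.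
have Lf : (L2sqnorm setT f = \int[mu]_x (nsq (f x))%:E)%E by apply: eq_integral => x _; rewrite nsqE.
have mn : measurable_fun setT (fun x => (nsq (f x))%:E).
  apply/measurable_EFinP; case: hf => m1 m2 _.
  by apply: measurable_funD; exact: measurable_funX.
rewrite Lf; split.
  rewrite mul1e; apply: ge0_le_integral_sub => x; last by rewrite lee_fin mulr_ge0 ?nsq_ge0.
  move=> _; rewrite !lee_fin nsq_ge0/=.
  have [dx|dx] := pselect (disk rad x); last by rewrite f0// /nsq/= expr0n addr0 mulr0.
  rewrite ler_peMl ?nsq_ge0//; have [q <-] := cell_weight_cover s1 dx.
  by rewrite (bigD1 q)//= lerDl sumr_ge0// => i _; exact: cell_weight_ge0.
rewrite -ge0_integralZl ?lee_fin//; last by move=> x _; rewrite lee_fin nsq_ge0.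
apply: ge0_le_integral_sub => x; last by rewrite -EFinM lee_fin mulr_ge0 ?nsq_ge0.
move=> _; rewrite -EFinM !lee_fin mulr_ge0 ?nsq_ge0//= ler_wpM2r ?nsq_ge0//.
exact: cell_weight_overlap.
Qed.

End Frame.

Theorem theorem1p2 (R : realType) :
  exists A B : R, 0 < A /\ A < B /\
  exists (I : nat -> R -> choiceType)
         (psi : forall (j : nat) (s : R), I j s -> R * R -> R[i]),
    (forall (j : nat) (s : R), (1 <= j)%N -> 1 < s ->
       is_frame (L2disk (2 ^+ j)) (psi j s) A B) /\
    (forall (S : set (R * R)), well_shaped S ->
     forall s : R, 1 < s ->
     exists2 C : R, 0 < C &
     forall (j : nat) (eps : R), (1 <= j)%N -> 0 < eps < 1 / 2 ->
     exists I1 I2 I3 : set (I j s),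
       [/\ I1 `|` I2 `|` I3 = setT,
           [/\ I1 `&` I2 = set0, I1 `&` I3 = set0 & I2 `&` I3 = set0],
           (\esum_(nu in I1) L2sqnorm S (fourier2 (psi j s nu)) +
            \esum_(nu in I2) L2sqnorm (~` S) (fourier2 (psi j s nu)) <=
            (eps ^+ 2)%:E)%E,
           finite_set I3 &
           (#|` fset_set I3|)%:R <=
             C * 2 ^+ j * (log2 (2 ^+ j / eps)) `^ (1 + 2 * s)]).
Proof.
exists 1, 49; split; [lra|split; [lra|]].
exists (fun j (_ : R) => (cell j * nat)%type), (fun j s nu => psi_cell s nu.1 nu.2); split.
  by move=> j s _ s1; exact: psi_frame.
by move=> S wS s s1; exact: cell_partition.
Qed.
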